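(* Let $N\ge 1$, let $Q,B$ be real $N\times N$ matrices with $Q=Q^\star\ge 0$ such that $K(t)$ is invertible for every $t>0$, and assume $\operatorname{tr}B\ge0$. For every $0<s<1$ and $1\le p<\infty$, the space $C_0^\infty$ is dense in $\mathfrak B^{\mathscr A}_{s,p}$, i.e. $$\overline{C^\infty_0}^{\,\mathfrak B^{\mathscr A}_{s,p}}=\mathfrak B^{\mathscr A}_{s,p}.$$
   Context: Here $Q,B$ are the constant coefficients of the operator $\mathscr A u=\operatorname{tr}(Q\nabla^2u)+\langle BX,\nabla u\rangle$ on $\mathbb R^N$, and $K(t)=\frac1t\int_0^t e^{sB}Qe^{sB^\star}\,ds$ for $t>0$ ($^\star$ denotes transpose). Functions are real-valued on $\mathbb R^N$, $L^p=L^p(\mathbb R^N)$ with norm $\|\cdot\|_p$; $C_0^\infty$ denotes the smooth compactly supported functions on $\mathbb R^N$. For $X,Y\in\mathbb R^N$, $t>0$, $$p(X,Y,t)=\frac{(4\pi)^{-N/2}}{\sqrt{\det(tK(t))}}\exp\Big(-\frac{\langle K(t)^{-1}(Y-e^{tB}X),\,Y-e^{tB}X\rangle}{4t}\Big).$$ For $s>0$ and $1\le p<\infty$, $$\mathscr N^{\mathscr A}_{s,p}(f)=\Big(\int_0^\infty \frac{1}{t^{\frac{sp}{2}+1}}\int_{\mathbb R^N}\int_{\mathbb R^N}p(X,Y,t)|f(Y)-f(X)|^p\,dY\,dX\,dt\Big)^{1/p},$$ and $\mathfrak B^{\mathscr A}_{s,p}$ is the set of $f\in L^p$ with $\mathscr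 N^{\mathscr A}_{s,p}(f)<\infty$. Convergence $f_n\to f$ in $\mathfrak B^{\mathscr A}_{s,p}$ means that $\|f_n-f\|_p\to0$ and $\mathscr N^{\mathscr A}_{s,p}(f_n-f)\to0$ (equivalently, convergence in the norm $\|\cdot\|_p+\mathscr N^{\mathscr A}_{s,p}(\cdot)$). It is known that $C_0^\infty\subset\mathfrak B^{\mathscr A}_{s,p}$ for $0<s<1$, $1\le p<\infty$. *)

(* Defs.v *)
From HB Require Import structures.
From mathcomp Require Import all_boot all_order all_algebra.
From mathcomp Require Import all_classical all_reals all_analysis.
From mathcomp Require Import measurable_realfun.

Set Implicit Arguments.
Unset Strict Implicit.
Unset Printing Implicit Defensive.
Import Order.TTheory GRing.Theory Num.Theory.
Import numFieldNormedType.Exports.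

Local Open Scope classical_set_scope.
Local Open Scope ring_scope.

(* 'M[T]_(m, n) carries the product sigma-algebra generated by the coordinates,
   as n.-tuple T does in the library; for T = R this is the Borel sigma-algebra
   (measurable_matrixE below). *)
Definition measure_matrix_display : measure_display -> measure_display.
Proof. exact. Qed.

Section measurable_matrix.
Context {d} {T : measurableType d} (m n : nat).

Definition g_sigma_coord : set (set 'M[T]_(m, n)) :=
  <<s \bigcup_(ij in [set: 'I_m * 'I_n])
        preimage_set_system setT (fun M : 'M[T]_(m, n) => M ij.1 ij.2)
          measurable >>.

Let matrix_set0 : g_sigma_coord set0.
Proof. exact: sigma_algebra0. Qed.

Let matrix_setC A : g_sigma_coord A -> g_sigma_coord (~` A).
Proof. exact: sigma_algebraC. Qed.

Let matrix_bigcup (F : _^nat) : (forall i, g_sigma_coord (F i)) ->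
  g_sigma_coord (\bigcup_i (F i)).
Proof. exact: sigma_algebra_bigcup. Qed.

HB.instance Definition _ := @isMeasurable.Build (measure_matrix_display d)
  'M[T]_(m, n) g_sigma_coord matrix_set0 matrix_setC matrix_bigcup.

Lemma measurable_coord (i : 'I_m) (j : 'I_n) :
  measurable_fun setT (fun M : 'M[T]_(m, n) => M i j).
Proof.
move=> _ Y mY; rewrite setTI; apply: sub_sigma_algebra.
by exists (i, j) => //; exists Y => //; rewrite setTI.
Qed.

Lemma measurable_fun_matrixP d' (T' : measurableType d')
    (f : T' -> 'M[T]_(m, n)) :
  measurable_fun setT f <->
  forall i j, measurable_fun setT (fun x => f x i j).
Proof.
split=> [mf i j|mf].
  exact: (measurableT_comp (measurable_coord i j) mf).
apply: measurability => //.
move=> _ [_ [[i j] _ [A mA <-]] <-].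
rewrite setTI; move: (mf i j measurableT A mA).
by rewrite !setTI.
Qed.

End measurable_matrix.

Section borel_matrix.
Context {R : realType} (m n : nat).

Let box (ab : 'I_m * 'I_n -> rat * rat) : set 'M[R]_(m, n) :=
  [set X | forall ij, ratr (ab ij).1 < X ij.1 ij.2 < ratr (ab ij).2].

Let open_box (M : 'M[R]_(m, n)) (U : set 'M[R]_(m, n)) : open U -> U M ->
  exists ab : {ffun 'I_m * 'I_n -> rat * rat}, box ab M /\ box ab `<=` U.
Proof.
rewrite openE => /(_ M) + UM => /(_ UM) [P MP PU].
have /choice[h hP] : forall ij : 'I_m * 'I_n, exists q : rat * rat,
    (ratr q.1 < M ij.1 ij.2 < ratr q.2) /\
    [set x : R | ratr q.1 < x < ratr q.2] `<=` P ij.1 ij.2.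
  move=> [i j] /=.
  have /nbhs_ballP[e /= e0 eP] := MP i j.
  have [a] : exists q : rat, (ratr q : R) \in `](M i j - e), (M i j)[.
    by have [|q] := @rat_in_itvoo R (M i j - e) (M i j);
      [rewrite ltrBlDr ltrDl|exists q].
  rewrite in_itv /= => /andP[a1 a2].
  have [b] : exists q : rat, (ratr q : R) \in `](M i j), (M i j + e)[.
    by have [|q] := @rat_in_itvoo R (M i j) (M i j + e);
      [rewrite ltrDl|exists q].
  rewrite in_itv /= => /andP[b1 b2].
  exists (a, b); split=> /=; first by rewrite a2 b1.
  move=> x /= /andP[ax xb]; apply: eP; rewrite /ball /= distrC ltr_distl.
  by rewrite (lt_trans a1 ax) (lt_trans xb b2).
exists [ffun ij => h ij]; split=> [ij|X XM].
  by rewrite ffunE; have [] := hP ij.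
apply: PU => i j; have [_] := hP (i, j); apply.
by have /= := XM (i, j); rewrite ffunE.
Qed.

Lemma open_measurable_matrix (U : set 'M[R]_(m, n)) : open U -> measurable U.
Proof.
move=> oU.
pose F (ab : {ffun 'I_m * 'I_n -> rat * rat}) :=
  if `[< box ab `<=` U >] then box ab else set0.
have -> : U = \bigcup_(ab in setT) F ab.
  apply/seteqP; split=> [M UM|M [ab _]].
    have [ab [Mab abU]] := open_box oU UM.
    by exists ab => //; rewrite /F asboolT.
  by rewrite /F; case: asboolP => // /[apply].
apply: countable_bigcupT_measurable; first exact: countableP.
move=> ab; rewrite /F; case: ifPn => // _.
have -> : box ab = \bigcap_(ij in [set: 'I_m * 'I_n])
    ((fun M : 'M[R]_(m, n) => M ij.1 ij.2) @^-1`
      `](ratr (ab ij).1), (ratr (ab ij).2)[%classic).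
  apply/seteqP; split=> [X XP ij _ /=|X XP ij].
    by rewrite in_itv /=; exact: XP.
  by have /= := XP ij Logic.I; rewrite in_itv.
apply: fin_bigcap_measurable => // ij _.
rewrite -[X in measurable X]setTI.
by apply: measurable_coord => //; exact: measurable_itv.
Qed.

Lemma measurable_matrixE :
  @measurable _ 'M[R]_(m, n) = <<s [set U : set 'M[R]_(m, n) | open U] >>.
Proof.
apply/seteqP; split; last first.
  apply: smallest_sub; first exact: sigma_algebra_measurable.
  exact: open_measurable_matrix.
apply: smallest_sub; first exact: smallest_sigma_algebra.
move=> _ [[i j] _ [A mA <-]] /=; rewrite setTI.
pose B := [set A : set R | <<s [set U : set 'M[R]_(m, n) | open U] >>
  ((fun M : 'M[R]_(m, n) => M i j) @^-1` A)].
suff : (@ocitv R).-sigma.-measurable `<=` B by exact.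
rewrite RGenOInfty.measurableE; apply: smallest_sub.
  split; rewrite /B /=.
  - by rewrite preimage_set0; exact: sigma_algebra0.
  - by move=> C ?; rewrite setTD preimage_setC; exact: sigma_algebraC.
  - by move=> F ?; rewrite preimage_bigcup; exact: sigma_algebra_bigcup.
move=> _ [x ->]; apply: sub_sigma_algebra => /=.
apply: open_comp; last exact: rray_open.
by move=> M _; exact: coord_continuous.
Qed.

End borel_matrix.

Section lebesgue_cons.
Local Open Scope ereal_scope.
Context {R : realType} (n : nat).

Definition cV_cons (xv : R * 'cV[R]_n) : 'cV[R]_n.+1 :=
  col_mx (xv.1)%:M xv.2.

Definition cV_uncons (v : 'cV[R]_n.+1) : R * 'cV[R]_n :=
  (v ord0 ord0, \col_i v (lift ord0 i) ord0).

Lemma cV_cons0 xv : cV_cons xv ord0 ord0 = xv.1.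
Proof.
have E : (xv.1)%:M ord0 (ord0 : 'I_1) = xv.1 by rewrite mxE eqxx mulr1n.
rewrite -[RHS]E -(@col_mxEu R 1 n 1 (xv.1)%:M xv.2 ord0 ord0) /cV_cons.
by congr (fun_of_matrix _ _ _); exact: val_inj.
Qed.

Lemma cV_consS xv i : cV_cons xv (lift ord0 i) ord0 = xv.2 i ord0.
Proof.
rewrite -(@col_mxEd R 1 n 1 (xv.1)%:M xv.2 i ord0) /cV_cons.
by congr (fun_of_matrix _ _ _); exact: val_inj.
Qed.

Lemma cV_consK : cancel cV_cons cV_uncons.
Proof.
move=> [x v]; rewrite /cV_uncons cV_cons0; congr (_, _).
by apply/colP => i; rewrite mxE cV_consS.
Qed.

Lemma measurable_cV_cons : measurable_fun setT cV_cons.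
Proof.
apply/measurable_fun_matrixP => i j; rewrite (ord1 j).
have [->|[k ->]] : i = ord0 \/ exists k, i = lift ord0 k.
  by case: (unliftP ord0 i) => [k ->|->]; [right; exists k|left].
  by under eq_fun do rewrite cV_cons0; exact: measurable_fst.
under eq_fun do rewrite cV_consS.
apply: (measurableT_comp (f := fun v : 'cV[R]_n => v k ord0)) => //.
exact: measurable_coord.
Qed.

Lemma measurable_cV_uncons : measurable_fun setT cV_uncons.
Proof.
apply/measurable_fun_pairP; split => /=; first exact: measurable_coord.
apply/measurable_fun_matrixP => i j /=.
by under eq_fun do rewrite mxE; exact: measurable_coord.
Qed.

Variable mu : {sigma_finite_measure set 'cV[R]_n -> \bar R}.

Definition lebesgue_cons : set 'cV[R]_n.+1 -> \bar R :=
  pushforward (@lebesgue_measure R \x mu) cV_cons.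

Let lebesgue_cons0 : lebesgue_cons set0 = 0.
Proof. by rewrite /lebesgue_cons /pushforward preimage_set0 measure0. Qed.

Let lebesgue_cons_ge0 A : 0 <= lebesgue_cons A.
Proof. by rewrite /lebesgue_cons /pushforward; apply: measure_ge0. Qed.

Let mpreim A : measurable A -> measurable (cV_cons @^-1` A).
Proof. by move=> mA; rewrite -[X in measurable X]setTI; exact: measurable_cV_cons. Qed.

Let lebesgue_cons_sigma_additive : semi_sigma_additive lebesgue_cons.
Proof.
move=> F mF tF mUF; rewrite /lebesgue_cons /pushforward preimage_bigcup.
apply: measure_semi_sigma_additive.
- by move=> k; exact: mpreim.
- apply/trivIsetP => /= i j _ _ ij; rewrite -preimage_setI.
  by move/trivIsetP : tF => /(_ _ _ _ _ ij) ->//; rewrite preimage_set0.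
- by rewrite -preimage_bigcup; exact: mpreim.
Qed.

HB.instance Definition _ := isMeasure.Build _ _ _ lebesgue_cons
  lebesgue_cons0 lebesgue_cons_ge0 lebesgue_cons_sigma_additive.

Let lebesgue_cons_sigma_finite : sigma_finite setT lebesgue_cons.
Proof.
have /sigma_finiteP[F [TF ndF Foo]] := sigma_finiteT (@lebesgue_measure R).
have /sigma_finiteP[G [TG ndG Goo]] := sigma_finiteT mu.
exists (fun k => cV_uncons @^-1` (F k `*` G k)).
  apply/seteqP; split=> // v _.
  have [i _ Fi] : (\bigcup_i F i) (cV_uncons v).1 by rewrite -TF.
  have [j _ Gj] : (\bigcup_i G i) (cV_uncons v).2 by rewrite -TG.
  exists (maxn i j) => //; split.
  - by move: Fi; exact/subsetPset/ndF/leq_maxl.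
  - by move: Gj; exact/subsetPset/ndG/leq_maxr.
move=> k; have [mF Fk] := Foo k; have [mG Gk] := Goo k; split.
  rewrite -[X in measurable X]setTI.
  by apply: measurable_cV_uncons => //; exact: measurableX.
rewrite /lebesgue_cons /pushforward -comp_preimage.
have -> : cV_uncons \o cV_cons = id by apply/funext => x /=; rewrite cV_consK.
rewrite preimage_id product_measure1E//.
by rewrite lte_mul_pinfty// ge0_fin_numE.
Qed.

HB.instance Definition _ := Measure_isSigmaFinite.Build _ _ _ lebesgue_cons
  lebesgue_cons_sigma_finite.

End lebesgue_cons.

(* N-dimensional Lebesgue measure on the Borel sets of R^N = 'cV[R]_N, as an
   iterated product of the one-dimensional one; R^0 is a single point of mass 1.
   lebesgue_cV_box gives its characteristic value on boxes. *)
Fixpoint lebesgue_cV (R : realType) (n : nat) :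
    {sigma_finite_measure set 'cV[R]_n -> \bar R} :=
  match n with
  | 0 => \d_(0 : 'cV[R]_0)
  | n'.+1 => lebesgue_cons (lebesgue_cV R n')
  end.

Lemma lebesgue_cV_box (R : realType) (n : nat) (A : 'I_n -> set R) :
  (forall i, measurable (A i)) ->
  lebesgue_cV R n [set v | forall i, A i (v i ord0)] =
  (\prod_(i < n) lebesgue_measure (A i))%E.
Proof.
elim: n A => [|n IH] A mA /=.
  by rewrite big_ord0 diracE mem_set// => -[].
rewrite big_ord_recl /= -IH// /lebesgue_cons /pushforward.
have mB : measurable [set v : 'cV[R]_n | forall i, A (lift ord0 i) (v i ord0)].
  pose B (i : 'I_n) := (fun v : 'cV[R]_n => v i ord0) @^-1` A (lift ord0 i).
  rewrite [X in measurable X](_ : _ = \bigcap_(i in [set: 'I_n]) B i).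
    apply: fin_bigcap_measurable => // i _.
    by rewrite -[X in measurable X]setTI; exact: measurable_coord.
  by apply/seteqP; split=> [v vA i _|v vA i]; [exact: vA|exact: (vA i)].
rewrite -product_measure1E; [|exact: mA|exact: mB].
congr (_ _); apply/seteqP; split=> [xv xvA|xv [x0 xS] i] /=.
  split=> [|i] /=; first by have := xvA ord0; rewrite cV_cons0.
  by have := xvA (lift ord0 i); rewrite cV_consS.
by case: (unliftP ord0 i) => [k ->|->]; rewrite ?cV_consS ?cV_cons0.
Qed.

Definition dotcv (R : realType) (N : nat) (u v : 'cV[R]_N) : R :=
  \sum_(i < N) u i ord0 * v i ord0.

Definition expmx (R : realType) (N : nat) (A : 'M[R]_N) : 'M[R]_N :=
  limn (series (fun k => (k`!%:R : R)^-1 *: A ^+ k)).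

Section kolmogorov.
Context {R : realType} {N : nat}.
Implicit Types (Q B : 'M[R]_N) (X Y : 'cV[R]_N) (f : 'cV[R]_N -> R).

Definition covmx Q B (t : R) : 'M[R]_N :=
  t^-1 *: \matrix_(i, j)
    \int[lebesgue_measure]_(s in `[0, t])
      (expmx (s *: B) *m Q *m expmx (s *: B^T)) i j.

Definition transition_kernel Q B X Y (t : R) : R :=
  let Z := Y - expmx (t *: B) *m X in
  (4 * pi) `^ (- (N%:R / 2)) / Num.sqrt (\det (t *: covmx Q B t)) *
  expR (- (dotcv (invmx (covmx Q B t) *m Z) Z / (4 * t))).

(* The seminorm takes values in \bar R: it may be +oo. *)
Definition besov_seminorm Q B (s p : R) f : \bar R :=
  ((\int[lebesgue_measure]_(t in `]0%R, +oo[)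
      ((t `^ (s * p / 2 + 1))^-1%:E *
       \int[lebesgue_cV R N]_X \int[lebesgue_cV R N]_Y
         (transition_kernel Q B X Y t * `|f Y - f X| `^ p)%:E))
   `^ p^-1)%E.

(* Elements are Borel representatives, not classes modulo a.e. equality; the
   L^p norm and the seminorm only depend on the class. *)
Definition besov_space Q B (s p : R) : set ('cV[R]_N -> R) :=
  [set f | f \in Lfun (lebesgue_cV R N) p%:E /\
           (besov_seminorm Q B s p f < +oo)%E].

Definition besov_cvg Q B (s p : R) (u : nat -> 'cV[R]_N -> R) f : Prop :=
  (Lnorm (lebesgue_cV R N) p%:E (EFin \o (u n \- f)) @[n --> \oo] --> 0%E) /\
  (besov_seminorm Q B s p (u n \- f) @[n --> \oo] --> 0%E).

(* The closure in the space normed by the L^p norm plus the seminorm, hence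
   sequential. *)
Definition besov_closure Q B (s p : R) (S : set ('cV[R]_N -> R)) :
    set ('cV[R]_N -> R) :=
  [set f | besov_space Q B s p f /\
    exists2 u : nat -> 'cV[R]_N -> R,
      forall n, S (u n) & besov_cvg Q B s p u f].

Definition iter_partial (l : seq 'I_N) f : 'cV[R]_N -> R :=
  foldr (fun i g => 'D_(delta_mx i ord0) g) f l.

(* All iterated partial derivatives, in any order, exist and are continuous. *)
Definition smooth f : Prop :=
  forall l : seq 'I_N, continuous (iter_partial l f) /\
    forall (i : 'I_N) X, derivable (iter_partial l f) X (delta_mx i ord0).

Definition Cc_smooth : set ('cV[R]_N -> R) :=
  [set f | smooth f /\ compact (closure [set X | f X != 0])].

End kolmogorov.

(* Main.v *)
(* Write f_n for the product of f by the cut-off (1 - |X| / n)^+, and u_n for the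
   convolution of f_n with a smooth bump of width eps_n, so that u_n is smooth
   with compact support and u_n -> f in L^p.  The t-integrand of the seminorm of
   u_n - f is, up to t ^ (- s p / 2 - 1), the p-energy of the kernel at time t.

   For every t > 0 this energy is at most 2 ^ (p + 1) ||u_n - f||_p ^ p, since
   p(X, ., t) has mass 1 and p(., Y, t) has mass exp (- t tr B) <= 1.  So the
   integrand tends to 0 pointwise, and it is dominated for large t.

   For small t the energies of f_n and u_n are bounded, uniformly in n, by that
   of f plus O(t ^ (p / 2)) ||f||_p ^ p: the cut-off is constant up to O(t) along
   the flow exp (t B), the kernel has p-th moment O(t ^ (p / 2)) about
   exp (t B) X, and convolution almost commutes with the kernel, because
   p(X + exp (- t B) h, Y + h, t) = p(X, Y, t) while exp (t B) distorts the bump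
   by O(t) in L^1.  As p / 2 - s p / 2 - 1 > -1 this bound is integrable near
   t = 0, and dominated convergence applies. *)
From HB Require Import structures.
Require Import Defs.
From mathcomp Require Import all_boot all_order all_algebra.
From mathcomp Require Import all_classical all_reals all_analysis.
From mathcomp Require Import perm measurable_realfun zify ring lra.
Set Implicit Arguments.
Unset Strict Implicit.
Unset Printing Implicit Defensive.
Import Order.TTheory GRing.Theory Num.Theory.
Import numFieldNormedType.Exports HBSimple HBNNSimple.
Local Open Scope classical_set_scope.
Local Open Scope ring_scope.

Section measurable_matrix_ops.
Context {d} {T : measurableType d} {R : realType}.

Lemma measurable_mulmx (m n q : nat) (f : T -> 'M[R]_(m, n))
    (g : T -> 'M[R]_(n, q)) :
  measurable_fun setT f -> measurable_fun setT g ->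
  measurable_fun setT (fun x => f x *m g x).
Proof.
move=> /measurable_fun_matrixP mf /measurable_fun_matrixP mg.
apply/measurable_fun_matrixP => i j.
under eq_fun do rewrite mxE.
by apply: measurable_sum => k; exact: measurable_funM.
Qed.

Lemma measurable_addmx (m n : nat) (f g : T -> 'M[R]_(m, n)) :
  measurable_fun setT f -> measurable_fun setT g ->
  measurable_fun setT (fun x => f x + g x).
Proof.
move=> /measurable_fun_matrixP mf /measurable_fun_matrixP mg.
apply/measurable_fun_matrixP => i j.
under eq_fun do rewrite mxE.
exact: measurable_funD.
Qed.

Lemma measurable_oppmx (m n : nat) (f : T -> 'M[R]_(m, n)) :
  measurable_fun setT f -> measurable_fun setT (fun x => - f x).
Proof.
move=> /measurable_fun_matrixP mf.
apply/measurable_fun_matrixP => i j.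
under eq_fun do rewrite mxE.
exact: measurableT_comp.
Qed.

Lemma measurable_scalemx (m n : nat) (a : T -> R) (f : T -> 'M[R]_(m, n)) :
  measurable_fun setT a -> measurable_fun setT f ->
  measurable_fun setT (fun x => a x *: f x).
Proof.
move=> ma /measurable_fun_matrixP mf.
apply/measurable_fun_matrixP => i j.
under eq_fun do rewrite mxE.
exact: measurable_funM.
Qed.

Lemma measurable_det (n : nat) (f : T -> 'M[R]_n) :
  measurable_fun setT f -> measurable_fun setT (fun x => \det (f x)).
Proof.
move=> /measurable_fun_matrixP mf.
apply: measurable_sum => s; apply: measurable_funM => //.
by apply: measurable_prod.
Qed.

Lemma measurable_adj (n : nat) (f : T -> 'M[R]_n) :
  measurable_fun setT f -> measurable_fun setT (fun x => \adj (f x)).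
Proof.
move=> /measurable_fun_matrixP mf.
apply/measurable_fun_matrixP => i j.
under eq_fun do rewrite mxE.
apply: measurable_funM => //; apply: measurable_det.
apply/measurable_fun_matrixP => k l.
under eq_fun do rewrite !mxE.
exact: mf.
Qed.

Lemma measurable_dotcv (n : nat) (f g : T -> 'cV[R]_n) :
  measurable_fun setT f -> measurable_fun setT g ->
  measurable_fun setT (fun x => dotcv (f x) (g x)).
Proof.
move=> /measurable_fun_matrixP mf /measurable_fun_matrixP mg.
by apply: measurable_sum => i; exact: measurable_funM.
Qed.

End measurable_matrix_ops.

Lemma measurable_invr {R : realType} : measurable_fun setT (fun x : R => x^-1).
Proof.
rewrite (_ : (fun _ => _) = fun x : R => x * (x ^+ 2) `^ (-1)).
  apply: measurable_funM => //.
  apply: (measurableT_comp (@measurable_powR R (-1)) (g := fun x : R => x ^+ 2)).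
  by apply: measurable_funX.
apply/funext => x; rewrite powR_inv1 ?sqr_ge0//.
have [->|x0] := eqVneq x 0; first by rewrite invr0 mul0r.
by rewrite expr2 invfM mulrA divff// mul1r.
Qed.

Lemma continuous_measurable_matrix {R : realType} (m n : nat)
    (f : 'M[R]_(m, n) -> R) : continuous f -> measurable_fun setT f.
Proof.
move=> /continuousP cf; apply: (measurability _ (RGenOpens.measurableE R)).
move=> _ [_ [a [b ->] <-]]; rewrite setTI; apply: open_measurable_matrix.
exact/cf/interval_open.
Qed.

Section lebesgue_affine.
Context {R : realType}.
Local Notation mu := (@lebesgue_measure R).
Local Open Scope ereal_scope.

Lemma integral_affine (a b : R) (g : R -> \bar R) : (0 < a)%R ->
  measurable_fun setT g -> (forall x, 0 <= g x) ->
  a%:E * \int[mu]_x g (a * x + b)%R = \int[mu]_x g x.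
Proof.
move=> a0 mg g0.
pose phi : measurableTypeR R -> measurableTypeR R := fun x => (a * x + b)%R.
have mphi : measurable_fun setT phi.
  by apply: measurable_funD => //; exact: measurable_funM.
pose k := NngNum (ltW a0).
pose phi_mixin := isMeasurableFun.Build _ _ _ _ _ mphi.
pose phi_pack : {mfun measurableTypeR R >-> measurableTypeR R} :=
  HB.pack phi phi_mixin.
transitivity (k%:num%:E * \int[pushforward mu phi_pack]_x g x).
  by congr (_ * _); rewrite ge0_integral_pushforward//= preimage_setT.
rewrite -ge0_integral_mscale//.
apply: eq_measure_integral => A mA _; apply/esym.
apply: lebesgue_measure_unique => // _ [[x y]] _ <- /=.
rewrite /mscale /= /pushforward.
rewrite [X in _ * mu X](_ : _ = `](x - b) / a, (y - b) / a]%classic)%R; last first.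
  apply/seteqP; split=> z; rewrite /= !in_itv/= /phi.
    by rewrite ltr_pdivrMr// ler_pdivlMr// (mulrC z) ltrBlDr lerBrDr.
  by rewrite ltr_pdivrMr// ler_pdivlMr// (mulrC z) ltrBlDr lerBrDr.
rewrite !lebesgue_measure_itv/= !lte_fin ltr_pM2r ?invr_gt0// ltrD2r.
case: ifPn => xy; rewrite ?mule0//.
rewrite -EFinM -EFinB; congr EFin.
by rewrite -mulrBl mulrC divfK ?gt_eqF//; ring.
Qed.

End lebesgue_affine.

Section lebesgue_cV_integral.
Context {R : realType}.
Local Notation mu := (@lebesgue_measure R).
Local Open Scope ereal_scope.

Lemma integral_cV_cons (n : nat) (g : 'cV[R]_n.+1 -> \bar R) :
  measurable_fun setT g -> (forall X, 0 <= g X) ->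
  \int[lebesgue_cV R n.+1]_X g X =
  \int[mu]_x \int[lebesgue_cV R n]_v g (cV_cons (x, v)).
Proof.
move=> mg g0.
rewrite [LHS]/= /lebesgue_cons.
have mc := @measurable_cV_cons R n.
pose mix := isMeasurableFun.Build _ _ _ _ _ mc.
pose pk : {mfun _ >-> _} := HB.pack (@cV_cons R n) mix.
transitivity (\int[pushforward (mu \x lebesgue_cV R n) pk]_X g X).
  by apply: eq_measure_integral.
rewrite ge0_integral_pushforward//= preimage_setT fubini_tonelli1//.
by apply: measurableT_comp.
Qed.

Lemma integral_cV_cons_swap (n : nat) (g : 'cV[R]_n.+1 -> \bar R) :
  measurable_fun setT g -> (forall X, 0 <= g X) ->
  \int[lebesgue_cV R n.+1]_X g X =
  \int[lebesgue_cV R n]_v \int[mu]_x g (cV_cons (x, v)).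
Proof.
move=> mg g0; rewrite integral_cV_cons//.
apply: (@fubini_tonelli _ _ _ _ R mu (lebesgue_cV R n) (fun z => g (cV_cons z))) => //.
by apply: measurableT_comp => //; exact: measurable_cV_cons.
Qed.

End lebesgue_cV_integral.

Section block_vectors.
Context {R : realType}.

Lemma cV_consE (n : nat) (X : 'cV[R]_n.+1) :
  exists x v, X = cV_cons (x, v).
Proof.
exists (X ord0 ord0), (\col_i X (lift ord0 i) ord0).
apply/colP => i.
by case: (unliftP ord0 i) => [k ->|->]; rewrite ?cV_consS ?cV_cons0 ?mxE.
Qed.

Lemma dotcv_cons (n : nat) (x y : R) (v w : 'cV[R]_n) :
  dotcv (cV_cons (x, v)) (cV_cons (y, w)) = x * y + dotcv v w.
Proof.
rewrite /dotcv big_ord_recl !cV_cons0; congr (_ + _).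
by apply: eq_bigr => i _; rewrite !cV_consS.
Qed.

Lemma dotcvE (n : nat) (u v : 'cV[R]_n) : dotcv u v = (u^T *m v) ord0 ord0.
Proof. by rewrite mxE; apply: eq_bigr => i _; rewrite mxE. Qed.

Lemma dotcvC (n : nat) (u v : 'cV[R]_n) : dotcv u v = dotcv v u.
Proof. by apply: eq_bigr => i _; rewrite mulrC. Qed.

Lemma dotcvDl (n : nat) (u v w : 'cV[R]_n) :
  dotcv (u + v) w = dotcv u w + dotcv v w.
Proof. by rewrite -big_split; apply: eq_bigr => i _; rewrite mxE mulrDl. Qed.

Lemma dotcvZl (n : nat) a (u v : 'cV[R]_n) : dotcv (a *: u) v = a * dotcv u v.
Proof. by rewrite mulr_sumr; apply: eq_bigr => i _; rewrite mxE mulrA. Qed.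

Lemma dotcvDr (n : nat) (u v w : 'cV[R]_n) :
  dotcv w (u + v) = dotcv w u + dotcv w v.
Proof. by rewrite !(dotcvC w) dotcvDl. Qed.

Lemma dotcvZr (n : nat) a (u v : 'cV[R]_n) : dotcv u (a *: v) = a * dotcv u v.
Proof. by rewrite !(dotcvC u) dotcvZl. Qed.

Lemma dotcvNl (n : nat) (u v : 'cV[R]_n) : dotcv (- u) v = - dotcv u v.
Proof. by rewrite -scaleN1r dotcvZl mulN1r. Qed.

Lemma dotcvNr (n : nat) (u v : 'cV[R]_n) : dotcv u (- v) = - dotcv u v.
Proof. by rewrite !(dotcvC u) dotcvNl. Qed.

Lemma dotcv_mulmx (n m : nat) (A : 'M[R]_(n, m)) u v :
  dotcv (A *m u) v = dotcv u (A^T *m v).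
Proof. by rewrite !dotcvE trmx_mul mulmxA. Qed.

Lemma dotcv_ge0 (n : nat) (u : 'cV[R]_n) : 0 <= dotcv u u.
Proof. by apply: sumr_ge0 => i _; rewrite -expr2 sqr_ge0. Qed.

Lemma dotcv_entry_le (n : nat) (A : 'M[R]_n) (c : R) X : (forall i j, `|A i j| <= c) ->
  `|dotcv (A *m X) X| <= c * n%:R * dotcv X X.
Proof.
move=> Ac.
apply: (@le_trans _ _ (\sum_i \sum_k c * ((X k ord0 ^+ 2 + X i ord0 ^+ 2) / 2))).
  rewrite (le_trans (ler_norm_sum _ _ _))//; apply: ler_sum => i _.
  rewrite mxE mulr_suml (le_trans (ler_norm_sum _ _ _))//; apply: ler_sum => k _.
  rewrite -mulrA normrM ler_pM// ler_norml; apply/andP; split.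
    rewrite -subr_ge0 (_ : _ - _ = (X k ord0 + X i ord0) ^+ 2 / 2); last by field.
    by rewrite divr_ge0 ?sqr_ge0.
  rewrite -subr_ge0 (_ : _ - _ = (X k ord0 - X i ord0) ^+ 2 / 2); last by field.
  by rewrite divr_ge0 ?sqr_ge0.
under eq_bigr do rewrite -mulr_sumr -mulr_suml big_split/= sumr_const card_ord.
rewrite -mulr_sumr -mulr_suml big_split/= sumr_const card_ord -sumrMnl.
set S := \sum_(i < n) X i ord0 ^+ 2.
have -> : \sum_(i < n) X i ord0 ^+ 2 *+ n = S *+ n by rewrite sumrMnl.
have -> : dotcv X X = S by apply: eq_bigr => i _; rewrite expr2.
by rewrite -mulr_natr le_eqVlt; apply/orP; left; apply/eqP; field.
Qed.

Lemma dotcv_gt0 (n : nat) (u : 'cV[R]_n) : u != 0 -> 0 < dotcv u u.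
Proof.
move=> u0; rewrite lt_neqAle dotcv_ge0 andbT eq_sym.
apply: contra u0; rewrite psumr_eq0 => [/allP X0|i _]; last by rewrite -expr2 sqr_ge0.
apply/eqP/colP => i; rewrite mxE; apply/eqP.
by have /= := X0 i (mem_index_enum _); rewrite mulf_eq0 orbb.
Qed.

Definition posdef (n : nat) (E : 'M[R]_n) :=
  forall X : 'cV[R]_n, X != 0 -> 0 < dotcv (E *m X) X.

Lemma posdef1 (n : nat) : posdef (1%:M : 'M[R]_n).
Proof. by move=> X X0; rewrite mul1mx dotcv_gt0. Qed.

Lemma block_mx_consE (n : nat) (E : 'M[R]_n.+1) :
  exists (a : R) (b : 'rV[R]_n) (c : 'cV[R]_n) (D : 'M[R]_n),
  [/\ forall x v, E *m cV_cons (x, v) =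
        cV_cons (a * x + (b *m v) ord0 ord0, x *: c + D *m v),
    (a != 0 -> \det E = a * \det (D - a^-1 *: (c *m b))) &
    E^T = E -> b = c^T /\ D^T = D].
Proof.
rewrite -[n.+1]/(1 + n)%N in E *.
pose a := ulsubmx E; pose b := ursubmx E.
pose c := dlsubmx E; pose D := drsubmx E.
have aE : a = (a ord0 ord0)%:M.
  by rewrite [LHS]mx11_scalar.
exists (a ord0 ord0), b, c, D; split => [x v|a0|sE].
- rewrite /cV_cons /= -[E]submxK mul_block_col -/a -/b -/c -/D.
  congr (col_mx _ _).
    rewrite {1}aE -scalar_mxM raddfD/=; congr (_ + _).
    by rewrite [LHS]mx11_scalar.
  by rewrite mul_mx_scalar.
- have -> : E = block_mx 1%:M 0 ((a ord0 ord0)^-1 *: c) 1%:M *m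
               block_mx a b 0 (D - (a ord0 ord0)^-1 *: (c *m b)).
    rewrite mulmx_block !mul1mx !mul0mx !addr0 -[LHS]submxK -/a -/b -/c -/D.
    have -> : (a ord0 ord0)^-1 *: c *m a = c.
      by rewrite [X in _ *m X]aE mul_mx_scalar scalerA mulfV// scale1r.
    by rewrite -scalemxAl addrC subrK.
  rewrite det_mulmx det_lblock det_ublock !det1 !mul1r.
  by rewrite {1}aE det_scalar1.
- split.
    by rewrite /b /c -sE -[in RHS]sE trmx_dlsub trmxK.
  by rewrite /D trmx_drsub sE.
Qed.

Lemma posdef_schur (n : nat) (a : R) (b : 'rV[R]_n) (c : 'cV[R]_n)
    (D : 'M[R]_n) (E : 'M[R]_n.+1) :
  (forall x v, E *m cV_cons (x, v) =
        cV_cons (a * x + (b *m v) ord0 ord0, x *: c + D *m v)) ->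
  posdef E -> 0 < a /\ posdef (D - a^-1 *: (c *m b)).
Proof.
move=> hE pE.
have a0 : 0 < a.
  have /pE : cV_cons (1, 0 : 'cV[R]_n) != 0.
    apply/eqP => /(congr1 (fun X : 'cV[R]_n.+1 => X ord0 ord0)).
    by rewrite cV_cons0 mxE => /eqP; rewrite oner_eq0.
  rewrite hE dotcv_cons !mulmx0 mxE addr0 !mulr1 addr0 scale1r dotcvC.
  by rewrite /dotcv big1 ?addr0// => i _; rewrite mxE mul0r.
split => // v v0.
pose m := (b *m v) ord0 ord0.
have /pE : cV_cons (- (m / a), v) != 0.
  apply: contra v0 => /eqP X0; apply/eqP/colP => i.
  by rewrite -(cV_consS (- (m / a), v)) X0 !mxE.
rewrite hE -/m dotcv_cons (_ : a * _ + m = 0) ?mul0r ?add0r; last first.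
  by field; rewrite gt_eqF.
congr (_ < dotcv _ _).
rewrite mulmxBl addrC; congr (_ + _).
rewrite -scalemxAl -mulmxA [b *m v]mx11_scalar -/m mul_mx_scalar scalerA.
by rewrite scaleNr mulrC.
Qed.

Lemma posdef_det_gt0 (n : nat) (E : 'M[R]_n) : posdef E -> 0 < \det E.
Proof.
elim: n E => [|n IH] E pE; first by rewrite det_mx00.
have [a [b [c [D [hE dE _]]]]] := block_mx_consE E.
have [a0 pS] := posdef_schur hE pE.
by rewrite dE ?gt_eqF// mulr_gt0// IH.
Qed.

End block_vectors.

Section linear_substitution.
Context {R : realType}.
Local Notation mu := (@lebesgue_measure R).
Local Open Scope ereal_scope.

(* Schur complement: for fixed v substitute x' = a x + b v, then the second
   block becomes an affine function of v with linear part D - c b / a. *)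
Lemma integral_affine_cV (n : nat) (E : 'M[R]_n) (h : 'cV[R]_n)
    (g : 'cV[R]_n -> \bar R) : posdef E ->
  measurable_fun setT g -> (forall X, 0 <= g X) ->
  (\det E)%:E * \int[lebesgue_cV R n]_X g (E *m X + h)%R =
  \int[lebesgue_cV R n]_X g X.
Proof.
elim: n E h g => [|n IH] E h g pE mg g0.
  rewrite det_mx00 mul1e; apply: eq_integral => X _; congr g.
  by apply/colP => -[].
have [a [b [c [D [hE dE _]]]]] := block_mx_consE E.
have [a0 pS] := posdef_schur hE pE.
rewrite dE ?gt_eqF//; set S := (D - _)%R in pS *.
have [h0 [h1 hh]] := cV_consE h.
pose B (v : 'cV[R]_n) := ((b *m v) ord0 ord0 + h0)%R.
have EX x v : (E *m cV_cons (x, v) + h =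
    cV_cons (a * x + B v, x *: c + D *m v + h1))%R.
  rewrite hE hh; apply/colP => i; rewrite mxE.
  case: (unliftP ord0 i) => [k ->|->]; first by rewrite !cV_consS /= [RHS]mxE.
  by rewrite !cV_cons0 /= addrA.
have mEX : measurable_fun setT (fun X : 'cV[R]_n.+1 => g (E *m X + h)%R).
  apply: measurableT_comp => //; apply: measurable_addmx => //.
  exact: measurable_mulmx.
rewrite integral_cV_cons_swap// EFinM (muleC a%:E) -muleA.
pose G v x := g (cV_cons (x, ((x - B v) / a) *: c + D *m v + h1)%R).
have mB : measurable_fun setT B.
  apply: measurable_funD => //.
  apply: (measurableT_comp (measurable_coord ord0 ord0)).
  exact: measurable_mulmx.
have mG : measurable_fun setT (fun z : R * 'cV[R]_n => G z.2 z.1).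
  apply: measurableT_comp => //; apply: measurableT_comp.
    exact: measurable_cV_cons.
  apply: measurable_fun_pair => //; apply: measurable_addmx => //.
  apply: measurable_addmx; last exact: measurable_mulmx.
  apply: measurable_scalemx => //; apply: measurable_funM => //.
  apply: measurable_funB => //; exact: measurableT_comp.
rewrite -ge0_integralZl//; last 3 first.
- apply: (measurable_fun_fubini_tonelli_G (m1 := mu) (fun z => g (E *m cV_cons z + h)%R)) => //.
  by apply: (measurableT_comp (f := fun X => g (E *m X + h)%R)) => //; exact: measurable_cV_cons.
- by move=> v _; exact: integral_ge0.
- by rewrite lee_fin ltW.
have mGv v : measurable_fun setT (G v).
  exact: (measurableT_comp mG (measurable_fun_pair _ (measurable_cst v))).
transitivity ((\det S)%:E * \int[lebesgue_cV R n]_v \int[mu]_x G v x).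
  congr (_ * _); apply: eq_integral => v _; rewrite -(integral_affine (B v) a0 (mGv v)); last by move=> x; exact: g0.
  congr (_ * _); apply: eq_integral => x _; rewrite EX /G addrK.
  by rewrite [(a * x)%R]mulrC mulfK ?gt_eqF.
transitivity ((\det S)%:E * \int[mu]_x \int[lebesgue_cV R n]_v G v x).
  congr (_ * _); apply/esym.
  by apply: (fubini_tonelli (fun z : measurableTypeR R * 'cV[R]_n => G z.2 z.1)) => // z; exact: g0.
rewrite integral_cV_cons// -ge0_integralZl//; last 3 first.
- apply: (measurable_fun_fubini_tonelli_F (m2 := lebesgue_cV R n) (fun z => G z.2 z.1)) => // z; exact: g0.
- by move=> x _; apply: integral_ge0 => v _; exact: g0.
- by rewrite lee_fin ltW// posdef_det_gt0.
apply: eq_integral => x _.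
rewrite -(IH S (((x - h0) / a) *: c + h1)%R (fun v => g (cV_cons (x, v))))//; last first.
  by apply: measurableT_comp => //; apply: measurableT_comp;
    [exact: measurable_cV_cons|exact: measurable_pair1].
congr (_ * _); apply: eq_integral => v _; rewrite /G; congr (g (cV_cons (_, _))).
have -> : (S *m v = D *m v - (a^-1 * (b *m v) ord0 ord0) *: c)%R.
  rewrite /S mulmxBl -scalemxAl -mulmxA [b *m v]mx11_scalar mul_mx_scalar.
  by rewrite scalerA [in RHS]mxE eqxx mulr1n.
rewrite /B; move: (D *m v)%R ((b *m v) ord0 ord0) => w m.
by apply/colP => i; rewrite !mxE; ring.
Qed.

Lemma integral_shift_cV (n : nat) (h : 'cV[R]_n) (g : 'cV[R]_n -> \bar R) :
  measurable_fun setT g -> (forall X, 0 <= g X) ->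
  \int[lebesgue_cV R n]_X g (X + h)%R = \int[lebesgue_cV R n]_X g X.
Proof.
move=> mg g0; rewrite -(integral_affine_cV h (@posdef1 R n) mg g0) det1 mul1e.
by apply: eq_integral => X _; rewrite mul1mx.
Qed.

Lemma integral_gauss (a b : R) : (0 < a)%R ->
  \int[mu]_x (expR (- (a * (x + b) ^+ 2)))%:E = (Num.sqrt (pi / a))%:E.
Proof.
move=> a0; pose sg := (Num.sqrt (2 * a))^-1%R.
have sg0 : (0 < sg)%R by rewrite invr_gt0 sqrtr_gt0 mulr_gt0.
have sg2 : (sg ^+ 2 = (2 * a)^-1)%R.
  by rewrite exprVn sqr_sqrtr// mulr_ge0// ltW.
have /(congr1 (fun z => (normal_peak sg)^-1%:E * z)) := integral_normal_pdf (- b)%R sg.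
rewrite mule1 -ge0_integralZl//; last 3 first.
- by apply/measurable_EFinP; exact: measurable_normal_pdf.
- by move=> x _; rewrite lee_fin normal_pdf_ge0.
- by rewrite lee_fin invr_ge0 normal_peak_ge0.
have pk : (normal_peak sg)^-1%R = Num.sqrt (pi / a).
  rewrite /normal_peak invrK sg2; congr Num.sqrt.
  by field; rewrite gt_eqF.
rewrite {2}pk => <-; apply: eq_integral => x _.
rewrite normal_pdfE ?gt_eqF// /normal_fun -EFinM mulKf; last first.
  by rewrite gt_eqF// normal_peak_gt0 ?gt_eqF.
rewrite sg2 opprK; congr (expR _)%:E.
by field; rewrite gt_eqF.
Qed.

Lemma integral_gauss_cV (n : nat) (M : 'M[R]_n) : M^T = M -> posdef M ->
  \int[lebesgue_cV R n]_X (expR (- dotcv (M *m X) X))%:E =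
  (Num.sqrt (pi ^+ n / \det M))%:E.
Proof.
elim: n M => [|n IH] M sM pM.
  rewrite det_mx00 expr0 invr1 mulr1 sqrtr1.
  rewrite (eq_integral (cst 1)) ?integral_cst//; first by rewrite mul1e /= diracT.
  by move=> X _; rewrite /dotcv big_ord0 oppr0 expR0.
have [a [b [c [D [hM dM /(_ sM)[bc sD]]]]]] := block_mx_consE M.
have [a0 pS] := posdef_schur hM pM.
rewrite dM ?gt_eqF//; set S := (D - _)%R in pS *.
have sS : S^T = S.
  rewrite /S linearB/= linearZ/= trmx_mul sD bc trmxK.
  by [].
have mq m : measurable_fun setT (fun X : 'cV[R]_m => X) by exact: measurable_id.
have mM : measurable_fun setT (fun X : 'cV[R]_n.+1 => (expR (- dotcv (M *m X) X))%:E).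
  apply/measurable_EFinP; apply: measurableT_comp => //; apply: measurableT_comp => //.
  by apply: measurable_dotcv => //; exact: measurable_mulmx.
rewrite integral_cV_cons_swap//.
pose q (v : 'cV[R]_n) := (b *m v) ord0 ord0.
have E x v : (dotcv (M *m cV_cons (x, v)) (cV_cons (x, v)) =
    a * (x + q v / a) ^+ 2 + dotcv (S *m v) v)%R.
  have -> : (S *m v = D *m v - (a^-1 * q v) *: c)%R.
    rewrite /S mulmxBl -scalemxAl -mulmxA [b *m v]mx11_scalar mul_mx_scalar.
    by rewrite scalerA.
  have cv : dotcv c v = q v by rewrite dotcvE -bc.
  rewrite hM dotcv_cons !dotcvDl dotcvNl !dotcvZl cv -/(q v).
  by field; rewrite gt_eqF.
transitivity (\int[lebesgue_cV R n]_v ((Num.sqrt (pi / a))%:E *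
    (expR (- dotcv (S *m v) v))%:E)).
  apply: eq_integral => v _; rewrite -(integral_gauss (q v / a) a0).
  rewrite -ge0_integralZr//.
  - by apply: eq_integral => x _; rewrite E opprD expRD EFinM.
  - apply/measurable_EFinP; apply: measurableT_comp => //; apply: measurableT_comp => //.
    by apply: measurable_funM => //; apply: measurable_funX; exact: measurable_funD.
rewrite ge0_integralZl//.
- rewrite IH// -EFinM -sqrtrM ?divr_ge0 ?pi_ge0 ?ltW//; congr (Num.sqrt _)%:E.
  by rewrite exprS invfM; ring.
- apply/measurable_EFinP; apply: measurableT_comp => //; apply: measurableT_comp => //.
  by apply: measurable_dotcv => //; exact: measurable_mulmx.
Qed.

End linear_substitution.

Section matrix_limits.
Context {R : realType}.

Lemma mx_norm_le (m n : nat) (A : 'M[R]_(m, n)) (c : R) : 0 <= c ->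
  `|A| <= c <-> forall i j, `|A i j| <= c.
Proof.
move=> c0; rewrite /Num.norm /= mx_normrE; split=> [Ac i j|Ac].
  by apply: le_trans Ac; apply/bigmax_geP; right; exists (i, j).
by apply/bigmax_leP; split => [|[i j] _] /=; [|exact: Ac].
Qed.

Lemma mx_entry_le (m n : nat) (A : 'M[R]_(m, n)) i j : `|A i j| <= `|A|.
Proof. by move: i j; apply/mx_norm_le. Qed.

Lemma cvg_mx (m n : nat) (u : nat -> 'M[R]_(m, n)) (l : 'M[R]_(m, n)) :
  (forall i j, u k i j @[k --> \oo] --> l i j) <-> u k @[k --> \oo] --> l.
Proof.
split=> [ul|ul i j]; last first.
  exact: (cvg_comp u (fun M : 'M[R]_(m, n) => M i j) ul (@coord_continuous _ _ _ i j l)).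
apply/cvgrPdist_le => e e0.
have : \forall k \near \oo, forall ij : 'I_m * 'I_n, `|l ij.1 ij.2 - u k ij.1 ij.2| <= e.
  apply: filter_forall => -[i j] /=.
  by move/cvgrPdist_le : (ul i j); apply.
apply: filterS => k H; apply/mx_norm_le; first exact: ltW.
by move=> i j; rewrite !mxE; exact: (H (i, j)).
Qed.

End matrix_limits.

Section matrix_exponential.
Context {R : realType} {N : nat}.
Implicit Types A B : 'M[R]_N.

Definition entry_sum A : R := \sum_i \sum_j `|A i j|.

Lemma entry_sum_ge0 A : 0 <= entry_sum A.
Proof. by apply: sumr_ge0 => i _; apply: sumr_ge0 => j _. Qed.

Lemma entry_sumZ c A : entry_sum (c *: A) = `|c| * entry_sum A.
Proof.
rewrite mulr_sumr; apply: eq_bigr => i _; rewrite mulr_sumr.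
by apply: eq_bigr => j _; rewrite mxE normrM.
Qed.

Lemma expr_scalemx (c : R) A k : (c *: A) ^+ k = c ^+ k *: A ^+ k.
Proof.
elim: k => [|k IH]; first by rewrite !expr0 scale1r.
rewrite !exprS IH -[LHS]/(_ *m _) -scalemxAl -scalemxAr scalerA.
by rewrite -exprS.
Qed.

Lemma expmx_entry_le A k i j : `|(A ^+ k) i j| <= entry_sum A ^+ k.
Proof.
elim: k i j => [|k IH] i j.
  by rewrite !expr0 mxE; case: (i == j); rewrite ?normr1// normr0.
rewrite !exprSr mxE (le_trans (ler_norm_sum _ _ _))//.
apply: (@le_trans _ _ (\sum_l entry_sum A ^+ k * `|A l j|)).
  by apply: ler_sum => l _; rewrite normrM ler_wpM2r.
rewrite -mulr_sumr ler_wpM2l ?exprn_ge0 ?entry_sum_ge0//.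
apply: ler_sum => l _; rewrite (bigD1 j)//= lerDl.
by apply: sumr_ge0.
Qed.

Lemma series_exp_coeff_le (x : R) n : 0 <= x -> series (exp_coeff x) n <= expR x.
Proof.
move=> x0; apply: nondecreasing_cvgn_le; last exact: is_cvg_series_exp_coeff.
by apply: nondecreasing_series => // k _ _; exact: exp_coeff_ge0.
Qed.

Let coef A k := (k`!%:R : R)^-1 *: A ^+ k.

Let coef_le A k i j : `|coef A k i j| <= exp_coeff (entry_sum A) k.
Proof.
rewrite /coef mxE normrM ger0_norm ?invr_ge0//.
by rewrite exp_coeffE/= ler_wpM2l ?invr_ge0// expmx_entry_le.
Qed.

Let seriesE A n i j : series (coef A) n i j = series (fun k => coef A k i j) n.
Proof. by rewrite /series /= summxE. Qed.

Lemma cvg_expmx A : series (coef A) k @[k --> \oo] --> expmx A.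
Proof.
have c i j : cvgn (series (fun k => coef A k i j)).
  apply: normed_cvg; apply: (series_le_cvg _ _ (coef_le A ^~ i ^~ j)) => //.
    by move=> k; exact: exp_coeff_ge0 (entry_sum_ge0 A).
  exact: is_cvg_series_exp_coeff.
suff : series (coef A) k @[k --> \oo] -->
    (\matrix_(i, j) limn (series (fun k => coef A k i j)) : 'M[R]_N).
  by move=> /[dup] h /cvg_lim; rewrite /expmx => ->.
apply/cvg_mx => i j; rewrite mxE.
by under eq_fun do rewrite seriesE; exact: c.
Qed.

Lemma cvg_expmx_entry A i j : series (coef A) k i j @[k --> \oo] --> expmx A i j.
Proof. by move: i j; apply/cvg_mx; exact: cvg_expmx. Qed.

Lemma expmx_sub1_le A (t : R) i j : 0 <= t <= 1 ->
  `|(expmx (t *: A) - 1%:M) i j| <= t * expR (entry_sum A).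
Proof.
move=> /andP[t0 t1].
have : (series (coef (t *: A)) k - 1%:M) i j @[k --> \oo] -->
    (expmx (t *: A) - 1%:M) i j.
  by move: i j; apply/cvg_mx; apply: cvgB; [exact: cvg_expmx|exact: cvg_cst].
move=> /cvg_norm h.
rewrite -(cvg_lim _ h)//; apply: limr_le; first by apply/cvg_ex; eexists; exact: h.
near=> n.
have [m ->] : exists m, n = m.+1.
  by exists n.-1; rewrite prednK//; near: n; exists 1%N.
rewrite !mxE seriesE /series/= big_mkord big_ord_recl /= {1}/coef expr0 fact0.
rewrite invr1 scale1r mxE addrC addKr.
apply: (@le_trans _ _ (\sum_(k < m) t * exp_coeff (entry_sum A) k.+1)).
  rewrite (le_trans (ler_norm_sum _ _ _))//; apply: ler_sum => k _.
  rewrite (le_trans (coef_le _ _ _ _))// !exp_coeffE /= entry_sumZ ger0_norm//.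
  rewrite mulrCA ler_wpM2l ?invr_ge0// exprMn ler_wpM2r ?exprn_ge0 ?entry_sum_ge0//.
  by rewrite /bump /= add1n exprS ler_piMr// exprn_ile1.
rewrite -mulr_sumr ler_wpM2l//.
apply: le_trans (@series_exp_coeff_le _ m.+1 (entry_sum_ge0 A)).
rewrite /series /= big_mkord big_ord_recl lerDr.
exact: exp_coeff_ge0 (entry_sum_ge0 A).
Unshelve. all: by end_near. Qed.

Lemma expmx_le A i j : `|expmx A i j| <= expR (entry_sum A).
Proof.
have /cvg_norm h := @cvg_expmx_entry A i j.
rewrite -(cvg_lim _ h)//; apply: limr_le; first by apply/cvg_ex; eexists; exact: h.
apply: nearW => n; rewrite seriesE; apply: le_trans (series_exp_coeff_le n (entry_sum_ge0 A)).
by rewrite (le_trans (ler_norm_sum _ _ _))//; apply: ler_sum => k _; exact: coef_le.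
Qed.

Lemma trmx_expr A k : (A ^+ k)^T = A^T ^+ k.
Proof.
elim: k => [|k IH]; first by rewrite !expr0 trmx1.
by rewrite exprS exprSr -IH; exact: trmx_mul.
Qed.

Lemma trmx_expmx A : (expmx A)^T = expmx A^T.
Proof.
have h : series (coef A^T) k @[k --> \oo] --> (expmx A)^T.
  apply/cvg_mx => i j; rewrite mxE.
  rewrite (_ : (fun k => _) = fun k => series (coef A) k j i).
    exact: cvg_expmx_entry.
  apply/funext => k; rewrite !seriesE; apply: eq_bigr => l _.
  by rewrite /coef !mxE -trmx_expr mxE.
by rewrite [RHS](cvg_lim _ h).
Qed.

Lemma measurable_expmx B : measurable_fun setT (fun t : R => expmx (t *: B)).
Proof.
apply/measurable_fun_matrixP => i j.
apply: (measurable_fun_cvg (h := fun n (t : R) => series (coef (t *: B)) n i j)).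
  move=> n; under eq_fun do rewrite seriesE.
  apply: measurable_sum => k; rewrite /coef.
  under eq_fun do rewrite mxE expr_scalemx mxE.
  by apply: measurable_funM => //; apply: measurable_funM.
by move=> t _; exact: cvg_expmx_entry.
Qed.

Lemma cvg_compound (a : R) : 0 <= a ->
  (1 + a / n.+1%:R) ^+ n.+1 @[n --> \oo] --> expR a.
Proof.
move=> a0; pose x (n : nat) := a / n.+1%:R.
have x0 n : 0 <= x n by rewrite divr_ge0.
have hx : x n @[n --> \oo] --> 0.
  rewrite -[X in _ --> X](mulr0 a); apply: cvgM; first exact: cvg_cst.
  exact: (@cvg_harmonic R).
apply: (@squeeze_cvgr _ _ _ _ (fun n => expR (a / (1 + x n))) (cst (expR a))).
- apply: nearW => n /=; apply/andP; split.
    have x1 : 0 < 1 + x n by rewrite ltr_pwDl.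
    rewrite (_ : a / _ = n.+1%:R * (x n / (1 + x n))); last first.
      by rewrite mulrA; congr (_ / _); rewrite mulrC divfK.
    rewrite expRM_natl ler_pXn2r ?nnegrE ?expR_ge0 ?(ltW x1)//.
        rewrite -[leLHS]invrK -expRN -[leRHS]invrK lef_pV2 ?posrE ?invr_gt0 ?expR_gt0//.
    apply: le_trans (expR_ge1Dx _).
    rewrite -/(x n) le_eqVlt; apply/orP; left; apply/eqP.
    by field; rewrite gt_eqF.
  rewrite [in leRHS](_ : a = n.+1%:R * x n); last by rewrite mulrC divfK.
  rewrite expRM_natl ler_pXn2r ?nnegrE ?expR_ge0 ?addr_ge0 ?(x0 n)//.
  exact: expR_ge1Dx.
- have h : a / (1 + x n) @[n --> \oo] --> a.
    rewrite -[X in _ --> X]mulr1; apply: cvgM; first exact: cvg_cst.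
    rewrite -[X in _ --> X]invr1; apply: cvgV; first by rewrite oner_eq0.
    rewrite -[X in _ --> X]addr0; apply: cvgD => //; exact: cvg_cst.
  exact: (cvg_comp _ expR h (@continuous_expR R a)).
- exact: cvg_cst.
Qed.

(* The entries of the compound powers differ from those of the partial sums of
   the exponential series by at most the same difference for the scalar
   entry_sum A, since C(n, k) / n ^ k <= 1 / k! termwise. *)
Lemma cvg_expmx_compound A :
  (1%:M + n.+1%:R^-1 *: A) ^+ n.+1 @[n --> \oo] --> expmx A.
Proof.
set a := entry_sum A; have a0 : 0 <= a := entry_sum_ge0 A.
pose c n k : R := 'C(n, k)%:R / n%:R ^+ k.
have cle n k : (0 < n)%N -> 0 <= c n k <= k`!%:R^-1.
  move=> n0; rewrite divr_ge0 ?exprn_ge0//= ler_pdivrMr ?exprn_gt0 ?ltr0n//.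
  rewrite mulrC ler_pdivlMr ?ltr0n ?fact_gt0// -natrM bin_ffact -natrX ler_nat.
  elim: k => [|k IH]; first by rewrite ffactn0 expn0.
  by rewrite ffactnSr expnSr leq_mul// leq_subr.
have Aexp n : (1%:M + n.+1%:R^-1 *: A) ^+ n.+1 = \sum_(k < n.+2) c n.+1 k *: A ^+ k.
  rewrite addrC exprD1n; apply: eq_bigr => k _.
  by rewrite expr_scalemx -scaler_nat scalerA exprVn.
have aexp n : (1 + a / n.+1%:R) ^+ n.+1 = \sum_(k < n.+2) c n.+1 k * a ^+ k.
  rewrite addrC exprD1n; apply: eq_bigr => k _.
  by rewrite exprMn -mulr_natl exprVn mulrA mulrAC.
apply/cvg_mx => i j.
have h1 : series (coef A) n.+2 i j @[n --> \oo] --> expmx A i j.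
  have := @cvg_expmx_entry A i j; rewrite -(cvg_shiftn 2)/=.
  by under eq_fun do rewrite addn2.
have h2 : series (exp_coeff a) n.+2 - (1 + a / n.+1%:R) ^+ n.+1 @[n --> \oo] --> (0:R).
  rewrite -[X in _ --> X](subrr (expR a)); apply: cvgB; last exact: cvg_compound.
  have : series (exp_coeff a) n @[n --> \oo] --> expR a.
    exact: is_cvg_series_exp_coeff.
  rewrite -(cvg_shiftn 2)/=.
  by under eq_fun do rewrite addn2.
have h3 : series (coef A) n.+2 i j - ((1%:M + n.+1%:R^-1 *: A) ^+ n.+1) i j
    @[n --> \oo] --> (0:R).
  apply/norm_cvg0P.
  apply: (squeeze_cvgr _ (cvg_cst (0:R)) h2).
  apply: nearW => n; rewrite normr_ge0/= aexp Aexp seriesE summxE /series/= !big_mkord.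
  rewrite -!sumrB (le_trans (ler_norm_sum _ _ _))//; apply: ler_sum => k _.
  rewrite exp_coeffE /= /coef !mxE -!mulrBl normrM ger0_norm ?subr_ge0; last first.
    by have /andP[] := cle n.+1 k isT.
  rewrite ler_wpM2l ?expmx_entry_le// subr_ge0.
  by have /andP[] := cle n.+1 k isT.
have := cvgB h1 h3; rewrite subr0 => h4.
apply: (cvg_trans _ (h4 _)); apply: near_eq_cvg; apply: nearW => n.
by rewrite !fctE opprB addrC subrK.
Qed.

Lemma det_1D_ge B : (0 < N)%N -> 0 <= \tr B ->
  exists2 C, 0 <= C & forall h, 0 <= h <= 1 -> 1 - C * h ^+ 2 <= \det (1%:M + h *: B).
Proof.
move=> N0 tB; pose p := char_poly (- B).
have sp : size p = N.+1 by rewrite size_char_poly.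
exists (\sum_(i < N.+1) `|p`_i|); first exact: sumr_ge0.
move=> h /andP[]; rewrite le_eqVlt => /predU1P[<- _|h0 h1].
  by rewrite expr0n mulr0 subr0 scale0r addr0 det1.
have -> : 1%:M + h *: B = h *: (h^-1%:M - (- B)).
  by rewrite opprK scalerDr scale_scalar_mx mulfV ?gt_eqF.
have -> : \det (h *: (h^-1%:M - (- B))) = \sum_(i < N.+1) p`_i * h ^+ (N - i).
  have -> : \det (h *: (h^-1%:M - - B)) = h ^+ N * p.[h^-1].
    rewrite detZ; congr (_ * _); rewrite /p /char_poly -horner_evalE -det_map_mx.
    congr (\det _); apply/matrixP => i j.
    by rewrite !mxE/= horner_evalE hornerD hornerN !hornerE hornerMn hornerX.
  rewrite horner_coef sp mulr_sumr; apply: eq_bigr => i _.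
  rewrite mulrCA; congr (_ * _); rewrite exprVn -exprB ?unitfE ?gt_eqF//.
  by rewrite -ltnS.
have pN : p`_N = 1.
  by have /monicP := char_poly_monic (- B); rewrite /lead_coef size_char_poly.
have h2 : 0 <= h ^+ 2 by rewrite exprn_ge0 ?ltW.
have -> : 1 - (\sum_(i < N.+1) `|p`_i|) * h ^+ 2 =
    \sum_(i < N.+1) ((i == N :> nat)%:R - `|p`_i| * h ^+ 2).
  rewrite sumrB -mulr_suml; congr (_ - _).
  rewrite big_ord_recr/= eqxx big1 ?add0r// => i _.
  by rewrite (ltn_eqF (ltn_ord i)).
apply: ler_sum => i _.
have [iN|iN] := eqVneq (i : nat) N.
  by rewrite iN pN subnn expr0 mulr1 lerBlDr lerDl normr1 mul1r.
rewrite sub0r; have [iN1|iN1] := eqVneq (i : nat) N.-1.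
  apply: (@le_trans _ _ 0); first by rewrite oppr_le0 mulr_ge0.
  by rewrite iN1 char_poly_trace// raddfN opprK mulr_ge0// exprn_ge0// ltW.
have i2 : (2 <= N - i)%N by move: (ltn_ord i) iN iN1; lia.
apply: (@le_trans _ _ (- (`|p`_i| * h ^+ (N - i)))).
  by rewrite lerN2 ler_wpM2l// ler_wiXn2l// ltW.
by rewrite lerNl -mulNr ler_wpM2r ?exprn_ge0 ?(ltW h0)// -normrN ler_norm.
Qed.

Lemma det_expmx_ge1 B t : (0 < N)%N -> 0 <= \tr B -> 0 <= t ->
  1 <= \det (expmx (t *: B)).
Proof.
move=> N0 tB t0; have [C C0 HC] := det_1D_ge N0 tB.
have cdet : \det ((1%:M + n.+1%:R^-1 *: (t *: B)) ^+ n.+1) @[n --> \oo] -->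
    \det (expmx (t *: B)).
  have /cvg_mx h := @cvg_expmx_compound (t *: B).
  apply: cvg_big => [|s _].
    by move=> x; apply: cvgD; [exact: cvg_fst|exact: cvg_snd].
  apply: cvgM; first exact: cvg_cst.
  apply: cvg_big => [|i _]; last exact: h.
  by move=> x; apply: cvgM; [exact: cvg_fst|exact: cvg_snd].
have hl : 1 - C * t ^+ 2 / n.+1%:R @[n --> \oo] --> (1 : R).
  rewrite -[X in _ --> X]subr0; apply: cvgB; first exact: cvg_cst.
  rewrite -[X in _ --> X](mulr0 (C * t ^+ 2)); apply: cvgM; first exact: cvg_cst.
  exact: (@cvg_harmonic R).
rewrite -(cvg_lim _ hl)// -(cvg_lim _ cdet)//.
apply: ler_lim; [by apply/cvg_ex; eexists; exact: hl|
  by apply/cvg_ex; eexists; exact: cdet|].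
near=> n.
have n0 : 0 < n.+1%:R :> R by [].
have tn : t <= n.+1%:R.
  by near: n; exists (Num.truncn t) => // n /= tn; rewrite ltW// -Num.Theory.truncn_le_nat.
have Ct : C * t ^+ 2 <= n.+1%:R.
  by near: n; exists (Num.truncn (C * t ^+ 2)) => // n /= tn; rewrite ltW// -Num.Theory.truncn_le_nat.
pose h := t / n.+1%:R.
have h01 : 0 <= h <= 1 by rewrite divr_ge0//= ler_pdivrMr ?mul1r.
have detX (M : 'M[R]_N) k : \det (M ^+ k) = \det M ^+ k.
  elim: k => [|k IH]; first by rewrite !expr0 det1.
  by rewrite !exprS -IH; exact: det_mulmx.
rewrite detX scalerA [_^-1 * t]mulrC -/h.
have hx : C * h ^+ 2 <= 1.
  rewrite /h exprMn mulrA exprVn ler_pdivrMr ?exprn_gt0// mul1r.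
  by rewrite (le_trans Ct)// expr2 ler_peMr// ler1n.
apply: (@le_trans _ _ ((1 - C * h ^+ 2) ^+ n.+1)); last first.
  have d0 : 0 <= 1 - C * h ^+ 2 by rewrite subr_ge0.
  have d1 := le_trans d0 (HC _ h01).
  by rewrite ler_pXn2r ?nnegrE ?d0 ?d1 ?HC.
have -> : C * t ^+ 2 / n.+1%:R = n.+1%:R * (C * h ^+ 2).
  by rewrite /h; field; rewrite gt_eqF.
have bern (x : R) k : 0 <= x <= 1 -> 1 - k%:R * x <= (1 - x) ^+ k.
  move=> /andP[x0 x1]; elim: k => [|k IH]; first by rewrite mul0r subr0 expr0.
  rewrite exprS; apply: (@le_trans _ _ ((1 - x) * (1 - k%:R * x))); last first.
    by rewrite ler_wpM2l// subr_ge0.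
  rewrite -natr1 -subr_ge0 (_ : _ - _ = k%:R * x ^+ 2); last by ring.
  by rewrite mulr_ge0// exprn_ge0.
by apply: bern; rewrite hx mulr_ge0// exprn_ge0// (andP h01).1.
Unshelve. all: by end_near. Qed.

End matrix_exponential.

Section covariance.
Context {R : realType} {N : nat}.
Variables (Q B : 'M[R]_N).
Hypothesis Qsym : Q^T = Q.
Hypothesis Qpsd : forall X : 'cV[R]_N, 0 <= dotcv (Q *m X) X.
Local Notation mu := (@lebesgue_measure R).

Let phi (s : R) : 'M[R]_N := expmx (s *: B) *m Q *m expmx (s *: B^T).

Let phi_sym s i j : phi s i j = phi s j i.
Proof.
have -> : phi s i j = (phi s)^T j i by rewrite [RHS]mxE.
rewrite /phi; congr (fun_of_matrix _ _ _).
by rewrite !trmx_mul !trmx_expmx !linearZ/= trmxK Qsym mulmxA.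
Qed.

Let phi_psd s X : 0 <= dotcv (phi s *m X) X.
Proof.
rewrite /phi -!mulmxA dotcv_mulmx trmx_expmx linearZ/=.
exact: Qpsd.
Qed.

Let measurable_phi : measurable_fun setT phi.
Proof.
apply: measurable_mulmx; last exact: measurable_expmx.
by apply: measurable_mulmx; [exact: measurable_expmx|exact: measurable_cst].
Qed.

Let measurable_phi_entry i j : measurable_fun setT (fun s => phi s i j).
Proof. exact: (measurableT_comp (measurable_coord i j) measurable_phi). Qed.

Let bnd (t : R) :=
  \sum_(k < N) (\sum_(l < N) expR (t * entry_sum B) * `|Q l k|) *
    expR (t * entry_sum B^T).

Let bnd_ge0 t : 0 <= bnd t.
Proof.
apply: sumr_ge0 => k _; rewrite mulr_ge0 ?expR_ge0//; apply: sumr_ge0 => l _.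
by rewrite mulr_ge0 ?expR_ge0.
Qed.

Let phi_le (t s : R) i j : 0 <= s <= t -> `|phi s i j| <= bnd t.
Proof.
move=> /andP[s0 st].
have h (A : 'M[R]_N) k l : `|expmx (s *: A) k l| <= expR (t * entry_sum A).
  rewrite (le_trans (expmx_le _ _ _))// ler_expR entry_sumZ ger0_norm//.
  by rewrite ler_wpM2r ?entry_sum_ge0.
rewrite /phi mxE (le_trans (ler_norm_sum _ _ _))//; apply: ler_sum => k _.
rewrite normrM ler_pM//; rewrite mxE (le_trans (ler_norm_sum _ _ _))//.
by apply: ler_sum => l _; rewrite normrM ler_wpM2r.
Qed.

Let integrable_phi t i j : mu.-integrable `[0, t] (EFin \o (fun s => phi s i j)).
Proof.
apply: measurable_bounded_integrable => //.
- have : (mu `[0%R, t]%classic < +oo)%E; last by [].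
  by rewrite lebesgue_measure_itv/=; case: ifP; rewrite ?ltry// -EFinB ltry.
- by apply: measurable_funTS; exact: measurable_phi_entry.
- exists (bnd t); split; first exact: num_real.
  move=> M bM s /=; rewrite in_itv/= => st.
  by rewrite (le_trans (phi_le i j st))// ltW.
Qed.

Lemma covmx_sym t : (covmx Q B t)^T = covmx Q B t.
Proof.
apply/matrixP => i j; rewrite !mxE; congr (_ * _).
by apply: eq_Rintegral => s _; exact: phi_sym.
Qed.

Let covmx_quad t X : dotcv (covmx Q B t *m X) X =
  t^-1 * \int[mu]_(s in `[0, t]) dotcv (phi s *m X) X.
Proof.
rewrite /covmx -scalemxAl dotcvZl; congr (_ * _).
under [RHS]eq_Rintegral do rewrite /dotcv.
have Rsum (I : Type) (r : seq I) (f : I -> R -> R) :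
    (forall i, mu.-integrable `[0, t] (EFin \o f i)) ->
    mu.-integrable `[0, t] (EFin \o (fun s => \sum_(i <- r) f i s)) /\
    \int[mu]_(s in `[0, t]) (\sum_(i <- r) f i s) =
    \sum_(i <- r) \int[mu]_(s in `[0, t]) f i s.
  move=> fi; elim: r => [|i r [IH1 IH2]].
    have -> : (fun s : R => \sum_(i <- [::]) f i s) = cst 0.
      by apply/funext => s; rewrite big_nil.
    by split; [exact: integrable0|rewrite big_nil /Rintegral integral0].
  split.
    rewrite (_ : _ \o _ = (EFin \o f i) \+ (EFin \o fun s => (\sum_(i <- r) f i s)%R))%E.
      exact: integrableD.
    by apply/funext => s /=; rewrite big_cons.
  rewrite big_cons -IH2 -RintegralD//.
  by apply: eq_Rintegral => s _; rewrite big_cons.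
have ip i k (c : R) : mu.-integrable `[0, t] (EFin \o (fun s => phi s i k * c)).
  rewrite (_ : _ \o _ = fun s => (c%:E * (phi s i k)%:E)%E).
    by apply: integrableZl => //; exact: integrable_phi.
  by apply/funext => s /=; rewrite -EFinM mulrC.
have ipp i (c : R) : mu.-integrable `[0, t] (EFin \o (fun s => (phi s *m X) i ord0 * c)).
  rewrite (_ : _ \o _ = fun s => (c%:E * (\sum_k phi s i k * X k ord0)%R%:E)%E).
    by apply: integrableZl => //; apply: (Rsum _ _ _ _).1 => k.
  by apply/funext => s /=; rewrite -EFinM mulrC mxE.
rewrite (Rsum _ _ _ _).2// /dotcv; apply: eq_bigr => i _.
rewrite RintegralZr//; last first.
  have := ipp i 1; congr (_.-integrable _ _); apply/funext => s /=.
  by rewrite mulr1.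
congr (_ * _); rewrite mxE.
under [RHS]eq_Rintegral do rewrite mxE.
rewrite (Rsum _ _ _ _).2//; apply: eq_bigr => k _.
by rewrite RintegralZr// mxE.
Qed.

Lemma covmx_psd t X : 0 < t -> 0 <= dotcv (covmx Q B t *m X) X.
Proof.
move=> t0; rewrite covmx_quad mulr_ge0 ?invr_ge0 ?(ltW t0)//.
by apply: Rintegral_ge0 => s _; exact: phi_psd.
Qed.

Lemma psd_unit_posdef (K : 'M[R]_N) : K^T = K ->
  (forall X : 'cV[R]_N, 0 <= dotcv (K *m X) X) -> K \in unitmx -> posdef K.
Proof.
move=> sK pK uK X X0; rewrite lt_neqAle pK andbT; apply/negP => /eqP KX0.
pose Y := K *m X.
have Y0 : Y != 0.
  by apply: contra X0 => /eqP Y0; rewrite -(mulKmx uK X) -/Y Y0 mulmx0.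
have b0 := dotcv_gt0 Y0; set b := dotcv Y Y in b0.
set c := dotcv (K *m Y) Y; have c0 : 0 <= c by exact: pK.
have /(_ (- b / (c + 1))) h : forall s, 0 <= s * (2 * b + s * c).
  move=> s; have := pK (X + s *: Y).
  rewrite mulmxDr -scalemxAr dotcvDl dotcvDr dotcvDr -/Y -/Y !dotcvZl !dotcvZr -/c.
  have -> : dotcv (K *m Y) X = b by rewrite dotcv_mulmx sK.
  rewrite -/b [dotcv Y X](_ : _ = 0) //.
  by congr (0 <= _); ring.
move: h; rewrite leNgt => /negP; apply.
have c1 : 0 < c + 1 by rewrite ltr_wpDl.
rewrite (_ : _ * (2 * b + _) = - (b ^+ 2 * (c + 2) / (c + 1) ^+ 2)); last first.
  by field; rewrite gt_eqF.
by rewrite oppr_lt0 divr_gt0 ?mulr_gt0 ?exprn_gt0// ltr_wpDl.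
Qed.

Lemma covmx_posdef t : 0 < t -> covmx Q B t \in unitmx -> posdef (covmx Q B t).
Proof.
by move=> t0; apply: psd_unit_posdef; [exact: covmx_sym|move=> X; exact: covmx_psd].
Qed.

Lemma covmx_bounded : exists2 C, 0 < C &
  forall t X, 0 < t <= 1 -> dotcv (covmx Q B t *m X) X <= C * dotcv X X.
Proof.
exists (bnd 1 * N%:R + 1); first by rewrite ltr_wpDl// mulr_ge0.
move=> t X /andP[t0 t1].
have Kle i j : `|covmx Q B t i j| <= bnd 1.
  rewrite !mxE normrM gtr0_norm ?invr_gt0// mulrC ler_pdivrMr//.
  apply: le_trans (le_normr_Rintegral _ (integrable_phi t i j)) _ => //.
  apply: (@le_trans _ _ (\int[mu]_(s in `[0, t]) (bnd 1))).
    apply: le_Rintegral => //.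
    - exact/integrable_norm/integrable_phi.
    - apply/integrableP; split; first exact: measurable_cst.
      by rewrite integral_cst//= lebesgue_measure_itv/= lte_fin t0 -EFinB -EFinM ltry.
    - move=> s /=; rewrite in_itv/= => /andP[s0 st]; apply: phi_le.
      by rewrite s0 (le_trans st).
  rewrite Rintegral_cst//= lebesgue_measure_itv/= lte_fin t0 -EFinB/= subr0.
  by [].
rewrite (le_trans (ler_norm _))// (le_trans (dotcv_entry_le X Kle))//.
by rewrite ler_wpM2r ?dotcv_ge0// lerDl.
Qed.

Lemma measurable_covmx : measurable_fun setT (covmx Q B).
Proof.
apply: measurable_scalemx; first exact: measurable_invr.
apply/measurable_fun_matrixP => i j.
under eq_fun do rewrite mxE.
under eq_fun do rewrite Rintegral_mkcond.
pose f (z : R * R) := if 0 <= z.2 <= z.1 then phi z.2 i j else 0.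
have mf : measurable_fun setT f.
  apply: measurable_fun_ifT => //=.
    by apply: measurable_and; apply: measurable_fun_ler.
  exact: (measurableT_comp (measurable_phi_entry i j)).
rewrite (_ : (fun t => _) = fun t => \int[mu]_s f (t, s)); last first.
  apply/funext => t; apply: eq_Rintegral => s _.
  rewrite patchE /f /=; case: ifPn => [|/negP]; first by rewrite inE/= in_itv/= => ->.
  by case: ifPn => // st; case; rewrite inE/= in_itv.
apply: measurableT_comp => //.
under eq_fun do rewrite integralE.
have mef : measurable_fun setT (EFin \o f) by exact/measurable_EFinP.
apply: emeasurable_funB.
  have := measurable_fun_fubini_tonelli_F (m2 := mu) _
    (measurable_funepos mef) (funepos_ge0 _).
  congr (measurable_fun _ _); apply/funext => t; apply: eq_integral => s _.
  by rewrite !funeposE.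
have := measurable_fun_fubini_tonelli_F (m2 := mu) _
  (measurable_funeneg mef) (funeneg_ge0 _).
congr (measurable_fun _ _); apply/funext => t; apply: eq_integral => s _.
by rewrite !funenegE.
Qed.

End covariance.

Section transition_kernel_facts.
Context {R : realType} {N : nat}.
Variables (Q B : 'M[R]_N).
Hypothesis Qsym : Q^T = Q.
Hypothesis Qpsd : forall X : 'cV[R]_N, 0 <= dotcv (Q *m X) X.
Hypothesis Kinv : forall t : R, 0 < t -> covmx Q B t \in unitmx.
Local Notation k := (transition_kernel Q B).
Local Notation K := (covmx Q B).
Local Notation E t := (expmx (t *: B)).
Local Notation L := (lebesgue_cV R N).

Let M (t : R) : 'M[R]_N := (4 * t)^-1 *: invmx (K t).

Let Kpos t : 0 < t -> posdef (K t).
Proof. by move=> t0; apply: covmx_posdef => //; exact: Kinv. Qed.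

Lemma posdef_inv (A : 'M[R]_N) : A^T = A -> A \in unitmx -> posdef A ->
  posdef (invmx A).
Proof.
move=> sA uA pA X X0.
have X'0 : invmx A *m X != 0.
  by apply: contra X0 => /eqP X0; rewrite -(mulKVmx uA X) X0 mulmx0.
by have := pA _ X'0; rewrite mulKVmx// dotcvC.
Qed.

Lemma posdefZ (A : 'M[R]_N) a : 0 < a -> posdef A -> posdef (a *: A).
Proof. by move=> a0 pA X X0; rewrite -scalemxAl dotcvZl mulr_gt0// pA. Qed.

Let Mpos t : 0 < t -> posdef (M t).
Proof.
move=> t0; apply: posdefZ; first by rewrite invr_gt0 mulr_gt0.
by apply: posdef_inv; [exact: covmx_sym|exact: Kinv|exact: Kpos].
Qed.

Let Msym t : (M t)^T = M t.
Proof. by rewrite /M linearZ/= trmx_inv covmx_sym. Qed.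

Let c t : R := (Num.sqrt (pi ^+ N / \det (M t)))^-1.

Let c_ge0 t : 0 <= c t. Proof. by rewrite invr_ge0 sqrtr_ge0. Qed.

Let kE X Y t : 0 < t ->
  k X Y t = c t * expR (- dotcv (M t *m (Y - E t *m X)) (Y - E t *m X)).
Proof.
move=> t0; rewrite /transition_kernel; congr (_ * expR (- _)); last first.
  by rewrite /M -scalemxAl dotcvZl mulrC.
have K0 : 0 < \det (K t) by exact/posdef_det_gt0/Kpos.
have pi0 := pi_gt0 R.
rewrite /c; have -> : pi ^+ N / \det (M t) = (4 * pi) ^+ N * \det (t *: K t).
  rewrite /M (detZ _ (invmx _)) (detZ t (K t)) det_inv invfM !exprVn !invrK !exprMn.
  by ring.
rewrite powRN powRrM powR12_sqrt ?powR_ge0// powR_mulrn ?mulr_ge0 ?(ltW pi0)//.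
by rewrite sqrtrM ?exprn_ge0 ?mulr_ge0 ?(ltW pi0)// invfM.
Qed.

Lemma transition_kernel_ge0 X Y t : 0 <= k X Y t.
Proof.
by rewrite /transition_kernel mulr_ge0 ?expR_ge0// divr_ge0 ?powR_ge0 ?sqrtr_ge0.
Qed.

Let gauss_gt0 t : 0 < t -> 0 < Num.sqrt (pi ^+ N / \det (M t)).
Proof.
by move=> t0; rewrite sqrtr_gt0 divr_gt0 ?exprn_gt0 ?pi_gt0 ?posdef_det_gt0//; exact: Mpos.
Qed.

Let measurable_gauss (A : 'M[R]_N) d (T : measurableType d) (f : T -> 'cV[R]_N) :
  measurable_fun setT f ->
  measurable_fun setT (fun x => (expR (- dotcv (A *m f x) (f x)))%:E).
Proof.
move=> mf; apply/measurable_EFinP; apply: measurableT_comp => //.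
apply: measurableT_comp => //; apply: measurable_dotcv => //.
exact: measurable_mulmx.
Qed.

Let gauss_shift (A : 'M[R]_N) h : A^T = A -> posdef A ->
  (\int[L]_Y (expR (- dotcv (A *m (Y + h)) (Y + h)))%:E)%E =
  (Num.sqrt (pi ^+ N / \det A))%:E.
Proof.
move=> sA pA; rewrite -integral_gauss_cV//.
rewrite (integral_shift_cV h (g := fun Y => (expR (- dotcv (A *m Y) Y))%:E))//.
exact: measurable_gauss.
Qed.

Lemma integral_transition_kernel X t : 0 < t ->
  (\int[L]_Y (k X Y t)%:E)%E = 1%E.
Proof.
move=> t0; under eq_integral do rewrite kE// EFinM.
rewrite ge0_integralZl//.
- rewrite gauss_shift//; last exact: Mpos.
  by rewrite -EFinM mulVf// gt_eqF// gauss_gt0.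
- by apply: measurable_gauss; exact: measurable_addmx.
- by rewrite lee_fin.
Qed.

Hypothesis N0 : (0 < N)%N.
Hypothesis trB : 0 <= \tr B.

Let Eunit t : 0 < t -> E t \in unitmx.
Proof.
move=> t0; rewrite unitmxE unitfE gt_eqF// (lt_le_trans ltr01)//.
exact: det_expmx_ge1 (ltW t0).
Qed.

(* Integrating in X replaces the precision matrix M by E^T M E, whose
   determinant is larger by the factor (det E)^2 >= 1. *)
Lemma integral_transition_kernel_backward Y t : 0 < t ->
  (\int[L]_X (k X Y t)%:E <= 1)%E.
Proof.
move=> t0; under eq_integral do rewrite kE// EFinM.
pose A := (E t)^T *m M t *m E t.
have sA : A^T = A by rewrite /A !trmx_mul trmxK Msym mulmxA.
have pA : posdef A.
  move=> X X0; rewrite /A -!mulmxA dotcv_mulmx trmxK; apply: Mpos => //.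
  by apply: contra X0 => /eqP X0; rewrite -(mulKmx (Eunit t0) X) X0 mulmx0.
have -> : (\int[L]_X ((c t)%:E * (expR (- dotcv (M t *m (Y - E t *m X)) (Y - E t *m X)))%:E))%E =
    (\int[L]_X ((c t)%:E * (expR (- dotcv (A *m (X + - (invmx (E t) *m Y))) (X + - (invmx (E t) *m Y))))%:E))%E.
  apply: eq_integral => X _; congr (_ * (expR (- _))%:E)%E.
  have EX : E t *m (X - invmx (E t) *m Y) = - (Y - E t *m X).
    by rewrite mulmxBr mulKVmx ?Eunit// opprB.
  by rewrite /A -!mulmxA [RHS]dotcv_mulmx trmxK EX mulmxN dotcvNl dotcvNr opprK.
rewrite ge0_integralZl//; last 2 first.
- by apply: measurable_gauss; exact: measurable_addmx.
- by rewrite lee_fin.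
rewrite gauss_shift// -EFinM lee_fin /c mulrC ler_pdivrMr ?gauss_gt0// mul1r.
rewrite ler_wsqrtr// ler_wpM2l ?exprn_ge0 ?pi_ge0//.
have M0 := posdef_det_gt0 (Mpos t0); have A0 := posdef_det_gt0 pA.
rewrite lef_pV2 ?posrE// /A !det_mulmx det_tr mulrC mulrA ler_peMl// ?(ltW M0)//.
by rewrite -[leLHS]mulr1 ler_pM// det_expmx_ge1// ltW.
Qed.

Lemma transition_kernel_shift X Y h t : 0 < t ->
  k (X + invmx (E t) *m h) (Y + h) t = k X Y t.
Proof.
move=> t0; suff EX : Y + h - E t *m (X + invmx (E t) *m h) = Y - E t *m X.
  by rewrite /transition_kernel EX.
by rewrite mulmxDr mulKVmx ?Eunit// opprD addrACA subrr addr0.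
Qed.

Lemma normr_sq_le_dotcv (Z : 'cV[R]_N) : `|Z| ^+ 2 <= dotcv Z Z.
Proof.
rewrite -[leRHS]sqr_sqrtr ?dotcv_ge0// ler_pXn2r ?nnegrE ?sqrtr_ge0//.
apply/mx_norm_le => // i j; rewrite (ord1 j) -sqrtr_sqr ler_wsqrtr//.
rewrite /dotcv (bigD1 i)//= -expr2 lerDl; apply: sumr_ge0 => l _.
by rewrite -expr2 sqr_ge0.
Qed.

Lemma powR_le_expR (q y : R) : 0 < q -> 0 <= y -> y `^ q <= q `^ q * expR y.
Proof.
move=> q0 y0.
have -> : y = q * (y / q) by rewrite mulrC divfK ?gt_eqF.
rewrite powRM ?divr_ge0 ?(ltW q0)// ler_wpM2l ?powR_ge0// [q * _]mulrC expRM.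
apply: ge0_ler_powR; rewrite ?nnegrE ?divr_ge0 ?expR_ge0 ?(ltW q0)//.
by apply: le_trans (expR_ge1Dx _); rewrite lerDr.
Qed.

Lemma integral_transition_kernel_moment (p : R) : 0 < p ->
  exists2 C, 0 <= C & forall X t, 0 < t <= 1 ->
  (\int[L]_Y (k X Y t * `|Y - E t *m X| `^ p)%:E <= (C * t `^ (p / 2))%:E)%E.
Proof.
move=> p0; have [CK CK0 HK] := covmx_bounded Q B.
pose q := p / 2; have q0 : 0 < q by rewrite divr_gt0.
pose C1 := (8 * CK) `^ q * q `^ q.
exists (C1 * Num.sqrt (2 ^+ N)); first by rewrite !mulr_ge0 ?powR_ge0.
move=> X t /andP[t0 t1].
pose M2 : 'M[R]_N := 2^-1 *: M t.
have key Z : `|Z| `^ p * expR (- dotcv (M t *m Z) Z) <=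
    C1 * t `^ q * expR (- dotcv (M2 *m Z) Z).
  have lowK : dotcv Z Z <= CK * dotcv (invmx (K t) *m Z) Z.
    pose W := invmx (K t) *m Z; pose s := CK^-1.
    have KW : K t *m W = Z by rewrite /W mulKVmx ?Kinv.
    have := @covmx_psd _ _ _ B Qpsd _ (W - s *: Z) t0.
    rewrite mulmxBr -scalemxAr KW !(dotcvDl, dotcvDr, dotcvNl, dotcvNr, dotcvZl, dotcvZr).
    have -> : dotcv (K t *m Z) W = dotcv Z Z.
      by rewrite dotcv_mulmx covmx_sym// KW.
    have /(_ t Z) := HK; rewrite t0 t1 => /(_ isT).
    rewrite -/W (dotcvC W Z). move: (dotcv (K t *m Z) Z) (dotcv Z Z) (dotcv Z W) => a b d.
    move=> ab h.
    have h2 : 0 <= d - s * b.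
      apply: (le_trans h); rewrite opprK.
      rewrite -subr_ge0 (_ : _ - _ = s * (b - s * a)); last by ring.
      rewrite mulr_ge0 ?invr_ge0 ?(ltW CK0)// subr_ge0 /s mulrC ler_pdivrMr// mulrC//.
    by move: h2; rewrite subr_ge0 /s mulrC ler_pdivrMr// mulrC.
  pose y := `|Z| ^+ 2 / (8 * CK * t).
  have y0 : 0 <= y by rewrite divr_ge0 ?sqr_ge0 ?mulr_ge0 ?(ltW CK0) ?(ltW t0).
  have normZp : `|Z| `^ p = (8 * CK) `^ q * t `^ q * y `^ q.
    rewrite -!powRM ?y0 ?mulr_ge0 ?(ltW CK0) ?(ltW t0)//.
    rewrite /y mulrC divfK; last by rewrite gt_eqF ?mulr_gt0.
    by rewrite -powR_mulrn// -powRrM /q; congr (_ `^ _); field.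
  have yM : y <= dotcv (M2 *m Z) Z.
    rewrite /y ler_pdivrMr ?mulr_gt0// (le_trans (normr_sq_le_dotcv Z))//.
    rewrite (le_trans lowK)// /M2 /M scalerA -scalemxAl dotcvZl.
    rewrite le_eqVlt; apply/orP; left; apply/eqP; field.
    by rewrite gt_eqF.
  rewrite normZp (_ : - dotcv (M t *m Z) Z = - dotcv (M2 *m Z) Z - dotcv (M2 *m Z) Z); last first.
    have -> : dotcv (M2 *m Z) Z = 2^-1 * dotcv (M t *m Z) Z.
      by rewrite /M2 -(scalemxAl 2^-1 (M t) Z) dotcvZl.
    by field.
  rewrite expRD mulrA ler_wpM2r ?expR_ge0//.
  have yq : y `^ q * expR (- dotcv (M2 *m Z) Z) <= q `^ q.
    rewrite expRN ler_pdivrMr ?expR_gt0// (le_trans (powR_le_expR q0 y0))//.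
    by rewrite ler_wpM2l ?powR_ge0// ler_expR.
  by rewrite -mulrA /C1 [leRHS]mulrAC ler_wpM2l// mulr_ge0 ?powR_ge0.
have mZ : measurable_fun setT (fun Y : 'cV[R]_N => Y - E t *m X).
  exact: measurable_addmx.
apply: (@le_trans _ _ (\int[L]_Y ((c t * C1 * t `^ q)%:E *
    (expR (- dotcv (M2 *m (Y - E t *m X)) (Y - E t *m X)))%:E))%E).
  apply: ge0_le_integral => //.
  - by move=> Y _; rewrite lee_fin mulr_ge0 ?transition_kernel_ge0 ?powR_ge0.
  - apply/measurable_EFinP; apply: measurable_funM.
      under eq_fun do rewrite kE//.
      apply: measurable_funM => //.
      by apply/measurable_EFinP; exact: measurable_gauss.
    apply: (measurableT_comp (@measurable_powR R p)).
    apply: measurableT_comp => //; apply: continuous_measurable_matrix.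
    exact: norm_continuous.
  - by apply: emeasurable_funM => //; exact: measurable_gauss.
  - move=> Y _; rewrite -EFinM lee_fin kE// -!mulrA ler_wpM2l//.
    by have := key (Y - E t *m X); rewrite /C1 -!mulrA mulrC.
rewrite ge0_integralZl//; first last.
- by rewrite lee_fin !mulr_ge0 ?powR_ge0.
- exact: measurable_gauss.
rewrite gauss_shift; [|by rewrite /M2 linearZ/= Msym|
  by apply: posdefZ; [rewrite invr_gt0|exact: Mpos]].
have -> : pi ^+ N / \det M2 = 2 ^+ N * (pi ^+ N / \det (M t)).
  by rewrite /M2 (detZ _ (M t)) exprVn invfM invrK mulrCA.
rewrite -EFinM lee_fin sqrtrM ?exprn_ge0// /c.
rewrite le_eqVlt; apply/orP; left; apply/eqP.
by rewrite /C1 /q; field; rewrite gt_eqF// gauss_gt0.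
Qed.

Lemma measurable_transition_kernel :
  measurable_fun setT (fun z : R * ('cV[R]_N * 'cV[R]_N) => k z.2.1 z.2.2 z.1).
Proof.
have mK : measurable_fun setT (fun z : R * ('cV[R]_N * 'cV[R]_N) => K z.1).
  exact: measurableT_comp (measurable_covmx _ _) measurable_fst.
have mE : measurable_fun setT (fun z : R * ('cV[R]_N * 'cV[R]_N) => E z.1).
  exact: (measurableT_comp (measurable_expmx B) measurable_fst).
have mX : measurable_fun setT (fun z : R * ('cV[R]_N * 'cV[R]_N) => z.2.1).
  exact: measurableT_comp.
have mY : measurable_fun setT (fun z : R * ('cV[R]_N * 'cV[R]_N) => z.2.2).
  exact: measurableT_comp.
have mZ : measurable_fun setT (fun z : R * ('cV[R]_N * 'cV[R]_N) => z.2.2 - E z.1 *m z.2.1).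
  by apply: measurable_addmx => //; apply: measurable_oppmx; exact: measurable_mulmx.
have mI : measurable_fun setT (fun z : R * ('cV[R]_N * 'cV[R]_N) => invmx (K z.1)).
  apply: measurable_fun_ifT => //.
    under eq_fun do rewrite unitmxE unitfE.
    apply: measurable_neg; apply: measurable_fun_eqr => //; exact: measurable_det.
  apply: measurable_scalemx; last exact: measurable_adj.
  by apply: (measurableT_comp measurable_invr); exact: measurable_det.
rewrite /transition_kernel; apply: measurable_funM.
  apply: measurable_funM => //; apply: (measurableT_comp measurable_invr).
  apply: (measurableT_comp (continuous_measurable_fun (@sqrt_continuous R))).
  by apply: measurable_det; exact: measurable_scalemx.
apply: measurableT_comp => //; apply: measurableT_comp => //.
apply: measurable_funM; first by apply: measurable_dotcv; [exact: measurable_mulmx mI mZ|exact: mZ].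
apply: (measurableT_comp measurable_invr); exact: measurable_funM.
Qed.

End transition_kernel_facts.

Section power_inequalities.
Context {R : realType}.
Implicit Types x y p : R.

Lemma powR_add_le x y p : 0 <= p -> 0 <= x -> 0 <= y ->
  (x + y) `^ p <= 2 `^ p * (x `^ p + y `^ p).
Proof.
move=> p0 x0 y0.
wlog xy : x y x0 y0 / x <= y.
  move=> H; have [/H|/ltW/H] := leP x y; first exact.
  by rewrite addrC [y `^ p + _]addrC; exact.
apply: (@le_trans _ _ ((2 * y) `^ p)).
  by apply: ge0_ler_powR; rewrite ?nnegrE ?addr_ge0 ?mulr_ge0// mulr2n mulrDl mul1r lerD2r.
by rewrite powRM// ler_wpM2l ?powR_ge0// lerDr powR_ge0.
Qed.

Lemma powR_tangent x m p : 1 <= p -> 0 <= x -> 0 < m ->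
  p * m `^ (p - 1) * x <= x `^ p + (p - 1) * m `^ p.
Proof.
move=> p1 x0 m0; have p0 : 0 < p := lt_le_trans ltr01 p1.
have [r r0 ->] : exists2 r, 0 <= r & x = m * r.
  by exists (x / m); [rewrite divr_ge0// ltW|rewrite mulrC divfK ?gt_eqF].
rewrite powRM// ?(ltW m0)//.
have -> : p * m `^ (p - 1) * (m * r) = m `^ p * (p * r).
  rewrite -(@mulr_powRB1 _ m p) ?(ltW m0)//; ring.
rewrite (_ : _ + _ = m `^ p * (r `^ p + (p - 1))); last by ring.
rewrite ler_wpM2l ?powR_ge0//.
have [->|p1'] := eqVneq p 1; first by rewrite powRr1// subrr addr0 mul1r.
have pgt1 : 1 < p by rewrite lt_neqAle eq_sym p1'.
have q0 : 0 < p / (p - 1) by rewrite divr_gt0// subr_gt0.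
have := @conjugate_powR _ r 1 p (p / (p - 1)) r0 ler01 p0 q0.
rewrite powR1 mulr1 => h.
have /h {}h : p^-1 + (p / (p - 1))^-1 = 1.
  by field; rewrite ?gt_eqF// subr_gt0.
have := ler_wpM2l (ltW p0) h; rewrite mulrDr mulrC => /le_trans; apply.
by rewrite le_eqVlt; apply/orP; left; apply/eqP; field; rewrite ?gt_eqF// subr_gt0.
Qed.

End power_inequalities.

Section nonneg_real_integrals.
Context d (T : measurableType d) (R : realType) (mu : {measure set T -> \bar R}).
Local Open Scope ereal_scope.
Implicit Types (f g : T -> R) (c : R).

Lemma ge0_integralZl_fin f c : measurable_fun setT f -> (forall x, 0 <= f x)%R ->
  (0 <= c)%R -> c%:E * \int[mu]_x (f x)%:E = \int[mu]_x (c * f x)%:E.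
Proof.
move=> mf f0 c0; under [RHS]eq_integral do rewrite EFinM.
rewrite ge0_integralZl//; first exact/measurable_EFinP.
by move=> x _; rewrite lee_fin.
Qed.

Lemma ge0_integralD_fin f g : measurable_fun setT f -> measurable_fun setT g ->
  (forall x, 0 <= f x)%R -> (forall x, 0 <= g x)%R ->
  \int[mu]_x (f x)%:E + \int[mu]_x (g x)%:E = \int[mu]_x (f x + g x)%:E.
Proof.
move=> mf mg f0 g0; under [RHS]eq_integral do rewrite EFinD.
rewrite ge0_integralD//.
- by move=> x _; rewrite lee_fin.
- exact/measurable_EFinP.
- by move=> x _; rewrite lee_fin.
- exact/measurable_EFinP.
Qed.

Lemma ge0_le_integral_fin f g : measurable_fun setT f -> measurable_fun setT g ->
  (forall x, 0 <= f x)%R -> (forall x, f x <= g x)%R ->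
  \int[mu]_x (f x)%:E <= \int[mu]_x (g x)%:E.
Proof.
move=> mf mg f0 fg; apply: ge0_le_integral => //.
- by move=> x _; rewrite lee_fin.
- exact/measurable_EFinP.
- exact/measurable_EFinP.
- by move=> x _; rewrite lee_fin.
Qed.

Lemma measurable_powR_fun f p : measurable_fun setT f ->
  measurable_fun setT (fun x => f x `^ p)%R.
Proof. exact: (measurableT_comp (@measurable_powR R p)). Qed.

Lemma measurable_powR_norm f p : measurable_fun setT f ->
  measurable_fun setT (fun x => `|f x| `^ p)%R.
Proof. by move=> mf; apply: measurable_powR_fun; exact: measurableT_comp. Qed.

End nonneg_real_integrals.

Section jensen.
Context d (T : measurableType d) (R : realType) (mu : {measure set T -> \bar R}).
Local Open Scope ereal_scope.

Lemma jensen_powR (w G : T -> R) (U W p : R) : (1 <= p)%R -> (0 < W)%R ->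
  measurable_fun setT w -> measurable_fun setT G ->
  (forall x, 0 <= w x)%R -> (forall x, 0 <= G x)%R ->
  \int[mu]_x (w x)%:E <= W%:E ->
  `|U|%:E <= \int[mu]_x (w x * G x)%:E ->
  (`|U| `^ p)%:E <= (W `^ (p - 1))%:E * \int[mu]_x (w x * G x `^ p)%:E.
Proof.
move=> p1 W0 mw mG w0 G0 wW hU.
have p0 : (0 < p)%R := lt_le_trans ltr01 p1.
have [->|U0] := eqVneq `|U|%R 0%R.
  rewrite powR0 ?gt_eqF// mule_ge0 ?lee_fin ?powR_ge0//.
  by apply: integral_ge0 => x _; rewrite lee_fin mulr_ge0 ?powR_ge0.
have {}U0 : (0 < `|U|)%R by rewrite lt_neqAle eq_sym U0/=.
pose m := (`|U| / W)%R; have m0 : (0 < m)%R by rewrite divr_gt0.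
have mGp : measurable_fun setT (fun x => G x `^ p)%R.
  exact: (measurableT_comp (@measurable_powR R p) mG).
have h1 : (p * m `^ (p - 1))%:E * \int[mu]_x (w x * G x)%:E <=
    \int[mu]_x (w x * G x `^ p)%:E + ((p - 1) * m `^ p)%:E * \int[mu]_x (w x)%:E.
  have wG0 x : (0 <= w x * G x)%R by rewrite mulr_ge0.
  have wGp0 x : (0 <= w x * G x `^ p)%R by rewrite mulr_ge0 ?powR_ge0.
  have mwG := measurable_funM mw mG; have mwGp := measurable_funM mw mGp.
  have c1 : (0 <= p * m `^ (p - 1))%R by rewrite mulr_ge0 ?powR_ge0 ?(ltW p0).
  have c2 : (0 <= (p - 1) * m `^ p)%R by rewrite mulr_ge0 ?powR_ge0// subr_ge0.
  rewrite !ge0_integralZl_fin// ge0_integralD_fin//.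
  - apply: ge0_le_integral_fin.
    + exact: measurable_funM.
    + by apply: measurable_funD => //; exact: measurable_funM.
    + by move=> x; rewrite mulr_ge0.
    + move=> x.
      rewrite [leRHS](_ : (_ = w x * (G x `^ p + (p - 1) * m `^ p))%R); last by ring.
      by rewrite mulrCA ler_wpM2l// powR_tangent.
  - exact: measurable_funM.
  - by move=> x; rewrite mulr_ge0.
have h2 : (p * m `^ (p - 1))%:E * (m * W)%:E <=
    \int[mu]_x (w x * G x `^ p)%:E + ((p - 1) * m `^ p)%:E * W%:E.
  apply: (le_trans _ (le_trans h1 _)).
    rewrite lee_wpmul2l ?lee_fin ?mulr_ge0 ?powR_ge0 ?(ltW p0)//.
    by rewrite /m divfK ?gt_eqF.
  by rewrite leeD2l// lee_wpmul2l// lee_fin mulr_ge0 ?powR_ge0// subr_ge0.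
have h3 : (m `^ p * W)%:E <= \int[mu]_x (w x * G x `^ p)%:E.
  rewrite -(@leeD2rE R (((p - 1) * m `^ p * W)%:E))//.
  apply: le_trans _ h2; rewrite -EFinM lee_fin -(@mulr_powRB1 _ m p) ?(ltW m0)//.
  rewrite le_eqVlt; apply/orP; left; apply/eqP; ring.
rewrite (_ : (`|U| `^ p = W `^ (p - 1) * (m `^ p * W))%R).
  by rewrite EFinM lee_wpmul2l// lee_fin powR_ge0.
rewrite mulrCA [(W `^ _ * W)%R]mulrC mulr_powRB1 ?(ltW W0)//.
by rewrite -powRM ?(ltW m0) ?(ltW W0)// /m divfK ?gt_eqF.
Qed.

End jensen.

Section energy.
Context {R : realType} {N : nat}.
Local Notation cV := 'cV[R]_N.
Local Notation L := (lebesgue_cV R N).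
Local Open Scope ereal_scope.

Definition Lpint (p : R) (f : cV -> R) : \bar R := \int[L]_X (`|f X| `^ p)%:E.

Definition energy (k : cV -> cV -> R) (p : R) (F : cV -> cV -> R) : \bar R :=
  \int[L]_X \int[L]_Y (k X Y * `|F X Y| `^ p)%:E.

Definition measurable2 (F : cV -> cV -> R) :=
  measurable_fun setT (fun z : cV * cV => F z.1 z.2).

Lemma measurable2_sec1 F X : measurable2 F -> measurable_fun setT (F X).
Proof.
exact: (@measurable_fun_pair2 _ _ _ _ _ _ (fun z : cV * cV => F z.1 z.2) X).
Qed.

Lemma measurable2_sec2 F Y : measurable2 F -> measurable_fun setT (F ^~ Y).
Proof.
exact: (@measurable_fun_pair1 _ _ _ _ _ _ (fun z : cV * cV => F z.1 z.2) Y).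
Qed.

Lemma measurable2_integral F : measurable2 F -> (forall X Y, 0 <= F X Y)%R ->
  measurable_fun setT (fun X => \int[L]_Y (F X Y)%:E).
Proof.
move=> mF F0.
apply: (measurable_fun_fubini_tonelli_F (m2 := L) (fun z : cV * cV => (F z.1 z.2)%:E)).
  exact/measurable_EFinP.
by move=> z; rewrite lee_fin.
Qed.

Lemma integral2_swap F : measurable2 F -> (forall X Y, 0 <= F X Y)%R ->
  \int[L]_X \int[L]_Y (F X Y)%:E = \int[L]_Y \int[L]_X (F X Y)%:E.
Proof.
move=> mF F0.
apply: (fubini_tonelli (m1 := L) (m2 := L) (fun z : cV * cV => (F z.1 z.2)%:E)).
  exact/measurable_EFinP.
by move=> z; rewrite lee_fin.
Qed.

Lemma Lpint_ge0 p f : 0 <= Lpint p f.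
Proof. by apply: integral_ge0 => X _; rewrite lee_fin powR_ge0. Qed.

Lemma Lpint_add_le p (f g h : cV -> R) : (0 <= p)%R ->
  measurable_fun setT f -> measurable_fun setT g -> measurable_fun setT h ->
  (forall X, `|f X| <= `|g X| + `|h X|)%R ->
  Lpint p f <= (2 `^ p)%:E * (Lpint p g + Lpint p h).
Proof.
move=> p0 mf mg mh fgh.
have [mfp mgp mhp] := And3 (measurable_powR_norm p mf) (measurable_powR_norm p mg)
  (measurable_powR_norm p mh).
have pow0 (u : cV -> R) X : (0 <= `|u X| `^ p)%R := powR_ge0 _ _.
have gh0 X : (0 <= `|g X| `^ p + `|h X| `^ p)%R by rewrite addr_ge0.
rewrite /Lpint ge0_integralD_fin// ge0_integralZl_fin ?powR_ge0//; last exact: measurable_funD.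
apply: ge0_le_integral_fin => //.
- by apply: measurable_funM => //; exact: measurable_funD.
- move=> X; apply: le_trans (powR_add_le p0 _ _) => //.
  by apply: ge0_ler_powR; rewrite ?nnegrE ?addr_ge0.
Qed.

Section fixed_kernel.
Variables (k : cV -> cV -> R) (p : R).
Hypothesis mk : measurable2 k.
Hypothesis k0 : forall X Y, (0 <= k X Y)%R.
Hypothesis p1 : (1 <= p)%R.

Let p0 : (0 < p)%R := lt_le_trans ltr01 p1.

Let kF0 (F : cV -> cV -> R) X Y : (0 <= k X Y * `|F X Y| `^ p)%R.
Proof. by rewrite mulr_ge0 ?powR_ge0. Qed.

Let mkF F : measurable2 F -> measurable2 (fun X Y => k X Y * `|F X Y| `^ p)%R.
Proof. by move=> mF; apply: measurable_funM => //; exact: measurable_powR_norm. Qed.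

Lemma energy_ge0 F : 0 <= energy k p F.
Proof. by apply: integral_ge0 => X _; apply: integral_ge0 => Y _; rewrite lee_fin. Qed.

Lemma le_integral2 (F G : cV -> cV -> R) : measurable2 F -> measurable2 G ->
  (forall X Y, 0 <= F X Y)%R -> (forall X Y, F X Y <= G X Y)%R ->
  \int[L]_X \int[L]_Y (F X Y)%:E <= \int[L]_X \int[L]_Y (G X Y)%:E.
Proof.
move=> mF mG F0 FG; have G0 X Y : (0 <= G X Y)%R := le_trans (F0 X Y) (FG X Y).
apply: ge0_le_integral => //.
- by move=> X _; apply: integral_ge0 => Y _; rewrite lee_fin.
- exact: measurable2_integral.
- exact: measurable2_integral.
- by move=> X _; apply: ge0_le_integral_fin => //; exact: measurable2_sec1.
Qed.

Lemma energy_add_le F G H : measurable2 F -> measurable2 G -> measurable2 H ->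
  (forall X Y, `|F X Y| <= `|G X Y| + `|H X Y|)%R ->
  energy k p F <= (2 `^ p)%:E * (energy k p G + energy k p H).
Proof.
move=> mF mG mH FGH; have [kF kG kH] := And3 (mkF mF) (mkF mG) (mkF mH).
pose S X Y := (k X Y * `|G X Y| `^ p + k X Y * `|H X Y| `^ p)%R.
have mS : measurable2 S by exact: measurable_funD.
have S0 X Y : (0 <= S X Y)%R by rewrite addr_ge0.
apply: (@le_trans _ _ (\int[L]_X \int[L]_Y (2 `^ p * S X Y)%:E)).
  apply: le_integral2 => //; first exact: measurable_funM.
  move=> X Y; rewrite /S -mulrDr mulrCA ler_wpM2l//.
  apply: le_trans (powR_add_le (ltW p0) _ _) => //.
  by apply: ge0_ler_powR; rewrite ?nnegrE ?addr_ge0 ?(ltW p0).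
have SE X : \int[L]_Y (2 `^ p * S X Y)%:E = (2 `^ p)%:E * \int[L]_Y (S X Y)%:E.
  by rewrite ge0_integralZl_fin ?powR_ge0//; exact: measurable2_sec1.
under eq_integral do rewrite SE.
rewrite ge0_integralZl//; last 2 first.
- exact: measurable2_integral.
- by move=> X _; apply: integral_ge0 => Y _; rewrite lee_fin.
rewrite lee_wpmul2l ?lee_fin ?powR_ge0// /energy -ge0_integralD//.
- rewrite le_eqVlt; apply/orP; left; apply/eqP; apply: eq_integral => X _.
  by rewrite ge0_integralD_fin//; [exact: (measurable2_sec1 X kG)|exact: (measurable2_sec1 X kH)].
- by move=> X _; apply: integral_ge0 => Y _; rewrite lee_fin.
- exact: measurable2_integral.
- by move=> X _; apply: integral_ge0 => Y _; rewrite lee_fin.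
- exact: measurable2_integral.
Qed.

Lemma energy_left_factor_le (f : cV -> R) (F : cV -> cV -> R) (c : R) :
  measurable_fun setT f -> measurable2 F -> (0 <= c)%R ->
  (forall X, \int[L]_Y (k X Y * `|F X Y| `^ p)%:E <= c%:E) ->
  energy k p (fun X Y => f X * F X Y)%R <= c%:E * Lpint p f.
Proof.
move=> mf mF c0 hc; rewrite /energy.
have mfp : measurable_fun setT (fun X => `|f X| `^ p)%R by exact: measurable_powR_norm.
apply: (@le_trans _ _ (\int[L]_X (c * `|f X| `^ p)%:E)); last first.
  by rewrite -ge0_integralZl_fin// => X; rewrite powR_ge0.
apply: ge0_le_integral => //.
- by move=> X _; apply: integral_ge0 => Y _; rewrite lee_fin mulr_ge0 ?powR_ge0.
- apply: measurable2_integral; last by move=> X Y; rewrite mulr_ge0 ?powR_ge0.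
  apply: measurable_funM => //; apply: measurable_powR_norm.
  by apply: measurable_funM => //; exact: (measurableT_comp mf measurable_fst).
- by apply/measurable_EFinP; exact: measurable_funM.
- move=> X _; under eq_integral do rewrite normrM powRM// mulrCA.
  rewrite -ge0_integralZl_fin ?powR_ge0//; last exact: measurable2_sec1 (mkF mF).
  by rewrite muleC EFinM lee_wpmul2r ?lee_fin ?powR_ge0.
Qed.

Hypothesis kY : forall X, \int[L]_Y (k X Y)%:E <= 1.

Lemma energy_diff_le (f : cV -> R) : measurable_fun setT f ->
  (forall Y, \int[L]_X (k X Y)%:E <= 1) ->
  energy k p (fun X Y => f Y - f X)%R <= (2 `^ p)%:E * (Lpint p f + Lpint p f).
Proof.
move=> mf kX.
have mf1 : measurable2 (fun X Y => f X) by exact: (measurableT_comp mf measurable_fst).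
have mf2 : measurable2 (fun X Y => f Y) by exact: (measurableT_comp mf measurable_snd).
apply: le_trans (energy_add_le (G := fun X Y => f Y) (H := fun X Y => f X) _ mf2 mf1 _) _.
- exact: measurable_funB.
- by move=> X Y; exact: ler_normB.
rewrite lee_wpmul2l ?lee_fin ?powR_ge0// leeD//.
  rewrite /energy (integral2_swap (mkF mf2)); last exact: kF0.
  apply: ge0_le_integral => //.
  - by move=> Y _; apply: integral_ge0 => X _; rewrite lee_fin mulr_ge0 ?powR_ge0.
  - apply: (measurable_fun_fubini_tonelli_G (m1 := L)
      (fun z : cV * cV => (k z.1 z.2 * `|f z.2| `^ p)%:E)).
      by apply/measurable_EFinP; exact: mkF mf2.
    by move=> z; rewrite lee_fin mulr_ge0 ?powR_ge0.
  - by apply/measurable_EFinP; exact: measurable_powR_norm.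
  - move=> Y _; under eq_integral do rewrite mulrC.
    rewrite -ge0_integralZl_fin ?powR_ge0//; last exact: measurable2_sec2.
    by rewrite -[leRHS]mule1 lee_wpmul2l ?lee_fin ?powR_ge0.
have := @energy_left_factor_le f (fun _ _ => 1%R) 1 mf _ ler01 _.
rewrite mul1e => h.
apply: le_trans (h _ _).
- rewrite le_eqVlt; apply/orP; left; apply/eqP; apply: eq_integral => X _.
  by apply: eq_integral => Y _; rewrite mulr1.
- exact: measurable_cst.
- by move=> X; under eq_integral do rewrite normr1 powR1 mulr1.
Qed.

End fixed_kernel.

End energy.

Section signed_substitution.
Context {R : realType} {N : nat}.
Local Notation cV := 'cV[R]_N.
Local Notation L := (lebesgue_cV R N).
Local Open Scope ereal_scope.

Lemma measurable_affine (A : 'M[R]_N) (b : cV) :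
  measurable_fun setT (fun h : cV => A *m h + b)%R.
Proof. by apply: measurable_addmx => //; exact: measurable_mulmx. Qed.

Lemma integral_affine_cV_inv (A : 'M[R]_N) (b : cV) (g : cV -> \bar R) :
  posdef A -> measurable_fun setT g -> (forall X, 0 <= g X) ->
  \int[L]_X g (A *m X + b)%R = (\det A)^-1%:E * \int[L]_X g X.
Proof.
move=> pA mg g0; rewrite -(integral_affine_cV b pA mg g0) muleA -EFinM mulVf ?mul1e//.
by rewrite gt_eqF// posdef_det_gt0.
Qed.

Lemma integrable_affine_cV (A : 'M[R]_N) (b : cV) (g : cV -> R) : posdef A ->
  L.-integrable setT (EFin \o g) ->
  L.-integrable setT (fun h : cV => (g (A *m h + b)%R)%:E).
Proof.
move=> pA /integrableP[mg gfin]; apply/integrableP; split.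
  exact: (measurableT_comp mg (measurable_affine A b)).
have mag : measurable_fun setT (fun X => `|(g X)%:E|) by exact: measurableT_comp.
rewrite (integral_affine_cV_inv b pA mag)// lte_mul_pinfty// lee_fin.
by rewrite invr_ge0 ltW// posdef_det_gt0.
Qed.

Lemma Rintegral_affine_cV (A : 'M[R]_N) (b : cV) (g : cV -> R) : posdef A ->
  L.-integrable setT (EFin \o g) ->
  (\det A * \int[L]_X g (A *m X + b) = \int[L]_X g X)%R.
Proof.
move=> pA ig; have dA := posdef_det_gt0 pA.
rewrite -[RHS]mul1r -(@mulfV _ (\det A)) ?gt_eqF// -mulrA; congr (_ * _)%R.
have mg := measurable_int _ ig.
rewrite /Rintegral -[((\det A)^-1)%R]/(fine (\det A)^-1%:E) -fineM//; last exact: integrable_fin_num.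
congr fine; rewrite [LHS]integralE [in RHS]integralE.
have mp := measurable_funepos mg; have mn := measurable_funeneg mg.
have e1 := integral_affine_cV_inv b pA mp (funepos_ge0 _).
have e2 := integral_affine_cV_inv b pA mn (funeneg_ge0 _).
rewrite muleBr//; last first.
  by rewrite fin_num_adde_defl// fin_numN; exact: (integrable_neg_fin_num measurableT ig).
rewrite -e1 -e2; congr (_ - _); apply: eq_integral => X _.
  by rewrite !funeposE.
by rewrite !funenegE.
Qed.

Lemma abs_Rintegral_le (f : cV -> R) : L.-integrable setT (EFin \o f) ->
  (`|\int[L]_X f X|%R)%:E <= \int[L]_X (`|f X|%R)%:E.
Proof.
move=> fi; rewrite EFin_normr_Rintegral//.
exact: le_abse_integral (measurable_int _ fi).
Qed.

Lemma integrable_bounded_mul (h g : cV -> R) (M : R) : measurable_fun setT h ->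
  (forall X, `|h X| <= M)%R -> L.-integrable setT (EFin \o g) ->
  L.-integrable setT (EFin \o (fun X => h X * g X)%R).
Proof.
move=> mh hM ig.
have := @integrableMr _ _ _ L setT measurableT h (EFin \o g) mh _ ig; apply.
exists M; split; first exact: num_real.
by move=> x Mx X _ /=; rewrite (le_trans (hM X))// ltW.
Qed.

Lemma integral2_shift (F : cV -> cV -> R) (a b : cV) (c : R) :
  measurable2 F -> (forall X Y, 0 <= F X Y)%R -> (0 <= c)%R ->
  \int[L]_X \int[L]_Y (c * F (X + a) (Y + b))%:E =
  c%:E * \int[L]_X \int[L]_Y (F X Y)%:E.
Proof.
move=> mF F0 c0.
have mFI := measurable2_integral mF F0.
have FI0 X : 0 <= \int[L]_Y (F X Y)%:E by apply: integral_ge0 => Y _; rewrite lee_fin.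
have mFY X : measurable_fun setT (fun Y => (F X Y)%:E).
  by apply/measurable_EFinP; exact: measurable2_sec1.
have FY0 X Y : 0 <= (F X Y)%:E by rewrite lee_fin.
have mFYb X : measurable_fun setT (fun Y : cV => F X (Y + b)%R).
  apply: (measurableT_comp (measurable2_sec1 X mF)); exact: measurable_addmx.
transitivity (\int[L]_X (c%:E * \int[L]_Y (F (X + a)%R Y)%:E)).
  apply: eq_integral => X _.
  rewrite -(ge0_integralZl_fin L (mFYb (X + a)%R))//.
  by rewrite (integral_shift_cV b (mFY (X + a)%R)).
have mFIa : measurable_fun setT (fun X : cV => \int[L]_Y (F (X + a)%R Y)%:E).
  apply: (measurableT_comp mFI); exact: measurable_addmx.
have c0' : 0 <= c%:E by rewrite lee_fin.
rewrite (ge0_integralZl L measurableT mFIa (fun X _ => FI0 (X + a)%R) c0').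
by rewrite (integral_shift_cV a mFI FI0).
Qed.

Lemma integral3_rot (Phi : (cV * cV) * cV -> R) : measurable_fun setT Phi ->
  (forall z, 0 <= Phi z)%R ->
  \int[L]_X \int[L]_Y \int[L]_h (Phi ((X, Y), h))%:E =
  \int[L]_h \int[L]_X \int[L]_Y (Phi ((X, Y), h))%:E.
Proof.
move=> mPhi Phi0.
have mPhiX X : measurable2 (fun Y h => Phi ((X, Y), h)).
  apply: (measurableT_comp mPhi).
  apply: measurable_fun_pair => //; exact: measurable_fun_pair.
transitivity (\int[L]_X \int[L]_h \int[L]_Y (Phi ((X, Y), h))%:E).
  by apply: eq_integral => X _; rewrite (integral2_swap (mPhiX X)).
have mPsi : measurable_fun setT (fun z : cV * cV => \int[L]_Y (Phi ((z.1, Y), z.2))%:E).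
  apply: (measurable_fun_fubini_tonelli_F (m2 := L)
    (fun z : (cV * cV) * cV => (Phi ((z.1.1, z.2), z.1.2))%:E)).
    apply/measurable_EFinP; apply: (measurableT_comp mPhi).
    by apply: measurable_fun_pair; [apply: measurable_fun_pair => //|];
      exact: measurableT_comp.
  by move=> z; rewrite lee_fin.
apply: (fubini_tonelli (m1 := L) (m2 := L)
    (fun z : cV * cV => \int[L]_Y (Phi ((z.1, Y), z.2))%:E)) => //.
by move=> z; apply: integral_ge0 => Y _; rewrite lee_fin.
Qed.

Lemma integral_weighted_translate (w f : cV -> R) (eps : R) :
  measurable_fun setT w -> (forall h, 0 <= w h)%R ->
  measurable_fun setT f -> (forall X, 0 <= f X)%R ->
  \int[L]_X \int[L]_h (w h * f (X + eps *: h))%:E =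
  \int[L]_h (w h)%:E * \int[L]_X (f X)%:E.
Proof.
move=> mw w0 mf f0.
have mwf : measurable2 (fun X h => w h * f (X + eps *: h))%R.
  apply: measurable_funM; first exact: (measurableT_comp mw measurable_snd).
  apply: (measurableT_comp mf).
  by apply: measurable_addmx => //; exact: measurable_scalemx.
have wf0 X h : (0 <= w h * f (X + eps *: h))%R by rewrite mulr_ge0.
have mfe : measurable_fun setT (fun X => (f X)%:E) by exact/measurable_EFinP.
have fe0 X : 0 <= (f X)%:E by rewrite lee_fin.
have mwe : measurable_fun setT (fun X => (w X)%:E) by exact/measurable_EFinP.
have we0 X : 0 <= (w X)%:E by rewrite lee_fin.
have If0 : 0 <= \int[L]_X (f X)%:E by exact: integral_ge0.
rewrite (integral2_swap mwf wf0) -(ge0_integralZr L measurableT mwe (fun X _ => we0 X) If0).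
apply: eq_integral => h _.
have mfh : measurable_fun setT (fun X : cV => f (X + eps *: h)%R).
  apply: (measurableT_comp mf); exact: measurable_addmx.
rewrite -(ge0_integralZl_fin L mfh (fun X => f0 _) (w0 h)).
by rewrite (integral_shift_cV (eps *: h) mfe fe0).
Qed.

End signed_substitution.

Section truncation_mollification.
Context {R : realType} {N : nat}.
Local Notation cV := 'cV[R]_N.
Local Notation L := (lebesgue_cV R N).
Local Open Scope ereal_scope.
Variables (k : cV -> cV -> R) (p : R) (E : 'M[R]_N).
Hypothesis mk : measurable2 k.
Hypothesis k0 : forall X Y, (0 <= k X Y)%R.
Hypothesis p1 : (1 <= p)%R.
Hypothesis kY : forall X, \int[L]_Y (k X Y)%:E <= 1.

Let p0 : (0 < p)%R := lt_le_trans ltr01 p1.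

Lemma measurable2_diff (f : cV -> R) : measurable_fun setT f ->
  measurable2 (fun X Y => f Y - f X)%R.
Proof.
move=> mf; apply: measurable_funB.
  exact: (measurableT_comp mf measurable_snd).
exact: (measurableT_comp mf measurable_fst).
Qed.

Lemma energy_truncation_le (f chi : cV -> R) (a b m : R) :
  measurable_fun setT f -> measurable_fun setT chi ->
  (forall X, 0 <= chi X <= 1)%R -> (0 <= a)%R -> (0 <= b)%R -> (0 <= m)%R ->
  (forall X Y, `|chi Y - chi X| <= a * `|Y - E *m X| + b)%R ->
  (forall X, \int[L]_Y (k X Y * `|Y - E *m X| `^ p)%:E <= m%:E) ->
  energy k p (fun X Y => f Y * chi Y - f X * chi X)%R <=
  (2 `^ p)%:E * (energy k p (fun X Y => f Y - f X)%R +
    (2 `^ p * (a `^ p * m + b `^ p))%:E * Lpint p f).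
Proof.
move=> mf mchi chi01 a0 b0 m0 hchi hm.
have mD : measurable2 (fun X Y => chi Y - chi X)%R by exact: measurable2_diff.
have mZ : measurable2 (fun X Y => `|Y - E *m X|)%R.
  apply: (measurableT_comp (continuous_measurable_matrix (@norm_continuous _ _))).
  apply: measurable_addmx => //; apply: measurable_oppmx.
  by apply: measurable_mulmx => //; exact: measurable_fst.
have mZp : measurable2 (fun X Y => k X Y * `|Y - E *m X| `^ p)%R.
  by apply: measurable_funM => //; exact: measurable_powR_fun.
apply: le_trans (@energy_add_le _ _ k p mk k0 p1 _ (fun X Y => f Y - f X)%R
  (fun X Y => f X * (chi Y - chi X))%R _ _ _ _) _.
- by apply: (@measurable2_diff (fun X => f X * chi X)%R); exact: measurable_funM.
- exact: measurable2_diff.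
- by apply: measurable_funM => //; exact: (measurableT_comp mf measurable_fst).
- move=> X Y.
  have -> : (f Y * chi Y - f X * chi X = (f Y - f X) * chi Y + f X * (chi Y - chi X))%R by ring.
  rewrite (le_trans (ler_normD _ _))// lerD2r normrM ler_piMr//.
  by have /andP[c0 c1] := chi01 Y; rewrite ger0_norm.
rewrite lee_wpmul2l ?lee_fin ?powR_ge0// leeD2l//.
apply: energy_left_factor_le => //.
  by rewrite mulr_ge0 ?addr_ge0 ?mulr_ge0 ?powR_ge0.
move=> X.
have mZpX := measurable2_sec1 X mZp; have mkX := measurable2_sec1 X mk.
have zp0 Y : (0 <= k X Y * `|Y - E *m X| `^ p)%R by rewrite mulr_ge0 ?powR_ge0.
have azp0 Y : (0 <= a `^ p * (k X Y * `|Y - E *m X| `^ p))%R by rewrite mulr_ge0 ?powR_ge0.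
have bk0 Y : (0 <= b `^ p * k X Y)%R by rewrite mulr_ge0 ?powR_ge0.
have mazp : measurable_fun setT (fun Y => a `^ p * (k X Y * `|Y - E *m X| `^ p))%R.
  exact: measurable_funM.
have mbk : measurable_fun setT (fun Y => b `^ p * k X Y)%R by exact: measurable_funM.
have s0 Y : (0 <= a `^ p * (k X Y * `|Y - E *m X| `^ p) + b `^ p * k X Y)%R by rewrite addr_ge0.
have ms : measurable_fun setT (fun Y => a `^ p * (k X Y * `|Y - E *m X| `^ p) + b `^ p * k X Y)%R.
  exact: measurable_funD.
apply: (@le_trans _ _ (\int[L]_Y (2 `^ p * (a `^ p * (k X Y * `|Y - E *m X| `^ p) +
   b `^ p * k X Y))%:E)).
  apply: ge0_le_integral_fin => //.
  - apply: measurable_funM => //; apply: measurable_powR_norm.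
    exact: (measurable2_sec1 X mD).
  - exact: measurable_funM.
  - by move=> Y; rewrite mulr_ge0 ?powR_ge0.
  - move=> Y; rewrite [leRHS](_ : _ = k X Y * (2 `^ p * (a `^ p * `|Y - E *m X| `^ p + b `^ p)))%R; last by ring.
    rewrite ler_wpM2l// -powRM//.
    apply: le_trans (powR_add_le (ltW p0) _ b0); last by rewrite mulr_ge0.
    by apply: ge0_ler_powR; rewrite ?nnegrE ?addr_ge0 ?mulr_ge0 ?(ltW p0)//; exact: hchi.
rewrite -ge0_integralZl_fin ?powR_ge0// -ge0_integralD_fin//.
rewrite -(ge0_integralZl_fin _ mZpX zp0) ?powR_ge0//.
rewrite -(ge0_integralZl_fin _ mkX (k0 X)) ?powR_ge0//.
rewrite EFinM lee_wpmul2l ?lee_fin ?powR_ge0// EFinD leeD//.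
  by rewrite EFinM lee_wpmul2l ?lee_fin ?powR_ge0.
by rewrite -[leRHS]mule1 lee_wpmul2l ?lee_fin ?powR_ge0.
Qed.

Lemma energy_le_split (F : cV -> cV -> R) (J1 : cV -> cV -> \bar R)
    (J2 : cV -> \bar R) (c : R) : (0 <= c)%R -> measurable2 F ->
  measurable_fun setT (fun z : cV * cV => J1 z.1 z.2) -> measurable_fun setT J2 ->
  (forall X Y, 0 <= J1 X Y) -> (forall X, 0 <= J2 X) ->
  (forall X Y, (`|F X Y| `^ p)%:E <= c%:E * (J1 X Y + J2 X)) ->
  energy k p F <= c%:E * (\int[L]_X \int[L]_Y ((k X Y)%:E * J1 X Y) + \int[L]_X J2 X).
Proof.
move=> c0' mF mJ1 mJ2 J1_ge0 J2_ge0 FJ.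
have c0 : 0 <= c%:E by rewrite lee_fin.
have mk' : measurable_fun setT (fun z : cV * cV => (k z.1 z.2)%:E) by exact/measurable_EFinP.
have mJ2' : measurable_fun setT (fun z : cV * cV => J2 z.1) by exact: measurableT_comp.
have mkJ1 : measurable_fun setT (fun z : cV * cV => (k z.1 z.2)%:E * J1 z.1 z.2) by exact: emeasurable_funM.
have mkJ2 : measurable_fun setT (fun z : cV * cV => (k z.1 z.2)%:E * J2 z.1) by exact: emeasurable_funM.
have kX0 X Y : 0 <= (k X Y)%:E by rewrite lee_fin.
have kJ10 X Y : 0 <= (k X Y)%:E * J1 X Y by rewrite mule_ge0.
have kJ20 X Y : 0 <= (k X Y)%:E * J2 X by rewrite mule_ge0.
have sec (f : cV -> cV -> \bar R) X : measurable_fun setT (fun z : cV * cV => f z.1 z.2) ->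
    measurable_fun setT (f X).
  exact: (@measurable_fun_pair2 _ _ _ _ _ _ (fun z : cV * cV => f z.1 z.2) X).
have mI (f : cV -> cV -> \bar R) : measurable_fun setT (fun z : cV * cV => f z.1 z.2) ->
    (forall X Y, 0 <= f X Y) -> measurable_fun setT (fun X => \int[L]_Y f X Y).
  move=> mf f0.
  exact: (measurable_fun_fubini_tonelli_F (m2 := L) (fun z : cV * cV => f z.1 z.2)).
pose S X Y := (k X Y)%:E * J1 X Y + (k X Y)%:E * J2 X.
have mS : measurable_fun setT (fun z : cV * cV => S z.1 z.2) by exact: emeasurable_funD.
have S0 X Y : 0 <= S X Y by rewrite adde_ge0.
apply: (@le_trans _ _ (\int[L]_X \int[L]_Y (c%:E * S X Y))).
  have mkF' : measurable2 (fun X Y => k X Y * `|F X Y| `^ p)%R.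
    by apply: measurable_funM => //; exact: measurable_powR_norm.
  have mcS : measurable_fun setT (fun z : cV * cV => c%:E * S z.1 z.2).
    exact: emeasurable_funM.
  have cS0 X Y : 0 <= c%:E * S X Y by rewrite mule_ge0 ?lee_fin ?c0.
  apply: ge0_le_integral => //.
  - by move=> X _; apply: integral_ge0 => Y _; rewrite lee_fin mulr_ge0 ?powR_ge0.
  - by apply: measurable2_integral => // X Y; rewrite mulr_ge0 ?powR_ge0.
  - exact: (mI (fun X Y => c%:E * S X Y)).
  move=> X _; apply: ge0_le_integral => //.
  - by move=> Y _; rewrite lee_fin mulr_ge0 ?powR_ge0.
  - by apply/measurable_EFinP; exact: (measurable2_sec1 X mkF').
  - exact: (sec (fun X Y => c%:E * S X Y)).
  move=> Y _; rewrite /S -ge0_muleDr// muleCA EFinM.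
  by rewrite lee_wpmul2l.
have -> : \int[L]_X \int[L]_Y (c%:E * S X Y) = c%:E *
   (\int[L]_X \int[L]_Y ((k X Y)%:E * J1 X Y) + \int[L]_X \int[L]_Y ((k X Y)%:E * J2 X)).
  transitivity (\int[L]_X (c%:E * \int[L]_Y S X Y)).
    apply: eq_integral => X _; rewrite ge0_integralZl//.
    exact: sec.
  rewrite ge0_integralZl//; last 2 first.
  - exact: mI.
  - by move=> X _; exact: integral_ge0.
  congr (_ * _); rewrite -ge0_integralD//; last 4 first.
  - by move=> X _; exact: integral_ge0.
  - exact: (mI (fun X Y => (k X Y)%:E * J1 X Y)).
  - by move=> X _; exact: integral_ge0.
  - exact: (mI (fun X Y => (k X Y)%:E * J2 X)).
  apply: eq_integral => X _; rewrite ge0_integralD//.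
  - exact: (sec (fun X Y => (k X Y)%:E * J1 X Y)).
  - exact: (sec (fun X Y => (k X Y)%:E * J2 X)).
rewrite lee_wpmul2l// leeD2l//; apply: ge0_le_integral => //.
- by move=> X _; exact: integral_ge0.
- exact: (mI (fun X Y => (k X Y)%:E * J2 X)).
- move=> X _; rewrite ge0_integralZr//; last by apply/measurable_EFinP; exact: measurable2_sec1.
  by rewrite -[leRHS]mul1e lee_wpmul2r.
Qed.

Hypothesis pE : posdef E.
Hypothesis uE : E \in unitmx.
Hypothesis kshift : forall X Y h, k (X + invmx E *m h)%R (Y + h)%R = k X Y.

Variables (rho g : cV -> R) (Mr eps W : R).
Hypothesis mrho : measurable_fun setT rho.
Hypothesis rho0 : forall h, (0 <= rho h)%R.
Hypothesis rhoM : forall h, (rho h <= Mr)%R.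
Hypothesis rho1 : \int[L]_h (rho h)%:E = 1.
Hypothesis eps0 : (0 < eps)%R.
Hypothesis ig : L.-integrable setT (EFin \o g).
Hypothesis W0 : (0 < W)%R.
Hypothesis rhoW : \int[L]_h (`|\det E * rho (E *m h) - rho h|)%:E <= W%:E.

Definition mollify (rho : cV -> R) (eps : R) (g : cV -> R) (X : cV) : R :=
  (\int[L]_h (rho h * g (X + eps *: h)))%R.

Let mg : measurable_fun setT g.
Proof. by apply/measurable_EFinP; exact: measurable_int ig. Qed.

Let posE1 : posdef (invmx E).
Proof.
move=> X X0; have X'0 : invmx E *m X != 0%R.
  by apply: contra X0 => /eqP X0; rewrite -(mulKVmx uE X) X0 mulmx0.
by have := pE X'0; rewrite mulKVmx// dotcvC.
Qed.

Let posdefS (A : 'M[R]_N) : posdef A -> posdef (eps *: A).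
Proof. by move=> pA X X0; rewrite -scalemxAl dotcvZl mulr_gt0// pA. Qed.

Let ish (A : 'M[R]_N) X : posdef A ->
  L.-integrable setT (EFin \o (fun h => g (X + eps *: (A *m h)))%R).
Proof.
move=> pA; have := integrable_affine_cV X (posdefS pA) ig.
by congr (_.-integrable _ _); apply/funext => h /=; rewrite -scalemxAl addrC.
Qed.

Let rho_abs h : (`|rho h| <= Mr)%R. Proof. by rewrite ger0_norm. Qed.

Let mshift (A : 'M[R]_N) X : measurable_fun setT (fun h : cV => X + eps *: (A *m h))%R.
Proof.
apply: measurable_addmx => //; apply: measurable_scalemx => //.
exact: measurable_mulmx.
Qed.

Let ug X : L.-integrable setT (EFin \o (fun h => rho h * g (X + eps *: h)))%R.
Proof.
apply: (@integrable_bounded_mul _ _ rho (fun h => g (X + eps *: h))%R _ mrho rho_abs).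
have := @ish 1%:M X (@posdef1 _ _).
by congr (_.-integrable _ _); apply/funext => h /=; rewrite mul1mx.
Qed.

Let vg X : L.-integrable setT (EFin \o (fun h => rho h * g (X + eps *: (invmx E *m h))))%R.
Proof.
exact: (@integrable_bounded_mul _ _ rho (fun h => g (X + eps *: (invmx E *m h)))%R _ mrho
  rho_abs (ish X posE1)).
Qed.

Let v X := (\int[L]_h (rho h * g (X + eps *: (invmx E *m h))))%R.

Let vE X : v X = (\int[L]_h (\det E * rho (E *m h) * g (X + eps *: h)))%R.
Proof.
rewrite /v -(Rintegral_affine_cV 0 pE (vg X)).
under eq_Rintegral do rewrite addr0 mulKmx//.
rewrite -RintegralZl//.
  by apply: eq_Rintegral => h _; rewrite mulrA.
have := integrable_affine_cV 0 pE (vg X).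
congr (_.-integrable _ _); apply/funext => h /=.
by rewrite addr0 mulKmx.
Qed.

Let J1 X Y := \int[L]_h (rho h * `|g (Y + eps *: h) - g (X + eps *: (invmx E *m h))| `^ p)%:E.

Let w h := `|\det E * rho (E *m h) - rho h|%R.

Let J2 X := (W `^ (p - 1))%:E * \int[L]_h (w h * `|g (X + eps *: h)| `^ p)%:E.

Let mgs (A : 'M[R]_N) X : measurable_fun setT (fun h : cV => g (X + eps *: (A *m h)))%R.
Proof. exact: (measurableT_comp mg (mshift A X)). Qed.

Let mgs1 X : measurable_fun setT (fun h : cV => g (X + eps *: h))%R.
Proof. by have := mgs 1%:M X; under eq_fun do rewrite mul1mx. Qed.

Let mrhoE : measurable_fun setT (fun h => \det E * rho (E *m h))%R.
Proof.
apply: measurable_funM => //; apply: (measurableT_comp mrho).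
exact: measurable_mulmx.
Qed.

Let mw : measurable_fun setT w.
Proof. by apply: measurableT_comp => //; exact: measurable_funB. Qed.

Let J1_ge X Y : (`|mollify rho eps g Y - v X| `^ p)%:E <= J1 X Y.
Proof.
have := @jensen_powR _ _ _ L rho (fun h => `|g (Y + eps *: h) - g (X + eps *: (invmx E *m h))|)%R
  (mollify rho eps g Y - v X) 1 p p1 ltr01 mrho.
rewrite powR1 mul1e; apply => //.
- by apply: measurableT_comp => //; exact: measurable_funB.
- by rewrite rho1.
have -> : (mollify rho eps g Y - v X =
   \int[L]_h (rho h * (g (Y + eps *: h) - g (X + eps *: (invmx E *m h)))))%R.
  rewrite /mollify /v -RintegralB//; apply: eq_Rintegral => h _.
  by rewrite mulrBr.
apply: le_trans (abs_Rintegral_le _) _.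
  have := integrableB measurableT (ug Y) (vg X); congr (_.-integrable _ _).
  by apply/funext => h /=; rewrite -EFinB mulrBr.
rewrite le_eqVlt; apply/orP; left; apply/eqP; apply: eq_integral => h _.
by rewrite normrM ger0_norm.
Qed.

Let J2_ge X : (`|v X - mollify rho eps g X| `^ p)%:E <= J2 X.
Proof.
apply: jensen_powR => //.
- by apply: measurableT_comp.
- by move=> h; exact: normr_ge0.
have iE : L.-integrable setT (EFin \o (fun h => \det E * rho (E *m h) * g (X + eps *: h)))%R.
  have := integrableZl measurableT (\det E) (integrable_affine_cV 0 pE (vg X)).
  congr (_.-integrable _ _); apply/funext => h /=.
  by rewrite addr0 mulKmx// -EFinM mulrA.
have -> : (v X - mollify rho eps g X =
   \int[L]_h ((\det E * rho (E *m h) - rho h) * g (X + eps *: h)))%R.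
  rewrite /mollify vE -RintegralB//; apply: eq_Rintegral => h _.
  by rewrite mulrBl.
apply: le_trans (abs_Rintegral_le _) _.
  have := integrableB measurableT iE (ug X); congr (_.-integrable _ _).
  by apply/funext => h /=; rewrite -EFinB mulrBl.
rewrite le_eqVlt; apply/orP; left; apply/eqP; apply: eq_integral => h _.
by rewrite normrM.
Qed.

Let Phi (z : (cV * cV) * cV) := (rho z.2 * (k z.1.1 z.1.2 *
  `|g (z.1.2 + eps *: z.2) - g (z.1.1 + eps *: (invmx E *m z.2))| `^ p))%R.

Let Phi0 z : (0 <= Phi z)%R.
Proof. by rewrite /Phi !mulr_ge0 ?powR_ge0. Qed.

Let mPhi : measurable_fun setT Phi.
Proof.
have m1 : measurable_fun setT (fun z : (cV * cV) * cV => z.1.1) by exact: measurableT_comp.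
have m2 : measurable_fun setT (fun z : (cV * cV) * cV => z.1.2) by exact: measurableT_comp.
apply: measurable_funM; first exact: (measurableT_comp mrho measurable_snd).
apply: measurable_funM; first exact: (measurableT_comp mk measurable_fst).
apply: measurable_powR_norm; apply: measurable_funB; apply: (measurableT_comp mg);
  apply: measurable_addmx => //; apply: measurable_scalemx => //.
exact: measurable_mulmx.
Qed.

Let translate_energy h : \int[L]_X \int[L]_Y (Phi ((X, Y), h))%:E =
  (rho h)%:E * energy k p (fun X Y => g Y - g X)%R.
Proof.
pose Th X Y := (k X Y * `|g Y - g X| `^ p)%R.
have mTh : measurable2 Th.
  by apply: measurable_funM => //; apply: measurable_powR_norm; exact: measurable2_diff.
have Th0 X Y : (0 <= Th X Y)%R by rewrite mulr_ge0 ?powR_ge0.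
have ThE X Y : Phi ((X, Y), h) = (rho h * Th (X + invmx E *m (eps *: h)) (Y + eps *: h))%R.
  by rewrite /Phi /Th kshift /= scalemxAr.
under eq_integral do under eq_integral do rewrite ThE.
exact: (integral2_shift (invmx E *m (eps *: h)) (eps *: h) mTh Th0 (rho0 h)).
Qed.

Let J1_energy : \int[L]_X \int[L]_Y ((k X Y)%:E * J1 X Y) = energy k p (fun X Y => g Y - g X)%R.
Proof.
transitivity (\int[L]_X \int[L]_Y \int[L]_h (Phi ((X, Y), h))%:E).
  apply: eq_integral => X _; apply: eq_integral => Y _.
  pose f h := (rho h * `|g (Y + eps *: h) - g (X + eps *: (invmx E *m h))| `^ p)%R.
  have mf : measurable_fun setT f.
    apply: measurable_funM => //; apply: measurable_powR_norm.
    exact: measurable_funB.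
  have f0 h : (0 <= f h)%R by rewrite mulr_ge0 ?powR_ge0.
  rewrite [LHS](ge0_integralZl_fin L mf f0 (k0 X Y)).
  by apply: eq_integral => h _; rewrite /Phi mulrCA.
rewrite (integral3_rot mPhi Phi0).
under eq_integral do rewrite translate_energy.
rewrite ge0_integralZr ?rho1 ?mul1e//; first exact/measurable_EFinP.
- by move=> h _; rewrite lee_fin.
- by apply: integral_ge0 => X _; apply: integral_ge0 => Y _;
    rewrite lee_fin mulr_ge0 ?powR_ge0.
Qed.

Let mJ1 : measurable_fun setT (fun z : cV * cV => J1 z.1 z.2).
Proof.
have m1 : measurable_fun setT (fun z : (cV * cV) * cV => z.1.1) by exact: measurableT_comp.
have m2 : measurable_fun setT (fun z : (cV * cV) * cV => z.1.2) by exact: measurableT_comp.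
apply: (measurable_fun_fubini_tonelli_F (m2 := L)
  (fun z : (cV * cV) * cV => (rho z.2 * `|g (z.1.2 + eps *: z.2) -
     g (z.1.1 + eps *: (invmx E *m z.2))| `^ p)%:E)).
  apply/measurable_EFinP.
  apply: measurable_funM; first exact: (measurableT_comp mrho measurable_snd).
  apply: measurable_powR_norm; apply: measurable_funB; apply: (measurableT_comp mg);
    apply: measurable_addmx => //; apply: measurable_scalemx => //.
  exact: measurable_mulmx.
by move=> z; rewrite lee_fin mulr_ge0 ?powR_ge0.
Qed.

Let mwg : measurable2 (fun X h => w h * `|g (X + eps *: h)| `^ p)%R.
Proof.
apply: measurable_funM; first exact: (measurableT_comp mw measurable_snd).
apply: measurable_powR_norm; apply: (measurableT_comp mg).
by apply: measurable_addmx => //; exact: measurable_scalemx.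
Qed.

Let wg0 X h : (0 <= w h * `|g (X + eps *: h)| `^ p)%R.
Proof. by rewrite mulr_ge0 ?powR_ge0 ?normr_ge0. Qed.

Let mJ2 : measurable_fun setT J2.
Proof.
apply: emeasurable_funM => //.
exact: (measurable2_integral mwg wg0).
Qed.

Let J1_ge0 X Y : 0 <= J1 X Y.
Proof. by apply: integral_ge0 => h _; rewrite lee_fin mulr_ge0 ?powR_ge0. Qed.

Let J2_ge0 X : 0 <= J2 X.
Proof.
rewrite mule_ge0 ?lee_fin ?powR_ge0//.
by apply: integral_ge0 => h _; rewrite lee_fin wg0.
Qed.

Let J2_Lpint : \int[L]_X J2 X <= (W `^ p)%:E * Lpint p g.
Proof.
have I0 X : 0 <= \int[L]_h (w h * `|g (X + eps *: h)| `^ p)%:E.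
  by apply: integral_ge0 => h _; rewrite lee_fin wg0.
have W0' : 0 <= (W `^ (p - 1))%:E by rewrite lee_fin powR_ge0.
rewrite /J2 (ge0_integralZl L measurableT (measurable2_integral mwg wg0) (fun X _ => I0 X) W0').
have mgp : measurable_fun setT (fun X => `|g X| `^ p)%R by exact: measurable_powR_norm.
have w0 h : (0 <= w h)%R by exact: normr_ge0.
have gp0 X : (0 <= `|g X| `^ p)%R by exact: powR_ge0.
rewrite (integral_weighted_translate eps mw w0 mgp gp0).
rewrite muleA lee_wpmul2r ?Lpint_ge0//.
apply: (@le_trans _ _ ((W `^ (p - 1))%:E * W%:E)).
  by rewrite lee_wpmul2l ?lee_fin ?powR_ge0.
by rewrite -EFinM lee_fin mulrC mulr_powRB1 ?(ltW W0).
Qed.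

(* Write u Y - u X as the average over h of g (Y + eps h) - g (X + eps E^-1 h),
   whose energy is that of g by invariance of the kernel, plus an error that is
   an average of g against the weight |det E rho (E h) - rho h| of mass W. *)
Lemma energy_mollify_le : measurable_fun setT (mollify rho eps g) ->
  energy k p (fun X Y => mollify rho eps g Y - mollify rho eps g X)%R <=
  (2 `^ p)%:E * (energy k p (fun X Y => g Y - g X)%R + (W `^ p)%:E * Lpint p g).
Proof.
move=> mu; set u := mollify rho eps g in mu *.
have mE := measurable2_diff mu.
have h2p : (0 <= 2 `^ p :> R)%R by exact: powR_ge0.
have FJ X Y : (`|u Y - u X| `^ p)%:E <= (2 `^ p)%:E * (J1 X Y + J2 X).
  apply: (@le_trans _ _ ((2 `^ p)%:E * ((`|u Y - v X| `^ p)%:E + (`|v X - u X| `^ p)%:E))).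
    rewrite -EFinD -EFinM lee_fin.
    apply: le_trans (powR_add_le (ltW p0) (normr_ge0 _) (normr_ge0 _)).
    apply: ge0_ler_powR; rewrite ?nnegrE ?addr_ge0 ?(ltW p0)//.
    by rewrite (_ : u Y - u X = (u Y - v X) + (v X - u X))%R ?ler_normD//; ring.
  apply: lee_wpmul2l; first by rewrite lee_fin.
  exact: leeD (J1_ge X Y) (J2_ge X).
apply: le_trans (energy_le_split h2p mE mJ1 mJ2 J1_ge0 J2_ge0 FJ) _.
apply: lee_wpmul2l; first by rewrite lee_fin.
by rewrite J1_energy leeD2l// J2_Lpint.
Qed.

End truncation_mollification.

Section derivative_criterion.
Context {R : realType} {V : normedModType R}.

Lemma is_derive_quadratic (f : V -> R) (X v : V) (l C : R) :
  (forall h, `|f (h *: v + X) - f X - h * l| <= C * h ^+ 2) ->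
  is_derive X v f l.
Proof.
move=> H.
have C0 : 0 <= C by have := le_trans (normr_ge0 _) (H 1); rewrite expr1n mulr1.
have cv : h^-1 *: (f (h *: v + X) - f X) @[h --> (0:R)^'] --> l.
  apply/cvgrPdist_le => e e0.
  have d0 : 0 < e / (C + 1) by rewrite divr_gt0// ltr_wpDl.
  apply/nbhs_ballP; exists (e / (C + 1)) => //= h; rewrite /ball/= sub0r normrN => he h0.
  have -> : l - h^-1 *: (f (h *: v + X) - f X) =
      - (h^-1 * (f (h *: v + X) - f X - h * l)).
    by rewrite /GRing.scale/=; field.
  rewrite normrN normrM normfV ler_pdivrMl ?normr_gt0// (le_trans (H h))//.
  rewrite -[h ^+ 2]ger0_norm ?sqr_ge0// normrX expr2 mulrA mulrC ler_wpM2l//.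
  rewrite (@le_trans _ _ (C * (e / (C + 1))))//; first by rewrite ler_wpM2l// ltW.
  by rewrite mulrCA ler_piMr ?(ltW e0)// ler_pdivrMr ?mul1r ?lerDl ?ltr_wpDl.
apply: DeriveDef; first by apply/cvg_ex; exists l.
exact: cvg_lim.
Qed.

End derivative_criterion.

Section bump.
Context {R : realType}.
Implicit Types (P : {poly R}) (x y : R).

Definition expinv P x : R := if 0 < x then P.[x^-1] * expR (- x^-1) else 0.

Lemma poly_le_expR P : exists2 C, 0 <= C & forall y, 0 <= y -> `|P.[y]| <= C * expR (y / 2).
Proof.
exists (\sum_(i < size P) `|P`_i| * (2 ^+ i * i`!%:R)).
  by apply: sumr_ge0 => i _; rewrite !mulr_ge0.
move=> y y0; rewrite horner_coef mulr_suml (le_trans (ler_norm_sum _ _ _))//.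
apply: ler_sum => i _; rewrite normrM -mulrA ler_wpM2l// normrX ger0_norm//.
have -> : y ^+ i = 2 ^+ i * (y / 2) ^+ i by rewrite -exprMn mulrC divfK.
rewrite -mulrA ler_wpM2l// ?exprn_ge0//.
case: (i : nat) => [|n]; first by rewrite expr0 mul1r -[leLHS]expR0 ler_expR divr_ge0.
rewrite [leRHS]mulrC -ler_pdivrMr ?ltr0n ?fact_gt0//.
apply: le_trans (@expR_ge1Dxn R (y / 2) n (divr_ge0 y0 (ler0n _ 2))).
by rewrite lerDr.
Qed.

Lemma expinv_le P : exists2 C, 0 <= C & forall x, `|expinv P x| <= C * x ^+ 2.
Proof.
have [C C0 HC] := poly_le_expR P.
exists (8 * C); first by rewrite mulr_ge0.
move=> x; rewrite /expinv; case: ifPn => [x0|_]; last first.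
  by rewrite normr0 mulr_ge0 ?sqr_ge0// mulr_ge0.
have xi0 : 0 <= x^-1 by rewrite invr_ge0 ltW.
rewrite normrM [`|expR _|]ger0_norm ?expR_ge0//.
apply: (@le_trans _ _ (C * expR (x^-1 / 2) * expR (- x^-1))).
  by rewrite ler_wpM2r ?expR_ge0// HC.
rewrite -mulrA -expRD [8 * C]mulrC -mulrA ler_wpM2l//.
rewrite (_ : _ + _ = - (x^-1 / 2)); last by field; rewrite gt_eqF.
rewrite expRN -[8 * _]invrK lef_pV2 ?posrE ?expR_gt0 ?invr_gt0 ?mulr_gt0 ?exprn_gt0//.
apply: le_trans (@expR_ge1Dxn R (x^-1 / 2) 1 (divr_ge0 xi0 (ler0n _ 2))).
rewrite (_ : (8 * x ^+ 2)^-1 = (x^-1 / 2) ^+ 2 / 2`!%:R).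
  by rewrite lerDr.
by rewrite !factS fact0; field; rewrite gt_eqF.
Qed.

Definition dexpinv P := 'X^2 * (P - P^`()).

Lemma is_derive_expinv P x : is_derive x 1 (expinv P) (expinv (dexpinv P) x).
Proof.
have [x0|x0|->] := ltgtP x 0.
- have -> : expinv (dexpinv P) x = 0 by rewrite /expinv ltNge (ltW x0).
  apply: (@near_eq_is_derive _ _ _ (cst 0)).
  near=> y; rewrite /expinv/= ifF//; apply/negbTE; rewrite -leNgt ltW//.
  by near: y; exact: lt_nbhsl.
- apply: (@near_eq_is_derive _ _ _ (fun y => P.[y^-1] * expR (- y^-1))).
    near=> y; rewrite /expinv ifT//; near: y; exact: lt_nbhsr.
  have xn0 : x != 0 by rewrite gt_eqF.
  have dV : is_derive x 1 (fun y : R => y^-1) (- x ^- 2 *: 1).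
    by apply: is_deriveV.
  have dP : is_derive x 1 (fun y : R => P.[y^-1]) (P^`().[x^-1] * (- x ^- 2 *: 1)).
    exact: (@is_derive1_comp R (horner P) (fun y : R => y^-1)).
  have dN : is_derive x 1 (fun y : R => - y^-1) (- (- x ^- 2 *: 1)).
    exact: is_deriveN.
  have dE : is_derive x 1 (fun y : R => expR (- y^-1)) (expR (- x^-1) * (- (- x ^- 2 *: 1))).
    exact: (@is_derive1_comp R expR (fun y : R => - y^-1)).
  apply: is_derive_eq (is_deriveM dP dE) _.
  rewrite /expinv x0 /dexpinv /GRing.scale/= hornerM hornerXn hornerD hornerN.
  by field.
- rewrite {2}/expinv ltxx.
  have [C C0 HC] := expinv_le P.
  apply: (@is_derive_quadratic _ _ _ _ _ _ C) => h.
  by rewrite {2}/expinv ltxx mulr0 !subr0 addr0 /GRing.scale/= mulr1.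
Unshelve. all: by end_near. Qed.

Lemma expinvN P x : expinv (- P) x = - expinv P x.
Proof. by rewrite /expinv; case: ifP; rewrite ?oppr0// hornerN mulNr. Qed.

Inductive bump_class : (R -> R) -> Prop :=
| bump_base P Q : bump_class (fun x => expinv P x * expinv Q (1 - x))
| bump_add f g : bump_class f -> bump_class g -> bump_class (fun x => f x + g x).

Lemma bump_class_derive f : bump_class f ->
  exists2 f', bump_class f' & forall x, is_derive x 1 f (f' x).
Proof.
elim=> [P Q|f1 f2 _ [f1' c1 d1] _ [f2' c2 d2]]; last first.
  exists (fun x => f1' x + f2' x); first exact: bump_add.
  by move=> x; exact: is_deriveD.
exists (fun x => expinv (dexpinv P) x * expinv Q (1 - x) +
                 expinv P x * expinv (- dexpinv Q) (1 - x)).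
  by apply: bump_add; exact: bump_base.
move=> x.
have d1 := is_derive_expinv P x.
have d2 : is_derive x 1 (fun y : R => expinv Q (1 - y)) (expinv (dexpinv Q) (1 - x) * (0 - 1)).
  have d0 : is_derive x 1 (fun y : R => 1 - y) (0 - 1) by apply: is_deriveB.
  have dQ := is_derive_expinv Q (1 - x).
  exact: (@is_derive1_comp R (expinv Q) (fun y : R => 1 - y)).
apply: is_derive_eq (is_deriveM d1 d2) _.
by rewrite expinvN /GRing.scale/=; ring.
Qed.

Lemma bump_class_support f x : bump_class f -> ~~ (0 < x < 1) -> f x = 0.
Proof.
elim=> [P Q|f1 f2 _ h1 _ h2] hx; last by rewrite h1// h2// addr0.
rewrite /expinv subr_gt0; case: ifPn; case: ifPn; rewrite ?mul0r ?mulr0//.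
by move=> x1 x0; rewrite x0 x1 in hx.
Qed.

Lemma bump_class_bounded f : bump_class f -> exists2 M, 1 <= M & forall x, `|f x| <= M.
Proof.
move=> cf; suff : exists M, forall x, 0 < x < 1 -> `|f x| <= M.
  move=> [M HM]; exists (Num.max 1 M); first by rewrite le_max lexx.
  move=> x; rewrite le_max; apply/orP.
  have [/HM|/(bump_class_support cf) ->] := boolP (0 < x < 1); first by right.
  by left; rewrite normr0.
elim: cf => [P Q|f1 f2 _ [M1 h1] _ [M2 h2]]; last first.
  exists (M1 + M2) => x hx; rewrite (le_trans (ler_normD _ _))// lerD//; [exact: h1|exact: h2].
have [C C0 HC] := expinv_le P; have [D D0 HD] := expinv_le Q.
exists (C * D) => x /andP[x0 x1].
have sq y : 0 < y < 1 -> y ^+ 2 <= 1.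
  by move=> /andP[y0 y1]; rewrite exprn_ile1// ltW.
rewrite normrM ler_pM//; [rewrite (le_trans (HC x))//|rewrite (le_trans (HD _))//];
  rewrite ler_piMr// sq ?x0//; apply/andP; split; lra.
Qed.

Lemma bump_class_lipschitz f : bump_class f ->
  exists2 M, 0 <= M & forall x y, `|f y - f x| <= M * `|y - x|.
Proof.
move=> cf; have [f' cf' df] := bump_class_derive cf.
have [M M1 HM] := bump_class_bounded cf'; exists M; first exact: le_trans ler01 M1.
move=> x y; wlog xy : x y / x <= y.
  move=> H; have [/H//|/ltW/H] := leP x y.
  by rewrite distrC [`|x - y|]distrC.
have cnt : {within `[x, y], continuous f}.
  apply: derivable_within_continuous => z _.
  by have [] := df z.
have [c _ ->] := MVT_segment xy (fun z _ => df z) cnt.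
by rewrite normrM ler_wpM2r.
Qed.

Lemma bump_class_taylor f : bump_class f -> exists f' M, [/\ bump_class f', 0 <= M &
  forall x h, `|f (x + h) - f x - h * f' x| <= M * h ^+ 2].
Proof.
move=> cf; have [f' cf' df] := bump_class_derive cf.
have [M M0 HM] := bump_class_lipschitz cf'; exists f', M; split => // x h.
have cnt a b : {within `[a, b], continuous f}.
  apply: derivable_within_continuous => z _.
  by have [] := df z.
have key : exists2 c, `|c - x| <= `|h| & f (x + h) - f x = h * f' c.
  have [h0|h0] := leP 0 h.
    have xh : x <= x + h by rewrite lerDl.
    have [c + e] := MVT_segment xh (fun z _ => df z) (cnt _ _).
    rewrite in_itv/= => /andP[c1 c2]; exists c.
      by rewrite !ger0_norm ?subr_ge0// lerBlDl.
    by rewrite e addrAC subrr add0r mulrC.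
  have xh : x + h <= x by rewrite gerDl ltW.
  have [c + e] := MVT_segment xh (fun z _ => df z) (cnt _ _).
  rewrite in_itv/= => /andP[c1 c2]; exists c.
    by rewrite (ltr0_norm h0) ler0_norm ?subr_le0// lerN2; lra.
  by rewrite -opprB e opprD addNKr mulrN opprK mulrC.
have [c cx ->] := key; rewrite -mulrBr normrM.
rewrite -[h ^+ 2]ger0_norm ?sqr_ge0// normrX expr2 mulrCA ler_wpM2l//.
by rewrite (le_trans (HM _ _))// ler_wpM2l.
Qed.

Definition bump x : R := expinv 1 x * expinv 1 (1 - x).

Lemma bump_classP : bump_class bump. Proof. exact: bump_base. Qed.

Lemma bump_ge0 x : 0 <= bump x.
Proof.
by rewrite mulr_ge0// /expinv; case: ifP => // _; rewrite hornerC mul1r expR_ge0.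
Qed.

Lemma bump_gt0 : exists2 d, 0 < d & forall x, 1 / 4 < x < 3 / 4 -> d <= bump x.
Proof.
exists (expR (- 4) * expR (- 4)); first by rewrite mulr_gt0 ?expR_gt0.
move=> x /andP[x1 x2].
have h y : 1 / 4 < y -> expR (- 4) <= expinv 1 y.
  move=> y1; have y0 : 0 < y by apply: lt_trans y1; rewrite divr_gt0.
  rewrite /expinv y0 hornerC mul1r ler_expR lerN2 -[leRHS]invrK lef_pV2 ?posrE ?invr_gt0//.
  by rewrite ltW// -div1r.
by rewrite /bump ler_pM ?expR_ge0// h//; lra.
Qed.

End bump.

Section product_functions.
Context {R : realType} {N : nat}.
Local Notation cV := 'cV[R]_N.
Local Notation L := (lebesgue_cV R N).

Lemma prod_diff_le (I : Type) (r : seq I) (a b M : I -> R) :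
  (forall i, 1 <= M i) -> (forall i, `|a i| <= M i) -> (forall i, `|b i| <= M i) ->
  `|\prod_(i <- r) a i - \prod_(i <- r) b i| <=
  (\sum_(i <- r) `|a i - b i|) * \prod_(i <- r) M i.
Proof.
move=> M1 aM bM; elim: r => [|i r IH].
  by rewrite !big_nil subrr normr0 mul0r.
rewrite !big_cons; set A := \prod_(j <- r) a j; set B := \prod_(j <- r) b j.
set S := \sum_(j <- r) _; set P := \prod_(j <- r) M j.
have AP : `|A| <= P.
  by rewrite normr_prod; apply: ler_prod => j _; rewrite normr_ge0 aM.
have P0 : 0 <= P := le_trans (normr_ge0 _) AP.
have Mi0 : 0 <= M i := le_trans ler01 (M1 i).
rewrite (_ : _ - _ = (a i - b i) * A + b i * (A - B)); last by ring.
rewrite (le_trans (ler_normD _ _))// !normrM mulrDl lerD//.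
  rewrite ler_wpM2l// (le_trans AP)// ler_peMl//.
by rewrite mulrCA ler_pM.
Qed.

Lemma lipschitz_continuous (V : normedModType R) (f : V -> R) (K : R) :
  (forall x y, `|f y - f x| <= K * `|y - x|) -> continuous f.
Proof.
move=> H x; apply/cvgrPdist_le => e e0.
have K0 : 0 < `|K| + 1 by rewrite ltr_wpDl.
apply/nbhs_ballP; exists (e / (`|K| + 1)) => /=; first by rewrite divr_gt0.
move=> y; rewrite -ball_normE/= => xy; rewrite (le_trans (H _ _))//.
apply: (@le_trans _ _ ((`|K| + 1) * `|x - y|)).
  by rewrite ler_wpM2r// (le_trans (ler_norm _))// lerDl.
by rewrite mulrC -ler_pdivlMr// ltW.
Qed.

Definition prodf (phi : 'I_N -> R -> R) (h : cV) : R := \prod_i phi i (h i ord0).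

Variable phi : 'I_N -> R -> R.
Hypothesis cphi : forall i, bump_class (phi i).

Lemma prodf_bounds : exists M : 'I_N -> R,
  (forall i, 1 <= M i) /\ (forall i x, `|phi i x| <= M i).
Proof.
have /choice[M HM] : forall i, exists M, 1 <= M /\ forall x, `|phi i x| <= M.
  by move=> i; have [M M1 HM] := bump_class_bounded (cphi i); exists M.
by exists M; split => i; have [] := HM i.
Qed.

Lemma prodf_bounded : exists2 M, 0 <= M & forall h, `|prodf phi h| <= M.
Proof.
have [M [M1 HM]] := prodf_bounds; exists (\prod_i M i).
  by apply: prodr_ge0 => i _; rewrite (le_trans ler01).
by move=> h; rewrite normr_prod; apply: ler_prod => i _; rewrite normr_ge0 HM.
Qed.

Lemma prodf_lipschitz : exists2 K, 0 <= K &
  forall h h', `|prodf phi h' - prodf phi h| <= K * `|h' - h|.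
Proof.
have [M [M1 HM]] := prodf_bounds.
have /choice[K HK] : forall i, exists K, 0 <= K /\
    forall x y, `|phi i y - phi i x| <= K * `|y - x|.
  by move=> i; have [K K0 HK] := bump_class_lipschitz (cphi i); exists K.
have PM0 : 0 <= \prod_i M i by apply: prodr_ge0 => i _; rewrite (le_trans ler01).
exists ((\sum_i K i) * \prod_i M i).
  by rewrite mulr_ge0// sumr_ge0// => i _; have [] := HK i.
move=> h h'; rewrite (le_trans (@prod_diff_le _ _ _ _ M _ _ _))//.
rewrite mulrAC ler_wpM2r// mulr_suml; apply: ler_sum => i _.
have [K0 /(_ (h i ord0) (h' i ord0)) /le_trans] := HK i; apply.
by rewrite ler_wpM2l//; have := mx_entry_le (h' - h) i ord0; rewrite !mxE.
Qed.

Lemma measurable_prodf : measurable_fun setT (prodf phi).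
Proof.
have [K _ HK] := prodf_lipschitz.
apply: continuous_measurable_matrix; exact: (lipschitz_continuous HK).
Qed.

Lemma prodf_support h : prodf phi h != 0 -> forall i, 0 < h i ord0 < 1.
Proof.
move=> + i; apply: contraNT => hi; rewrite /prodf (bigD1 i)//=.
by rewrite (bump_class_support (cphi i) hi) mul0r.
Qed.

Lemma prodf_taylor (i : 'I_N) : exists psi M, [/\ forall j, bump_class (psi j), 0 <= M &
  forall h s, `|prodf phi (h + s *: delta_mx i ord0) - prodf phi h - s * prodf psi h|
    <= M * s ^+ 2].
Proof.
have [f' [Mi [cf' Mi0 HMi]]] := bump_class_taylor (cphi i).
have [M [M1 HM]] := prodf_bounds.
have PM0 : 0 <= \prod_(j | j != i) M j by apply: prodr_ge0 => j _; rewrite (le_trans ler01).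
exists (fun j => if j == i then f' else phi j), (Mi * \prod_(j | j != i) M j); split.
- by move=> j; case: eqP.
- exact: mulr_ge0.
move=> h s; rewrite /prodf !(bigD1 (P := xpredT) i)//= eqxx.
have e1 : \prod_(j | j != i) phi j ((h + s *: delta_mx i ord0 : cV) j ord0) =
    \prod_(j | j != i) phi j (h j ord0).
  by apply: eq_bigr => j ji; rewrite !mxE (negbTE ji)/= mulr0 addr0.
have e2 : \prod_(j | j != i) (if j == i then f' else phi j) (h j ord0) =
    \prod_(j | j != i) phi j (h j ord0).
  by apply: eq_bigr => j ji; rewrite (negbTE ji).
rewrite e1 e2 !mxE !eqxx mulr1; set P := \prod_(j | _) _.
rewrite (_ : _ - _ = (phi i (h i ord0 + s) - phi i (h i ord0) - s * f' (h i ord0)) * P); last by ring.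
rewrite normrM mulrAC ler_pM// /P normr_prod; apply: ler_prod => j _.
by rewrite normr_ge0 HM.
Qed.

End product_functions.

Section smooth_convolution.
Context {R : realType} {N : nat}.
Local Notation cV := 'cV[R]_N.
Local Notation L := (lebesgue_cV R N).
Variables (g : cV -> R) (eps : R).
Hypothesis ig : L.-integrable setT (EFin \o g).
Hypothesis eps0 : 0 < eps.

Definition bump_conv (phi : 'I_N -> R -> R) (X : cV) : R :=
  (\int[L]_Z (prodf phi (eps^-1 *: (Z - X)) * g Z))%R.

Let measurable_scaled (phi : 'I_N -> R -> R) (X : cV) : (forall i, bump_class (phi i)) ->
  measurable_fun setT (fun Z : cV => prodf phi (eps^-1 *: (Z - X))).
Proof.
move=> cphi; apply: (measurableT_comp (measurable_prodf cphi)).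
by apply: measurable_scalemx => //; exact: measurable_addmx.
Qed.

Lemma integrable_bump_conv phi X : (forall i, bump_class (phi i)) ->
  L.-integrable setT (EFin \o (fun Z : cV => prodf phi (eps^-1 *: (Z - X)) * g Z)).
Proof.
move=> cphi; have [M _ HM] := prodf_bounded cphi.
apply: (@integrable_bounded_mul _ _ (fun Z : cV => prodf phi (eps^-1 *: (Z - X))) g M) => //.
exact: measurable_scaled.
Qed.

Let norm1 : R := (\int[L]_Z `|g Z|)%R.

Let Rint_le (q : cV -> R) (c : R) : measurable_fun setT q -> (forall Z, `|q Z| <= c) ->
  `|\int[L]_Z (q Z * g Z)| <= c * norm1.
Proof.
move=> mq qc.
have ci : L.-integrable setT (EFin \o (fun Z => `|g Z|)).
  exact: integrable_norm ig.
rewrite -lee_fin; apply: le_trans (abs_Rintegral_le _) _.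
  exact: (integrable_bounded_mul mq qc ig).
have c0 : 0 <= c by exact: le_trans (normr_ge0 _) (qc 0).
rewrite EFinM /norm1 /Rintegral fineK; last exact: integrable_fin_num.
have mg : measurable_fun setT g by apply/measurable_EFinP; exact: measurable_int ig.
rewrite ge0_integralZl_fin//; last exact: measurableT_comp.
apply: ge0_le_integral_fin => //.
- by apply: measurableT_comp => //; exact: measurable_funM.
- by apply: measurable_funM => //; exact: measurableT_comp.
- by move=> Z; rewrite normrM ler_wpM2r.
Qed.

Lemma bump_conv_continuous (c : R) phi : (forall i, bump_class (phi i)) ->
  continuous (fun X => c * bump_conv phi X).
Proof.
move=> cphi; have [K K0 HK] := prodf_lipschitz cphi.
apply: (@lipschitz_continuous _ _ _ (`|c| * (K * eps^-1 * norm1))) => X Y.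
rewrite -mulrBr normrM -[leRHS]mulrA ler_wpM2l// /bump_conv -RintegralB//; try exact: integrable_bump_conv.
under eq_Rintegral do rewrite -mulrBl.
rewrite mulrAC; apply: Rint_le.
  by apply: measurable_funB; exact: measurable_scaled.
move=> Z; rewrite (le_trans (HK _ _))// -mulrA ler_wpM2l//.
rewrite -scalerBr normrZ ger0_norm ?invr_ge0 ?(ltW eps0)// ler_wpM2l ?invr_ge0 ?(ltW eps0)//.
by rewrite opprB addrC addrA subrK distrC.
Qed.

Lemma bump_conv_derive phi i : (forall i, bump_class (phi i)) ->
  exists2 psi, forall i, bump_class (psi i) &
  forall X, is_derive X (delta_mx i ord0 : cV) (bump_conv phi) (- eps^-1 * bump_conv psi X).
Proof.
move=> cphi; have [psi [M [cpsi M0 HM]]] := prodf_taylor cphi i.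
exists psi => // X.
apply: (@is_derive_quadratic _ _ _ _ _ _ (M * eps^-1 ^+ 2 * norm1)) => h.
have i1 := integrable_bump_conv (h *: delta_mx i ord0 + X) cphi.
have i2 := integrable_bump_conv X cphi.
have i3 := integrable_bump_conv X cpsi.
rewrite /bump_conv mulrA -RintegralZl// -!RintegralB//; last 2 first.
- by have := integrableB measurableT i1 i2.
- by have := integrableZl measurableT (h * - eps^-1) i3.
have -> : \int[L]_Z (prodf phi (eps^-1 *: (Z - (h *: delta_mx i ord0 + X))) * g Z -
     prodf phi (eps^-1 *: (Z - X)) * g Z - h * - eps^-1 * (prodf psi (eps^-1 *: (Z - X)) * g Z)) =
  \int[L]_Z ((prodf phi (eps^-1 *: (Z - X) + (- (h * eps^-1)) *: delta_mx i ord0) -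
     prodf phi (eps^-1 *: (Z - X)) - (- (h * eps^-1)) * prodf psi (eps^-1 *: (Z - X))) * g Z).
  apply: eq_Rintegral => Z _.
  have -> : eps^-1 *: (Z - (h *: delta_mx i ord0 + X)) =
      eps^-1 *: (Z - X) + (- (h * eps^-1)) *: delta_mx i ord0.
    rewrite scaleNr [h * _]mulrC -scalerA -scalerBr; congr (_ *: _).
    by rewrite opprD addrA addrAC.
  by ring.
rewrite mulrAC; apply: Rint_le.
  apply: measurable_funB; last by apply: measurable_funM => //; exact: measurable_scaled.
  apply: measurable_funB; last exact: measurable_scaled.
  apply: (measurableT_comp (measurable_prodf cphi)).
  apply: measurable_addmx => //; apply: measurable_scalemx => //.
  exact: measurable_addmx.
move=> Z; apply: le_trans (HM _ _) _.
by rewrite sqrrN exprMn [h ^+ 2 * _]mulrC mulrA.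
Qed.

Lemma smooth_bump_conv (c : R) phi : (forall i, bump_class (phi i)) ->
  smooth (fun X => c * bump_conv phi X).
Proof.
move=> cphi.
have main (l : seq 'I_N) : exists c' psi, (forall i, bump_class (psi i)) /\
    iter_partial l (fun X => c * bump_conv phi X) = fun X => c' * bump_conv psi X.
  elim: l => [|i l [c' [psi [cpsi /= ->]]]]; first by exists c, phi.
  have [psi' cpsi' d] := bump_conv_derive i cpsi.
  exists (c' * - eps^-1), psi'; split => //; apply/funext => X.
  have dX : is_derive X (delta_mx i ord0 : cV) (c' \*: bump_conv psi) (c' *: (- eps^-1 * bump_conv psi' X)).
    exact: is_deriveZ.
  have [_ e] := dX.
  by rewrite -mulrA -[RHS]e.
move=> l; have [c' [psi [cpsi ->]]] := main l; split.
  exact: bump_conv_continuous.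
move=> i X; have [psi' cpsi' d] := bump_conv_derive i cpsi.
have dX : is_derive X (delta_mx i ord0 : cV) (c' \*: bump_conv psi) (c' *: (- eps^-1 * bump_conv psi' X)).
  exact: is_deriveZ.
by have [] := dX.
Qed.

End smooth_convolution.

Section mollifier.
Context {R : realType} {N : nat}.
Local Notation cV := 'cV[R]_N.
Local Notation L := (lebesgue_cV R N).

Lemma posdef_scalar (a : R) : 0 < a -> posdef (a%:M : 'M[R]_N).
Proof. by move=> a0 X X0; rewrite mul_scalar_mx dotcvZl mulr_gt0// dotcv_gt0. Qed.

Lemma mollify_bump_conv (c eps : R) (phi : 'I_N -> R -> R) (g : cV -> R) (X : cV) :
  0 < eps -> (forall i, bump_class (phi i)) -> L.-integrable setT (EFin \o g) ->
  mollify (fun h => c * prodf phi h) eps g X = (c * eps ^- N) * bump_conv g eps phi X.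
Proof.
move=> eps0 cphi ig.
have iq := integrable_bump_conv eps ig X cphi.
have := Rintegral_affine_cV X (posdef_scalar eps0) iq; rewrite det_scalar.
have qE h : prodf phi (eps^-1 *: (eps%:M *m h + X - X)) * g (eps%:M *m h + X) =
    prodf phi h * g (X + eps *: h).
  by rewrite addrK mul_scalar_mx scalerA mulVf ?gt_eqF// scale1r addrC.
have := integrable_affine_cV X (posdef_scalar eps0) iq.
under eq_fun do rewrite qE.
move=> iq'; under eq_Rintegral do rewrite qE.
move=> e; rewrite /bump_conv -e mulrA mulfVK; last by rewrite expf_neq0// gt_eqF.
rewrite -RintegralZl//; apply: eq_Rintegral => h _.
by rewrite mulrA.
Qed.

Lemma norm_cV_le (X : cV) (r : R) : 0 <= r -> (`|X| <= r) <-> forall i, `|X i ord0| <= r.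
Proof.
move=> r0; split=> [/mx_norm_le H i|H]; first exact: H.
by apply/mx_norm_le => // i j; rewrite (ord1 j).
Qed.

Definition cube (r : R) : set cV := [set X | forall i, X i ord0 \in `[- r, r]].

Lemma cubeE (r : R) : 0 <= r -> cube r = [set X | `|X| <= r].
Proof.
move=> r0; apply/seteqP; split => X /=.
  by move=> H; apply/norm_cV_le => // i; have := H i; rewrite in_itv/= -ler_norml.
by move=> /norm_cV_le H i; rewrite in_itv/= -ler_norml H.
Qed.

Lemma measurable_box (A : 'I_N -> set R) : (forall i, measurable (A i)) ->
  measurable [set v : cV | forall i, A i (v i ord0)].
Proof.
move=> mA; pose D (i : 'I_N) := (fun v : cV => v i ord0) @^-1` A i.
rewrite [X in measurable X](_ : _ = \bigcap_(i in [set: 'I_N]) D i).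
  apply: fin_bigcap_measurable => // i _.
  by rewrite -[X in measurable X]setTI; exact: measurable_coord.
by apply/seteqP; split=> [v vA i _|v vA i]; [exact: vA|exact: (vA i)].
Qed.

Lemma measurable_cube r : measurable (cube r).
Proof. by apply: (@measurable_box (fun=> `[- r, r]%classic)) => i. Qed.

Lemma lebesgue_itv_box (a b : R) : a <= b ->
  L [set v | forall i, v i ord0 \in `[a, b]] = ((b - a) ^+ N)%:E.
Proof.
move=> ab; rewrite (lebesgue_cV_box (A := fun=> `[a, b]%classic))//.
rewrite (eq_bigr (fun=> (b - a)%:E)) => [|i _].
  by rewrite prodEFin prodr_const card_ord.
rewrite lebesgue_measure_itv/= lte_fin; case: ltgtP ab => // -> _.
by rewrite subrr.
Qed.

Lemma lebesgue_cube r : 0 <= r -> L (cube r) = ((2 * r) ^+ N)%:E.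
Proof.
by move=> r0; rewrite /cube lebesgue_itv_box ?ge0_cp// opprK -mulr2n mulr_natl.
Qed.

Lemma integral_le_cube (f : cV -> R) (c r : R) : 0 <= r -> measurable_fun setT f ->
  (forall X, 0 <= f X <= c) -> (forall X, f X != 0 -> `|X| <= r) ->
  (\int[L]_X (f X)%:E <= (c * (2 * r) ^+ N)%:E)%E.
Proof.
move=> r0 mf fc fr.
have c0 : 0 <= c by have /andP[a b] := fc 0; exact: le_trans a b.
apply: (@le_trans _ _ (\int[L]_X (c * \1_(cube r) X)%:E)%E).
  apply: ge0_le_integral_fin => //.
  - by apply: measurable_funM => //; apply: measurable_indic; exact: measurable_cube.
  - by move=> X; have /andP[] := fc X.
  - move=> X; rewrite indicE; have [/eqP ->|f0] := boolP (f X == 0).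
      by rewrite mulr_ge0.
    by rewrite mem_set ?mulr1 ?cubeE//=; [have /andP[] := fc X|exact: fr].
have m1 : measurable_fun setT (\1_(cube r) : cV -> R).
  by apply: measurable_indic; exact: measurable_cube.
rewrite -(ge0_integralZl_fin L m1)//.
rewrite integral_indic//; last exact: measurable_cube.
by rewrite setIT [X in (_ * X)%E](lebesgue_cube r0) -EFinM.
Qed.

Record mollifier_spec (rho : cV -> R) (phi : 'I_N -> R -> R) (c : R) := {
  mol_class : forall i, bump_class (phi i);
  mol_def : rho = fun h => c * prodf phi h;
  mol_meas : measurable_fun setT rho;
  mol_ge0 : forall h, 0 <= rho h;
  mol_bnd : exists M, forall h, rho h <= M;
  mol_int : (\int[L]_h (rho h)%:E = 1)%E;
  mol_lip : exists2 K, 0 <= K & forall h h', `|rho h' - rho h| <= K * `|h' - h|;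
  mol_supp : forall h, rho h != 0 -> `|h| <= 1 }.

Lemma mollifier_exists : exists rho phi c, mollifier_spec rho phi c.
Proof.
pose phi (i : 'I_N) : R -> R := @bump R.
have cphi i : bump_class (phi i) by exact: bump_classP.
have [M M0 HM] := prodf_bounded cphi.
have f0 h : 0 <= prodf phi h by apply: prodr_ge0 => i _; exact: bump_ge0.
have mf := measurable_prodf cphi.
have supp h : prodf phi h != 0 -> `|h| <= 1.
  move=> /(prodf_support cphi) H; apply/norm_cV_le => // i.
  by have /andP[h0 h1] := H i; rewrite ger0_norm ltW.
pose I := (\int[L]_h (prodf phi h)%:E)%E.
have Ifin : (I < +oo)%E.
  apply: (le_lt_trans (@integral_le_cube _ M 1 ler01 mf _ supp)); last by rewrite ltry.
  by move=> h; rewrite f0/= -[leLHS]ger0_norm.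
have I0 : (0 < I)%E.
  have [d d0 Hd] := @bump_gt0 R.
  pose A := [set v : cV | forall i, v i ord0 \in `](1 / 4 : R), (3 / 4)[].
  pose A' := [set v : cV | forall i, v i ord0 \in `[(3 / 8 : R), (5 / 8)]].
  have mA' : measurable A' by apply: (@measurable_box (fun=> `[(3 / 8 : R), (5 / 8)]%classic)).
  apply: (@lt_le_trans _ _ (\int[L]_h (d ^+ N * \1_A' h)%:E)%E).
    have m1 : measurable_fun setT (\1_A' : cV -> R) by exact: measurable_indic.
    rewrite -(ge0_integralZl_fin L m1) ?exprn_ge0 ?(ltW d0)//.
    rewrite integral_indic// setIT [X in (_ * X)%E]lebesgue_itv_box; last by lra.
    by rewrite -EFinM lte_fin mulr_gt0 ?exprn_gt0//; lra.
  apply: ge0_le_integral_fin => //.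
  - by apply: measurable_funM => //; exact: measurable_indic.
  - by move=> h; rewrite mulr_ge0 ?exprn_ge0 ?(ltW d0).
  - move=> h; rewrite indicE; have [hA|hA] := boolP (h \in A'); last by rewrite mulr0.
    rewrite mulr1 -[in leLHS](card_ord N) -prodr_const; apply: ler_prod => i _.
    rewrite (ltW d0)/=; apply: Hd.
    by move: hA; rewrite inE => /(_ i); rewrite in_itv/= => /andP[h1 h2]; apply/andP; split; lra.
have Ifn : I \is a fin_num by rewrite ge0_fin_numE// ltW.
pose c := (fine I)^-1.
have c0 : 0 < c by rewrite invr_gt0 fine_gt0// I0.
exists (fun h => c * prodf phi h), phi, c; split => //.
- exact: measurable_funM.
- by move=> h; rewrite mulr_ge0 ?(ltW c0).
- exists (c * M) => h; rewrite ler_wpM2l ?(ltW c0)//.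
  by rewrite -[leLHS]ger0_norm.
- rewrite -ge0_integralZl_fin ?(ltW c0)// -/I -(fineK Ifn) -EFinM mulVf//.
  by rewrite gt_eqF// fine_gt0// I0.
- have [K K0 HK] := prodf_lipschitz cphi; exists (c * K); first by rewrite mulr_ge0 ?(ltW c0).
  by move=> h h'; rewrite -mulrBr normrM gtr0_norm// -mulrA ler_wpM2l ?(ltW c0).
- by move=> h; rewrite mulf_eq0 negb_or => /andP[_]; exact: supp.
Qed.

End mollifier.

Section near_identity.
Context {R : realType} {N : nat}.
Local Notation cV := 'cV[R]_N.
Local Notation L := (lebesgue_cV R N).

Lemma norm_mulmx_le (A : 'M[R]_N) (c : R) (X : cV) : 0 <= c -> (forall i j, `|A i j| <= c) ->
  `|A *m X| <= N%:R * c * `|X|.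
Proof.
move=> c0 Ac; apply/norm_cV_le; first by rewrite !mulr_ge0.
move=> i; rewrite mxE (le_trans (ler_norm_sum _ _ _))//.
apply: (@le_trans _ _ (\sum_(j < N) c * `|X|)).
  by apply: ler_sum => j _; rewrite normrM ler_pM// mx_entry_le.
by rewrite sumr_const card_ord -[leLHS]mulr_natl mulrA.
Qed.

Lemma det_near1 (C0 : R) : 0 <= C0 -> exists2 C, 0 <= C & forall (E : 'M[R]_N) t,
  0 <= t <= 1 -> (forall i j, `|(E - 1%:M) i j| <= C0 * t) -> `|\det E - 1| <= C * t.
Proof.
move=> C00.
exists (\sum_(s : 'S_N) (\sum_(i < N) C0) * \prod_(i < N) (1 + C0)).
  apply: sumr_ge0 => s _; rewrite mulr_ge0 ?sumr_ge0//.
  by apply: prodr_ge0 => i _; rewrite addr_ge0.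
move=> E t /andP[t0 t1] HE.
have h1 i j : `|(1%:M : 'M[R]_N) i j| <= 1 + C0.
  by rewrite mxE; case: (i == j); rewrite ?normr1 ?normr0 ?addr_ge0// lerDl.
have hE i j : `|E i j| <= 1 + C0.
  have -> : E i j = (1%:M : 'M[R]_N) i j + (E - 1%:M) i j by rewrite !mxE addrCA subrr addr0.
  rewrite (le_trans (ler_normD _ _))// lerD//.
    by rewrite mxE; case: (i == j); rewrite ?normr1 ?normr0.
  by rewrite (le_trans (HE i j))// ler_piMr.
have -> : \det E - 1 = \det E - \det (1%:M : 'M[R]_N) by rewrite det1.
rewrite /determinant -sumrB mulr_suml (le_trans (ler_norm_sum _ _ _))//.
apply: ler_sum => s _; rewrite -mulrBr normrM normrX normrN1 expr1n mul1r.
rewrite (le_trans (@prod_diff_le _ _ _ _ _ (fun=> 1 + C0) _ _ _))//; first by move=> i; rewrite lerDl.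
rewrite [leRHS]mulrAC ler_wpM2r//; first by apply: prodr_ge0 => i _; rewrite addr_ge0.
rewrite mulr_suml; apply: ler_sum => i _.
by have := HE i (s i); rewrite !mxE.
Qed.

(* Both rho and rho \o E vanish outside the cube of radius 2 when E is close
   to the identity. *)
Lemma mollifier_weight (rho : cV -> R) phi c (C0 : R) : mollifier_spec rho phi c -> 0 <= C0 ->
  exists d C, [/\ 0 < d <= 1, 0 <= C & forall (E : 'M[R]_N) t,
  0 < t <= d -> (forall i j, `|(E - 1%:M) i j| <= C0 * t) ->
  [/\ posdef E, forall X : cV, `|X| <= 2 * `|E *m X|, forall X : cV, `|E *m X - X| <= N%:R * C0 * t * `|X| &
  (\int[L]_h (`|\det E * rho (E *m h) - rho h|)%:E <= (C * t)%:E)%E]].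
Proof.
case=> _ _ mrho rho0 [M HM] _ [K K0 HK] supp C00.
have [D D0 HD] := det_near1 C00.
have M0 : 0 <= M := le_trans (rho0 0) (HM 0).
pose NC := N%:R * C0; have NC0 : 0 <= NC by rewrite mulr_ge0.
pose d := (2 * NC + 1)^-1.
have d0 : 0 < d by rewrite invr_gt0 ltr_wpDl// mulr_ge0.
have d1 : d <= 1 by rewrite invf_le1 ?lerDr ?mulr_ge0// ltr_wpDl// mulr_ge0.
pose C1 := D * M + K * (NC * 2).
have C10 : 0 <= C1 by rewrite addr_ge0 ?mulr_ge0.
exists d, (C1 * (2 * 2) ^+ N); split; first by rewrite d0.
  by rewrite mulr_ge0// exprn_ge0.
move=> E t /andP[t0 td] HE.
have t1 : t <= 1 := le_trans td d1.
have NCt : NC * t <= 1 / 2.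
  apply: (@le_trans _ _ (NC * d)); first by rewrite ler_wpM2l.
  by rewrite /d ler_pdivrMr ?ltr_wpDl ?mulr_ge0//; lra.
have C0t : 0 <= C0 * t by rewrite mulr_ge0// ltW.
have Ediff (X : cV) : `|E *m X - X| <= NC * t * `|X|.
  have -> : E *m X - X = (E - 1%:M) *m X by rewrite mulmxBl mul1mx.
  by rewrite /NC -(mulrA N%:R); exact: norm_mulmx_le.
have E2 (X : cV) : `|X| <= 2 * `|E *m X|.
  have h1 : `|X| <= `|E *m X| + `|E *m X - X|.
    by rewrite -{1}[X](subKr (E *m X)) (le_trans (ler_normB _ _)).
  have h2 : `|E *m X - X| <= 1 / 2 * `|X|.
    by rewrite (le_trans (Ediff X))// ler_wpM2r.
  lra.
have supp0' (h : cV) : 1 < `|h| -> rho h = 0.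
  by move=> h1; apply/eqP; apply: contraTT h1 => /supp; rewrite -leNgt.
have supp0 (h : cV) : 2 < `|h| -> rho h = 0.
  by move=> h2; apply: supp0'; apply: lt_trans h2; rewrite ltr1n.
have supp0E (h : cV) : 2 < `|h| -> rho (E *m h) = 0.
  by move=> h2; apply: supp0'; have := E2 h; move: h2; lra.
split => //.
  move=> X X0; have -> : E *m X = X + (E - 1%:M) *m X by rewrite mulmxBl mul1mx addrC subrK.
  have XX := dotcv_gt0 X0; rewrite dotcvDl.
  have := dotcv_entry_le X HE; rewrite ler_norml => /andP[h _].
  have h2 : C0 * t * N%:R * dotcv X X <= 1 / 2 * dotcv X X.
    by rewrite ler_wpM2r ?(ltW XX)// (le_trans _ NCt)// /NC mulrC mulrA.
  by move: h h2 XX; lra.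
have -> : C1 * (2 * 2) ^+ N * t = C1 * t * (2 * 2) ^+ N by ring.
apply: integral_le_cube => //.
- apply: measurableT_comp => //; apply: measurable_funB => //; apply: measurable_funM => //.
  by apply: (measurableT_comp mrho); exact: measurable_mulmx.
- move=> h; rewrite normr_ge0/=.
  have [h2|h2] := leP `|h| 2; last first.
    rewrite (supp0 _ h2) (supp0E _ h2).
    by rewrite mulr0 subrr normr0 mulr_ge0// ltW.
  have -> : \det E * rho (E *m h) - rho h =
    (\det E - 1) * rho (E *m h) + (rho (E *m h) - rho h) by ring.
  rewrite (le_trans (ler_normD _ _))// /C1 [leRHS]mulrDl lerD//.
    rewrite normrM mulrAC ler_pM//; first by rewrite HD// ltW.
    by rewrite ger0_norm.
  rewrite (le_trans (HK _ _))// -mulrA ler_wpM2l// (le_trans (Ediff _))//.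
  by rewrite mulrAC ler_wpM2r ?(ltW t0)// ler_wpM2l.
- move=> h hn; apply: contraNT hn; rewrite -ltNge => h2.
  rewrite (supp0 _ h2) (supp0E _ h2).
  by rewrite mulr0 subrr normr0.
Qed.

Lemma compact_cube (r : R) : 0 <= r -> compact [set X : cV | `|X| <= r].
Proof.
move=> r0.
have -> : [set X : cV | `|X| <= r] =
    trmx @` [set v : 'rV[R]_N | forall i, `[- r, r]%classic (v ord0 i)].
  apply/seteqP; split => [X /= /norm_cV_le Xr|_ [v /= vr <-]].
    exists X^T; last by rewrite trmxK.
    by move=> i; rewrite mxE /= in_itv/= -ler_norml Xr.
  apply/norm_cV_le => // i; rewrite mxE ler_norml.
  by have := vr i; rewrite /= in_itv.
apply: continuous_compact; last first.
  by apply: (@rV_compact R N (fun=> `[- r, r]%classic)) => _; exact: segment_compact.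
apply: continuous_subspaceT => X S [P XP PS].
exists (fun j i => P i j) => [j i|Y YP]; first by have := XP i j; rewrite mxE.
by apply: PS => i j; rewrite mxE.
Qed.

Lemma compact_support (f : cV -> R) (r : R) : 0 <= r ->
  (forall X, f X != 0 -> `|X| <= r) -> compact (closure [set X | f X != 0]).
Proof.
move=> r0 fr; apply: (subclosed_compact _ (compact_cube r0)).
  exact: closed_closure.
have cl : closed [set X : cV | `|X| <= r].
  exact: (compact_closed (@norm_hausdorff _ _) (compact_cube r0)).
by move=> X clX; apply: cl; apply: closure_subset clX => Y /= /fr.
Qed.

End near_identity.

Lemma cvge0_le (R : realType) (x : nat -> \bar R) (e : R) : 0 < e ->
  (forall n, 0 <= x n)%E -> x n @[n --> \oo] --> 0%E -> exists n, (x n <= e%:E)%E.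
Proof.
move=> e0 x0 /fine_cvgP[fin /cvgrPdist_le /(_ e e0) cv].
near \oo => n; exists n.
have xn : x n \is a fin_num by near: n.
rewrite -(fineK xn) lee_fin -[leLHS]ger0_norm ?fine_ge0// -normrN -sub0r.
by near: n.
Unshelve. all: by end_near. Qed.

Section Lp_density.
Context {R : realType} {N : nat}.
Local Notation cV := 'cV[R]_N.
Local Notation L := (lebesgue_cV R N).
Variable p : R.
Hypothesis p1 : 1 <= p.

Let p0 : 0 < p := lt_le_trans ltr01 p1.

Lemma Lpint_dominated (h : nat -> cV -> R) (G : cV -> R) :
  (forall n, measurable_fun setT (h n)) -> measurable_fun setT G ->
  (forall n X, `|h n X| <= `|G X|) -> (Lpint p G < +oo)%E ->
  (forall X, h n X @[n --> \oo] --> 0) ->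
  Lpint p (h n) @[n --> \oo] --> 0%E.
Proof.
move=> mh mG hG Gfin h0.
have mhp n : measurable_fun setT (fun X => `|h n X| `^ p) by exact: measurable_powR_norm.
have mGp : measurable_fun setT (fun X => `|G X| `^ p) by exact: measurable_powR_norm.
have := @dominated_convergence _ _ _ L setT measurableT
  (fun n X => (`|h n X| `^ p)%:E) (cst 0%E) (fun X => (`|G X| `^ p)%:E).
case.
- by move=> n; exact/measurable_EFinP.
- exact: measurable_cst.
- apply: aeW => X _; apply/cvg_EFin; first by apply: nearW.
  rewrite [X in _ --> X](_ : _ = (0 : R))//; apply/cvgrPdist_le => e e0.
  have ep : 0 < e `^ p^-1 by rewrite powR_gt0.
  have /cvgrPdist_le /(_ _ ep) := h0 X; apply: filterS => n.
  rewrite !sub0r !normrN => hn; rewrite /= ger0_norm ?powR_ge0//.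
  rewrite (_ : e = (e `^ p^-1) `^ p); last first.
    by rewrite -powRrM mulVf ?gt_eqF// powRr1// ltW.
  by apply: ge0_ler_powR; rewrite ?nnegrE ?powR_ge0 ?(ltW p0).
- apply/integrableP; split; first exact/measurable_EFinP.
  by under eq_integral do rewrite gee0_abs ?lee_fin ?powR_ge0//.
- apply: aeW => X n _; rewrite gee0_abs ?lee_fin ?powR_ge0//.
  by apply: ge0_ler_powR; rewrite ?nnegrE ?(ltW p0).
move=> _ _; rewrite integral0.
exact.
Qed.

Definition lipschitz_compact (k : cV -> R) := exists K M, [/\ 0 <= K, 0 <= M,
  forall X Y, `|k Y - k X| <= K * `|Y - X| & forall X, k X != 0 -> `|X| <= M].

Definition Lp_approx (f : cV -> R) := forall e : R, 0 < e ->
  exists2 k, lipschitz_compact k & (Lpint p (f \- k)%R <= e%:E)%E.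

Lemma lipschitz_compact_measurable k : lipschitz_compact k -> measurable_fun setT k.
Proof.
move=> [K [M [_ _ HK _]]]; apply: continuous_measurable_matrix.
exact: (lipschitz_continuous HK).
Qed.

Lemma lipschitz_compactD k1 k2 : lipschitz_compact k1 -> lipschitz_compact k2 ->
  lipschitz_compact (k1 \+ k2).
Proof.
move=> [K1 [M1 [K10 M10 H1 S1]]] [K2 [M2 [K20 M20 H2 S2]]].
exists (K1 + K2), (Num.max M1 M2); split.
- exact: addr_ge0.
- by rewrite le_max M10.
- move=> X Y /=; rewrite opprD addrACA (le_trans (ler_normD _ _))// mulrDl lerD//.
- move=> X /=; rewrite le_max; have [/eqP e1|/S1 ->//] := boolP (k1 X == 0).
  by rewrite e1 add0r => /S2 ->; rewrite orbT.
Qed.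

Lemma lipschitz_compactZ c k : lipschitz_compact k -> lipschitz_compact (fun X => c * k X).
Proof.
move=> [K [M [K0 M0 H S]]]; exists (`|c| * K), M; split => //; first exact: mulr_ge0.
  by move=> X Y; rewrite -mulrBr normrM -mulrA ler_wpM2l.
by move=> X; rewrite mulf_eq0 negb_or => /andP[_ /S].
Qed.

Lemma Lpint_pow_gt0 : 0 < 2 `^ p :> R. Proof. by rewrite powR_gt0. Qed.

Lemma Lp_approx_limit (f : cV -> R) : measurable_fun setT f ->
  (forall e : R, 0 < e -> exists g, [/\ measurable_fun setT g, Lp_approx g &
    (Lpint p (f \- g)%R <= e%:E)%E]) -> Lp_approx f.
Proof.
move=> mf H e e0.
have d0 : 0 < e / (2 `^ p * 2) by rewrite divr_gt0// mulr_gt0// Lpint_pow_gt0.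
have [g [mg ag fg]] := H _ d0; have [k nk gk] := ag _ d0; exists k => //.
have mk := lipschitz_compact_measurable nk.
apply: le_trans (@Lpint_add_le _ _ p (f \- k) (f \- g) (g \- k) _ _ _ _ _) _.
- exact: ltW.
- exact: measurable_funB.
- exact: measurable_funB.
- exact: measurable_funB.
- by move=> X /=; rewrite (_ : f X - k X = (f X - g X) + (g X - k X)) ?ler_normD//; ring.
apply: (@le_trans _ _ ((2 `^ p)%:E * ((e / (2 `^ p * 2))%:E + (e / (2 `^ p * 2))%:E))%E).
  by apply: lee_wpmul2l; rewrite ?lee_fin ?powR_ge0// leeD.
rewrite -EFinD -EFinM lee_fin le_eqVlt; apply/orP; left; apply/eqP.
by field; rewrite gt_eqF// Lpint_pow_gt0.
Qed.

Lemma Lp_approxD (f g : cV -> R) : measurable_fun setT f -> measurable_fun setT g ->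
  Lp_approx f -> Lp_approx g -> Lp_approx (f \+ g).
Proof.
move=> mf mg af ag e e0.
have d0 : 0 < e / (2 `^ p * 2) by rewrite divr_gt0// mulr_gt0// Lpint_pow_gt0.
have [k1 n1 h1] := af _ d0; have [k2 n2 h2] := ag _ d0.
exists (k1 \+ k2); first exact: lipschitz_compactD.
have mk1 := lipschitz_compact_measurable n1; have mk2 := lipschitz_compact_measurable n2.
apply: le_trans (@Lpint_add_le _ _ p _ (f \- k1) (g \- k2) _ _ _ _ _) _.
- exact: ltW.
- by apply: measurable_funB; exact: measurable_funD.
- exact: measurable_funB.
- exact: measurable_funB.
- by move=> X /=; rewrite opprD addrACA ler_normD.
apply: (@le_trans _ _ ((2 `^ p)%:E * ((e / (2 `^ p * 2))%:E + (e / (2 `^ p * 2))%:E))%E).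
  by apply: lee_wpmul2l; rewrite ?lee_fin ?powR_ge0// leeD.
rewrite -EFinD -EFinM lee_fin le_eqVlt; apply/orP; left; apply/eqP.
by field; rewrite gt_eqF// Lpint_pow_gt0.
Qed.

Lemma Lp_approxZ c (f : cV -> R) : measurable_fun setT f -> Lp_approx f ->
  Lp_approx (fun X => c * f X).
Proof.
move=> mf af e e0.
have C0 : 0 < `|c| `^ p + 1 by rewrite ltr_wpDl// powR_ge0.
have d0 : 0 < e / (`|c| `^ p + 1) by rewrite divr_gt0.
have [k nk h] := af _ d0; exists (fun X => c * k X); first exact: lipschitz_compactZ.
have mk := lipschitz_compact_measurable nk.
have md : measurable_fun setT (fun X => `|(f \- k) X| `^ p).
  by apply: measurable_powR_norm; exact: measurable_funB.
have -> : Lpint p ((fun X => c * f X) \- (fun X => c * k X)) = ((`|c| `^ p)%:E * Lpint p (f \- k)%R)%E.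
  have md0 X : 0 <= `|(f \- k) X| `^ p by exact: powR_ge0.
  rewrite /Lpint (ge0_integralZl_fin L md md0) ?powR_ge0//.
  by apply: eq_integral => X _ /=; rewrite -mulrBr normrM powRM.
apply: (@le_trans _ _ ((`|c| `^ p)%:E * (e / (`|c| `^ p + 1))%:E)%E).
  by rewrite lee_wpmul2l ?lee_fin ?powR_ge0.
by rewrite -EFinM lee_fin mulrCA ler_piMr ?(ltW e0)// ler_pdivrMr// mul1r lerDl.
Qed.

Lemma Lpint0 : Lpint p (fun _ : cV => 0) = 0%E.
Proof.
by rewrite /Lpint; under eq_integral do rewrite normr0 powR0 ?gt_eqF//; rewrite integral0.
Qed.

Lemma Lp_approx0 : Lp_approx (fun _ => 0).
Proof.
move=> e e0; exists (fun _ => 0).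
  by exists 0, 0; split => // [X Y|X]; rewrite ?subrr ?normr0 ?mul0r// eqxx.
rewrite (_ : _ \- _ = (fun _ : cV => 0)) ?Lpint0 ?lee_fin ?(ltW e0)//.
by apply/funext => X /=; rewrite subrr.
Qed.

Variable m : R.
Hypothesis m0 : 0 < m.

Let V : set cV := [set X | `|X| < m].

Let openV : open V.
Proof.
rewrite (_ : V = ball (0 : cV) m); first exact: ball_open.
by apply/seteqP; split => X; rewrite -ball_normE /= sub0r normrN.
Qed.

Let measurableV : measurable V. Proof. exact: open_measurable_matrix. Qed.

Let LpintV (G : cV -> R) : measurable_fun setT G ->
  (forall X, `|G X| <= \1_V X) -> (Lpint p G < +oo)%E.
Proof.
move=> mG GV; apply: le_lt_trans (ltry (1 * (2 * m) ^+ N)).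
apply: (@integral_le_cube _ _ _ _ m) => //; first exact: ltW.
- exact: measurable_powR_norm.
- move=> X; have pw : 1 `^ p = 1 :> R by rewrite powR1.
  rewrite powR_ge0/= -[leRHS]pw.
  apply: ge0_ler_powR; rewrite ?nnegrE ?(ltW p0)//.
  by rewrite (le_trans (GV X))// indicE; case: (X \in V).
- move=> X; apply: contraNT; rewrite -ltNge => mX.
  have -> : `|G X| = 0.
    apply/eqP; rewrite eq_le normr_ge0 andbT (le_trans (GV X))// indicE memNset//.
    by rewrite /V /= => /(lt_trans mX); rewrite ltxx.
  by rewrite powR0// gt_eqF.
Qed.

(* Lipschitz minorants k_n X = inf_Z (1_U Z + n |X - Z|) increase to 1_U. *)
Lemma Lp_approx_open (U : set cV) : open U -> U `<=` V -> Lp_approx \1_U.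
Proof.
move=> oU UV e e0.
pose A n X : set R := range (fun Z : cV => \1_U Z + n%:R * `|X - Z|).
pose k (n : nat) X : R := inf (A n X).
have ind0 (X : cV) : 0 <= \1_U X :> R by rewrite indicE.
have A0 n X : A n X !=set0 by exists (\1_U X + n%:R * `|X - X|); exists X.
have Alb n X : lbound (A n X) 0.
  by move=> _ [Z _ <-]; rewrite addr_ge0// mulr_ge0.
have Ahl n X : has_inf (A n X) by split => //; exists 0.
have k0 n X : 0 <= k n X by apply: lb_le_inf.
have kle n X Z : k n X <= \1_U Z + n%:R * `|X - Z|.
  by apply: ge_inf; [exists 0|exists Z].
have kU n X : k n X <= \1_U X.
  by have := kle n X X; rewrite subrr normr0 mulr0 addr0.
have klip n X Y : `|k n Y - k n X| <= n%:R * `|Y - X|.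
  wlog xy : X Y / k n X <= k n Y.
    move=> H; have [/H//|/ltW/H] := leP (k n X) (k n Y).
    by rewrite distrC [`|X - Y|]distrC.
  rewrite ger0_norm ?subr_ge0// lerBlDr -lerBlDl.
  apply: lb_le_inf => // _ [Z _ <-]; rewrite lerBlDl (le_trans (kle n Y Z))//.
  rewrite addrCA lerD2l -mulrDr ler_wpM2l//.
  by rewrite (_ : Y - Z = (Y - X) + (X - Z)) ?ler_normD// addrA subrK.
have nk n : lipschitz_compact (k n).
  exists n%:R, m; split => //; first exact: ltW.
  move=> X; apply: contraNT; rewrite -ltNge => mX.
  rewrite eq_le k0 andbT (le_trans (kU n X))// indicE memNset// => /UV.
  by rewrite /V/= => /(lt_trans mX); rewrite ltxx.
have mU : measurable U := open_measurable_matrix oU.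
have mind : measurable_fun setT (\1_U : cV -> R) by exact: measurable_indic.
have mk n := lipschitz_compact_measurable (nk n).
have cv : Lpint p (\1_U \- k n) @[n --> \oo] --> 0%E.
  apply: (@Lpint_dominated (fun n => \1_U \- k n) \1_U) => //.
  - by move=> n; exact: measurable_funB.
  - move=> n X /=; rewrite ger0_norm ?subr_ge0// ger0_norm// lerBlDr lerDl//.
  - apply: LpintV => // X; rewrite ger0_norm// !indicE.
    have [|//] := boolP (X \in U); rewrite inE => /UV VX; rewrite mem_set//.
  - move=> X /=; have [XU|XU] := boolP (X \in U); last first.
      rewrite (_ : (fun n => _) = cst 0); first exact: cvg_cst.
      apply/funext => n /=; apply/eqP; rewrite subr_eq0 eq_le kU andbT indicE (negbTE XU).
      exact: k0.
    move: (XU); rewrite inE => UX.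
    have /nbhs_ballP[r /= r0 rU] : nbhs X U by exact: open_nbhs_nbhs.
    have cvr : (fun n => Num.max 0 (1 - n%:R * r)) n @[n --> \oo] --> (0 : R).
      apply: (@cvg_near_cst _ _ _ _ _ _).
      exists (Num.truncn r^-1).+1 => // n /= hn.
      apply/eqP; rewrite -/(Num.max 0 _) max_l// subr_le0 -ler_pdivrMr// mul1r.
      by rewrite ltW// (lt_le_trans (Num.Theory.truncnS_gt _))// ler_nat.
    apply: (squeeze_cvgr _ (cvg_cst (0 : R)) cvr); apply: nearW => n.
    rewrite subr_ge0 kU/= le_max subr_le0 indicE XU/=.
    apply/orP; have [nr|nr] := leP 1 (n%:R * r).
      left; apply: lb_le_inf => // _ [Z _ <-]; rewrite indicE.
      have [|ZU] := boolP (Z \in U); first by rewrite lerDl mulr_ge0.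
      rewrite add0r (le_trans nr)// ler_wpM2l// leNgt; apply: contra ZU => XZ.
      by rewrite inE; apply: rU; rewrite -ball_normE.
    right; rewrite lerD2l lerN2; apply: lb_le_inf => // _ [Z _ <-]; rewrite indicE.
    have [_|ZU] := boolP (Z \in U); first by rewrite (le_trans (ltW nr))// lerDl mulr_ge0.
    rewrite add0r ler_wpM2l// leNgt; apply: contra ZU => XZ.
    by rewrite inE; apply: rU; rewrite -ball_normE.
have [n hn] := cvge0_le e0 (fun n => Lpint_ge0 _ _) cv.
by exists (k n).
Unshelve. all: by end_near. Qed.

End Lp_density.

Section Lp_density_bounded_support.
Context {R : realType} {N : nat}.
Local Notation cV := 'cV[R]_N.
Local Notation L := (lebesgue_cV R N).
Variables p m : R.
Hypothesis p1 : 1 <= p.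
Hypothesis m0 : 0 < m.

Let p0 : 0 < p := lt_le_trans ltr01 p1.

Let V : set cV := [set X | `|X| < m].

Let openV : open V.
Proof.
rewrite (_ : V = ball (0 : cV) m); first exact: ball_open.
by apply/seteqP; split => X; rewrite -ball_normE /= sub0r normrN.
Qed.

Let measurableV : measurable V. Proof. exact: open_measurable_matrix. Qed.

Let mindic (A : set cV) : measurable A -> measurable_fun setT (\1_A : cV -> R).
Proof. by move=> mA; exact: measurable_indic. Qed.

Let LpV : (Lpint p (\1_V : cV -> R) < +oo)%E.
Proof.
apply: le_lt_trans (ltry (1 * (2 * m) ^+ N)).
apply: (@integral_le_cube _ _ _ _ m) => //; first exact: ltW.
- by apply: measurable_powR_norm; exact: mindic.
- move=> X; rewrite indicE; case: (X \in V); rewrite ?normr1 ?normr0 ?powR1 ?powR0 ?gt_eqF//= ?lexx ?ler01//.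
- move=> X; rewrite indicE; have [XV _|XV] := boolP (X \in V); last first.
    by rewrite mulr0n normr0 (powR0 (lt0r_neq0 p0)) eqxx.
  by move: XV; rewrite inE => /ltW.
Qed.

Let P (A : set cV) := Lp_approx p (\1_(A `&` V) : cV -> R).

Let approx_measurable (A : set cV) : measurable A -> P A.
Proof.
move=> mA.
apply: (@dynkin_induction _ cV [set U : set cV | open U] P (@measurable_matrixE R N 1)).
- by move=> U W; exact: openI.
- rewrite /P setTI; exact: (@Lp_approx_open _ _ p p1 m m0).
- move=> U oU; apply: (@Lp_approx_open _ _ p p1 m m0); first exact: openI.
  by move=> X [].
- move=> S mS PS; rewrite /P.
  have -> : \1_(~` S `&` V) = (\1_V \+ (fun X => -1 * \1_(S `&` V) X) : cV -> R).
    apply/funext => X /=; rewrite !indicE !in_setI in_setC.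
    by case: (X \in S); case: (X \in V) => /=; rewrite ?mulr0 ?addr0// mulr1 subrr.
  have mSV : measurable_fun setT (\1_(S `&` V) : cV -> R).
    by apply: mindic; exact: measurableI.
  apply: (@Lp_approxD _ _ p p1 \1_V (fun X => -1 * \1_(S `&` V) X)).
  + exact: mindic.
  + exact: measurable_funM.
  + exact: (@Lp_approx_open _ _ p p1 m m0).
  + exact: (@Lp_approxZ _ _ p (-1) (\1_(S `&` V)) mSV PS).
- move=> F mF tF PF; rewrite /P.
  have mU : measurable (\bigcup_k F k) by exact: bigcup_measurable.
  pose G n : cV -> R := fun X => \sum_(i < n) \1_(F i `&` V) X.
  have mG n : measurable_fun setT (G n).
    by apply: measurable_sum => i; apply: mindic; exact: measurableI.
  have aG n : Lp_approx p (G n).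
    rewrite /G; elim: n => [|n IH].
      by under eq_fun do rewrite big_ord0; exact: Lp_approx0.
    under eq_fun do rewrite big_ord_recr/=.
    apply: (@Lp_approxD _ _ p p1 (G n) (\1_(F n `&` V)) (mG n) _ IH (PF n)).
    by apply: mindic; exact: measurableI.
  have GE n X : (exists2 i, (i < n)%N & F i X) -> V X -> G n X = 1.
    move=> [i ilt FiX] VX; rewrite /G (bigD1 (Ordinal ilt))//= big1 ?addr0.
      by rewrite indicE mem_set.
    move=> j ji; rewrite indicE memNset// => -[FjX _].
    move/eqP : ji; apply; apply/val_inj => /=.
    by apply: (tF j i) => //; exists X.
  have G0 n X : ~ (exists2 i, (i < n)%N & F i X) \/ ~ V X -> G n X = 0.
    move=> H; rewrite /G big1// => i _; rewrite indicE memNset// => -[FiX VX].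
    by case: H => [|]; [apply; exists i|apply].
  apply: Lp_approx_limit => //; first by apply: mindic; exact: measurableI.
  move=> e e0.
  have cv : Lpint p (\1_(\bigcup_k F k `&` V) \- G n) @[n --> \oo] --> 0%E.
    apply: (@Lpint_dominated _ _ p p1 (fun n => \1_(\bigcup_k F k `&` V) \- G n) \1_V) => //.
    - by move=> n; apply: measurable_funB => //; apply: mindic; exact: measurableI.
    - move=> n X /=; rewrite !indicE in_setI.
      have [VX|VX] := boolP (X \in V); last first.
        rewrite andbF G0 ?subrr//; right.
        by move/negP : VX; rewrite inE.
      rewrite andbT normr1; have [E|E] := pselect (exists2 i, (i < n)%N & F i X).
        rewrite GE//; last by rewrite inE in VX.
        rewrite mem_set ?subrr ?normr0//; case: E => i _ FiX; by exists i.
      by rewrite (G0 _ _ (or_introl E)) subr0; case: (_ \in _); rewrite ?normr1 ?normr0.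
    - move=> X; apply: cvg_near_cst.
      have [VX|VX] := pselect (V X); last first.
        apply: nearW => n /=; rewrite (G0 n X (or_intror VX)) indicE memNset ?subrr//.
        by move=> [].
      have [[i _ FiX]|nF] := pselect ((\bigcup_k F k) X).
        exists i.+1 => // n /= ilt; rewrite (GE n X)//; last by exists i.
        by rewrite indicE mem_set ?subrr//; split => //; exists i.
      apply: nearW => n /=; rewrite G0; last first.
        by left => -[i _ FiX]; apply: nF; exists i.
      by rewrite indicE memNset ?subrr// => -[].
  have [n Hn] := cvge0_le e0 (fun n => Lpint_ge0 _ _) cv.
  by exists (G n).
by rewrite -measurable_matrixE.
Qed.

Let approx_nonneg (f : cV -> R) : measurable_fun setT f -> (forall X, 0 <= f X) ->
  (forall X, f X != 0 -> V X) -> (Lpint p f < +oo)%E -> Lp_approx p f.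
Proof.
move=> mf f0 fV Lf.
have mfE : measurable_fun setT (EFin \o f) by exact/measurable_EFinP.
pose s n : {nnsfun cV >-> R} := nnsfun_approx measurableT mfE n.
have f0E X : setT X -> (0 <= (EFin \o f) X)%E by rewrite /= lee_fin.
have scv (X : cV) : s n X @[n --> \oo] --> f X.
  by have /fine_cvgP[_] := @cvg_nnsfun_approx _ _ _ _ measurableT _ mfE f0E X Logic.I.
have sle n (X : cV) : s n X <= f X.
  rewrite -(cvg_lim _ (scv X))//; apply: nondecreasing_cvgn_le; last by apply/cvg_ex; exists (f X).
  by move=> a b ab; have /lefP := nd_nnsfun_approx measurableT mfE ab; exact.
have s0 n (X : cV) : 0 <= s n X by exact: fun_ge0.
have ms n : measurable_fun setT (s n) by exact: measurable_funP.
apply: Lp_approx_limit => // e e0.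
have cv : Lpint p (f \- s n) @[n --> \oo] --> 0%E.
  apply: (@Lpint_dominated _ _ p p1 (fun n => f \- s n) f) => //.
  - by move=> n; exact: measurable_funB.
  - by move=> n X /=; rewrite !ger0_norm ?subr_ge0// lerBlDr lerDl.
  - move=> X; rewrite -[X in _ --> X](subrr (f X)).
    by apply: cvgB => //; exact: cvg_cst.
have [n Hn] := cvge0_le e0 (fun n => Lpint_ge0 _ _) cv.
exists (s n); split => //.
have sE : (s n : cV -> R) = fun X => \sum_(y <- finmap.enum_fset (fset_set (range (s n))))
    y * \1_(s n @^-1` [set y] `&` V) X.
  apply/funext => X; rewrite {1}fimfunE fsbig_finite//=.
  have [VX|VX] := pselect (V X).
    by apply: eq_bigr => y _; rewrite !indicE in_setI [X in _ && X]mem_set// andbT.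
  have sX0 : s n X = 0.
    apply/eqP; rewrite eq_le s0 andbT (le_trans (sle n X))//.
    by rewrite leNgt; apply/negP => fX; apply: VX; apply: fV; rewrite gt_eqF.
  have := fimfunE (s n) X; rewrite fsbig_finite//= sX0 => <-.
  by rewrite big1// => y _; rewrite indicE in_setI [X in _ && X]memNset// andbF mulr0.
rewrite sE; elim: (finmap.enum_fset (fset_set (range (s n)))) => [|y l IH].
  by under eq_fun do rewrite big_nil; exact: Lp_approx0.
under eq_fun do rewrite big_cons.
have my y' : measurable (s n @^-1` [set y'] : set cV).
  by rewrite -[X in measurable X]setTI; exact: ms.
have mI y' : measurable_fun setT (fun X => y' * \1_(s n @^-1` [set y'] `&` V) X).
  by apply: measurable_funM => //; apply: mindic; exact: measurableI.
apply: (Lp_approxD p1 (mI y) _ _ IH); first by apply: measurable_sum => i; exact: mI.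
apply: (@Lp_approxZ _ _ p y (\1_(s n @^-1` [set y] `&` V))); first by apply: mindic; exact: measurableI.
exact: approx_measurable.
Qed.

Lemma Lp_approx_bounded_support (f : cV -> R) : measurable_fun setT f ->
  (forall X, f X != 0 -> `|X| < m) -> (Lpint p f < +oo)%E -> Lp_approx p f.
Proof.
move=> mf fV Lf.
have mfp : measurable_fun setT (f \max cst 0) by exact: measurable_maxr.
have mfn : measurable_fun setT ((fun X => - f X) \max cst 0).
  by apply: measurable_maxr => //; exact: measurableT_comp.
have -> : f = (f \max cst 0) \+ (fun X => -1 * ((fun X => - f X) \max cst 0) X).
  apply/funext => X /=; have [fX|fX] := leP (f X) 0.
    by rewrite max_l ?oppr_ge0// mulN1r opprK add0r.
  by rewrite max_r ?oppr_le0 ?(ltW fX)// mulr0 addr0.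
have fin (g : cV -> R) : measurable_fun setT g -> (forall X, `|g X| <= `|f X|) -> (Lpint p g < +oo)%E.
  move=> mg gf; apply: le_lt_trans Lf; apply: ge0_le_integral_fin.
  - exact: measurable_powR_norm.
  - exact: measurable_powR_norm.
  - by move=> X; exact: powR_ge0.
  - by move=> X; apply: ge0_ler_powR; rewrite ?nnegrE ?(ltW p0).
have mfn' : measurable_fun setT (fun X => -1 * ((fun X => - f X) \max cst 0) X).
  exact: measurable_funM.
have sn (g : cV -> R) : (forall X, `|g X| <= `|f X|) -> forall X, g X != 0 -> V X.
  move=> gf X; rewrite -normr_gt0 => gX; apply: fV; rewrite -normr_gt0.
  exact: lt_le_trans gX (gf X).
have fp X : `|(f \max cst 0) X| <= `|f X|.
  by rewrite /=; have [fX|fX] := leP (f X) 0; rewrite ?normr0.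
have fn X : `|((fun X => - f X) \max cst 0) X| <= `|f X|.
  by rewrite /=; have [fX|fX] := leP (- f X) 0; rewrite ?normr0// normrN.
apply: (Lp_approxD p1 mfp mfn').
  apply: (approx_nonneg mfp _ (sn _ fp) (fin _ mfp fp)).
  by move=> X; rewrite /= le_max lexx orbT.
apply: (@Lp_approxZ _ _ p (-1) ((fun X => - f X) \max cst 0) mfn).
apply: (approx_nonneg mfn _ (sn _ fn) (fin _ mfn fn)).
by move=> X; rewrite /= le_max lexx orbT.
Qed.

End Lp_density_bounded_support.

Section mollify_convergence.
Context {R : realType} {N : nat}.
Local Notation cV := 'cV[R]_N.
Local Notation L := (lebesgue_cV R N).
Variables (p : R) (rho : cV -> R) (phi : 'I_N -> R -> R) (c : R).
Hypothesis p1 : 1 <= p.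
Hypothesis mol : mollifier_spec rho phi c.

Let p0 : 0 < p := lt_le_trans ltr01 p1.

Lemma integrable_rho_shift (g : cV -> R) eps X : 0 < eps ->
  L.-integrable setT (EFin \o g) ->
  L.-integrable setT (EFin \o (fun h => rho h * g (X + eps *: h))).
Proof.
move=> eps0 ig; have [M HM] := mol_bnd mol.
apply: (@integrable_bounded_mul _ _ rho (fun h => g (X + eps *: h)) M (mol_meas mol)).
  by move=> h; rewrite ger0_norm ?(mol_ge0 mol).
have := integrable_affine_cV X (posdef_scalar (N := N) eps0) ig.
congr (_.-integrable _ _); apply/funext => h /=.
by rewrite mul_scalar_mx addrC.
Qed.

Lemma Lpint_mollify_le (g : cV -> R) eps : 0 < eps -> L.-integrable setT (EFin \o g) ->
  measurable_fun setT (mollify rho eps g) ->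
  (Lpint p (mollify rho eps g) <= Lpint p g)%E.
Proof.
move=> eps0 ig mu.
have mg : measurable_fun setT g by apply/measurable_EFinP; exact: measurable_int ig.
have mgp : measurable_fun setT (fun X => `|g X| `^ p) by exact: measurable_powR_norm.
have gp0 X : 0 <= `|g X| `^ p by exact: powR_ge0.
have mrho := mol_meas mol; have rho0 := mol_ge0 mol.
have mgs X : measurable_fun setT (fun h : cV => g (X + eps *: h)).
  by apply: (measurableT_comp mg); apply: measurable_addmx => //; exact: measurable_scalemx.
have F2 : measurable2 (fun X h => rho h * `|g (X + eps *: h)| `^ p).
  apply: measurable_funM; first exact: (measurableT_comp mrho measurable_snd).
  apply: measurable_powR_norm; apply: (measurableT_comp mg).
  by apply: measurable_addmx => //; exact: measurable_scalemx.
have F0 X h : 0 <= rho h * `|g (X + eps *: h)| `^ p by rewrite mulr_ge0 ?powR_ge0.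
have := integral_weighted_translate eps mrho rho0 mgp gp0.
rewrite (mol_int mol) mul1e /Lpint => <-.
apply: ge0_le_integral => //.
- by apply/measurable_EFinP; exact: measurable_powR_norm.
- exact: (measurable2_integral F2 F0).
move=> X _.
have := @jensen_powR _ _ _ L rho (fun h => `|g (X + eps *: h)|) (mollify rho eps g X) 1 p p1 ltr01 mrho.
rewrite powR1 mul1e; apply => //.
- exact: measurableT_comp.
- by rewrite (mol_int mol).
apply: le_trans (abs_Rintegral_le (integrable_rho_shift X eps0 ig)) _.
rewrite le_eqVlt; apply/orP; left; apply/eqP; apply: eq_integral => h _.
by rewrite normrM ger0_norm.
Qed.

Lemma mollify_Lipschitz_le (k : cV -> R) (K eps : R) X : 0 < eps -> 0 <= K ->
  (forall X Y, `|k Y - k X| <= K * `|Y - X|) -> L.-integrable setT (EFin \o k) ->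
  `|mollify rho eps k X - k X| <= K * eps.
Proof.
move=> eps0 K0 HK ik.
have irho : L.-integrable setT (EFin \o rho).
  apply/integrableP; split; first by apply/measurable_EFinP; exact: (mol_meas mol).
  under eq_integral do rewrite /= ger0_norm ?(mol_ge0 mol)//.
  by rewrite (mol_int mol) ltry.
have ic (a : R) : L.-integrable setT (EFin \o (fun h => rho h * a)).
  have := integrableZr measurableT a irho; congr (_.-integrable _ _).
have rint : \int[L]_h rho h = 1 by rewrite /Rintegral (mol_int mol).
have -> : k X = \int[L]_h (rho h * k X) by rewrite RintegralZr// rint mul1r.
have i1 := integrable_rho_shift X eps0 ik.
rewrite /mollify -RintegralB//; under eq_Rintegral do rewrite -mulrBr.
have i2 : L.-integrable setT (EFin \o (fun h => rho h * (k (X + eps *: h) - k X))).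
  have := integrableB measurableT i1 (ic (k X)); congr (_.-integrable _ _).
  by apply/funext => h /=; rewrite -EFinB mulrBr.
rewrite (le_trans (le_normr_Rintegral _ i2))//.
have -> : K * eps = \int[L]_h (rho h * (K * eps)) by rewrite RintegralZr// rint mul1r.
apply: le_Rintegral => //; first exact: integrable_norm.
move=> h _; rewrite normrM ger0_norm ?(mol_ge0 mol)//.
have [->|rh] := eqVneq (rho h) 0; first by rewrite !mul0r.
rewrite ler_wpM2l ?(mol_ge0 mol)// (le_trans (HK _ _))// ler_wpM2l//.
rewrite addrAC subrr add0r normrZ gtr0_norm// ler_piMr ?(ltW eps0)//.
exact: (mol_supp mol).
Qed.

Lemma mollify_support (g : cV -> R) (M eps : R) : 0 < eps <= 1 ->
  (forall X, g X != 0 -> `|X| <= M) ->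
  forall X, mollify rho eps g X != 0 -> `|X| <= M + 1.
Proof.
move=> /andP[eps0 eps1] gM X; apply: contraNT; rewrite -ltNge => MX.
rewrite /mollify; apply/eqP; rewrite /Rintegral (eq_integral (cst 0%E)) ?integral0//.
move=> h _ /=; congr EFin.
have [->|rh] := eqVneq (rho h) 0; first by rewrite mul0r.
have [->|gh] := eqVneq (g (X + eps *: h)) 0; first by rewrite mulr0.
have h1 := mol_supp mol rh; have g1 := gM _ gh.
have : `|X| <= `|X + eps *: h| + `|eps *: h|.
  by rewrite -{1}[X](addrK (eps *: h)) (le_trans (ler_normB _ _)).
rewrite normrZ gtr0_norm// => XX.
have eh : eps * `|h| <= 1 by rewrite mulr_ile1// ltW.
by move: MX; rewrite ltNge (le_trans XX)// lerD.
Qed.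

Lemma mollify_cvg (g : cV -> R) (m e : R) : 0 < m -> 0 < e ->
  L.-integrable setT (EFin \o g) -> (forall X, g X != 0 -> `|X| < m) ->
  (Lpint p g < +oo)%E ->
  (forall eps f, 0 < eps -> L.-integrable setT (EFin \o f) ->
     measurable_fun setT (mollify rho eps f)) ->
  exists2 eps, 0 < eps <= 1 & (Lpint p (mollify rho eps g \- g)%R <= e%:E)%E.
Proof.
move=> m0 e0 ig gm Lg mmol.
have mg : measurable_fun setT g by apply/measurable_EFinP; exact: measurable_int ig.
have T0 : 0 < 2 `^ p :> R by rewrite powR_gt0.
pose T := 2 `^ p :> R.
pose d := e / (T + T * T + T * T).
have D0 : 0 < T + T * T + T * T by rewrite !addr_gt0 ?mulr_gt0.
have d0 : 0 < d by rewrite divr_gt0.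
have [k nk hk] := Lp_approx_bounded_support p1 m0 mg gm Lg d0.
have mk := lipschitz_compact_measurable nk.
have [K [M [K0 M0 HK SK]]] := nk.
have ik : L.-integrable setT (EFin \o k).
  apply/integrableP; split; first exact/measurable_EFinP.
  apply: (@le_lt_trans _ _ ((K * (2 * M) + `|k 0|) * (2 * M) ^+ N)%:E); last by rewrite ltry.
  apply: (@integral_le_cube _ _ (fun X => `|k X|) _ M) => //.
  - exact: measurableT_comp.
  - move=> X; rewrite normr_ge0/=.
    have [->|/SK XM] := eqVneq (k X) 0; first by rewrite normr0 addr_ge0 ?mulr_ge0.
    rewrite -[k X](subrK (k 0)) (le_trans (ler_normD _ _))// lerD2r (le_trans (HK 0 X))//.
    by rewrite ler_wpM2l// subr0 (le_trans XM)// ler_peMl// ler1n.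
  - by move=> X; rewrite normr_eq0 => /SK.
pose B := (2 * (M + 1)) ^+ N; have B0 : 0 <= B by rewrite exprn_ge0// mulr_ge0// addr_ge0.
pose q := (d / (B + 1)) `^ p^-1.
have q0 : 0 < q by rewrite powR_gt0// divr_gt0// ltr_wpDl.
pose eps := Num.min 1 (q / (K + 1)).
have K1 : 0 < K + 1 by rewrite ltr_wpDl.
have eps0 : 0 < eps by rewrite lt_min ltr01 divr_gt0.
have eps1 : eps <= 1 by rewrite ge_min lexx.
have Kq : K * eps <= q.
  apply: (@le_trans _ _ (K * (q / (K + 1)))); first by rewrite ler_wpM2l// ge_min lexx orbT.
  by rewrite mulrCA ler_piMr ?(ltW q0)// ler_pdivrMr// mul1r lerDl.
exists eps; first by rewrite eps0.
have igk : L.-integrable setT (EFin \o (g \- k)).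
  have := integrableB measurableT ig ik; congr (_.-integrable _ _).
have mu := mmol _ _ eps0 ig; have muk := mmol _ _ eps0 ik; have mugk := mmol _ _ eps0 igk.
have linE X : mollify rho eps g X - g X =
    mollify rho eps (g \- k) X + ((mollify rho eps k X - k X) + (k X - g X)).
  have -> : mollify rho eps (g \- k) X = mollify rho eps g X - mollify rho eps k X.
    rewrite /mollify -RintegralB//; try exact: integrable_rho_shift.
    by apply: eq_Rintegral => h _; rewrite mulrBr.
  by ring.
have h1 : (Lpint p (mollify rho eps (g \- k)%R) <= d%:E)%E.
  by apply: le_trans hk; exact: Lpint_mollify_le.
have h3 : (Lpint p (k \- g)%R <= d%:E)%E.
  apply: le_trans hk; rewrite le_eqVlt; apply/orP; left; apply/eqP.
  by apply: eq_integral => X _ /=; rewrite distrC.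
have h2 : (Lpint p (mollify rho eps k \- k)%R <= d%:E)%E.
  have M1 : 0 <= M + 1 by rewrite addr_ge0.
  apply: (@le_trans _ _ ((d / (B + 1)) * B)%:E); last first.
    by rewrite lee_fin mulrAC ler_pdivrMr ?ltr_wpDl// ler_wpM2l ?(ltW d0)// lerDl.
  apply: (@integral_le_cube _ _ _ _ (M + 1)) => //.
  - by apply: measurable_powR_norm; exact: measurable_funB.
  - move=> X; rewrite powR_ge0/=.
    have -> : d / (B + 1) = q `^ p.
      by rewrite /q -powRrM mulVf ?gt_eqF// powRr1// divr_ge0 ?addr_ge0 ?(ltW d0).
    apply: ge0_ler_powR; rewrite ?nnegrE ?(ltW p0) ?(ltW q0)//.
    by rewrite (le_trans _ Kq)//; exact: mollify_Lipschitz_le.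
  - move=> X; apply: contraNT => MX.
    have kX : k X = 0.
      by apply/eqP; apply: contraNT MX => /SK XM; rewrite (le_trans XM)// lerDl.
    have mkX : mollify rho eps k X = 0.
      by apply/eqP; apply: contraNT MX; apply: mollify_support => //; rewrite eps0.
    by rewrite /= kX mkX subr0 normr0 (powR0 (lt0r_neq0 p0)) eqxx.
pose w X := (mollify rho eps k X - k X) + (k X - g X).
have mw : measurable_fun setT w by apply: measurable_funD; exact: measurable_funB.
have hw : (Lpint p w <= (T * (d + d))%:E)%E.
  apply: le_trans (@Lpint_add_le _ _ p w (mollify rho eps k \- k) (k \- g) _ _ _ _ _) _ => //.
  - exact: ltW.
  - exact: measurable_funB.
  - exact: measurable_funB.
  - by move=> X; exact: ler_normD.
  rewrite EFinM EFinD; apply: lee_wpmul2l; last exact: (leeD h2 h3).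
  by rewrite lee_fin powR_ge0.
apply: le_trans (@Lpint_add_le _ _ p _ (mollify rho eps (g \- k)) w _ _ _ _ _) _ => //.
- exact: ltW.
- exact: measurable_funB.
- by move=> X /=; rewrite linE ler_normD.
apply: (@le_trans _ _ ((2 `^ p)%:E * (d%:E + (T * (d + d))%:E))%E).
  apply: lee_wpmul2l; last exact: (leeD h1 hw).
  by rewrite lee_fin powR_ge0.
rewrite -EFinD -EFinM lee_fin le_eqVlt; apply/orP; left; apply/eqP.
by rewrite -/T /d; field; rewrite gt_eqF.
Qed.

End mollify_convergence.

Lemma ge0_integral_bigcup_le d (T : measurableType d) (R : realType)
    (mu : {measure set T -> \bar R}) (F : nat -> set T) (f : T -> R) (M : \bar R) :
  nondecreasing_seq F -> (forall n, measurable (F n)) ->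
  measurable_fun setT f -> (forall t, 0 <= f t) ->
  (forall n, \int[mu]_(t in F n) (f t)%:E <= M)%E ->
  (\int[mu]_(t in \bigcup_n F n) (f t)%:E <= M)%E.
Proof.
move=> ndF mF mf f0 FM.
have cv : (\int[mu]_(t in F n) (f t)%:E)%E @[n --> \oo] --> (\int[mu]_(t in \bigcup_n F n) (f t)%:E)%E.
  apply: (@ge0_nondecreasing_set_cvg_integral _ _ _ F (fun t => (f t)%:E) mu ndF mF) => [n|n t _].
    by apply/measurable_EFinP; exact: measurable_funTS.
  by rewrite lee_fin.
rewrite -(cvg_lim _ cv)//; apply: lime_le; first by apply/cvg_ex; eexists; exact: cv.
exact: nearW.
Qed.

Section power_integrals.
Context {R : realType}.
Local Notation mu := (@lebesgue_measure R).

Lemma integral_powR_segment (c x y : R) : 0 < x -> x < y -> c + 1 != 0 ->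
  (\int[mu]_(t in `[x, y]) (t `^ c)%:E =
   ((y `^ (c + 1) - x `^ (c + 1)) / (c + 1))%:E)%E.
Proof.
move=> x0 xy c1.
pose F z := (c + 1)^-1 * z `^ (c + 1).
have dp (e z : R) : 0 < z -> derivable (fun t : R => t `^ e) z 1.
  by move=> z0; apply: derivable_powR; rewrite in_itv/= z0.
have dF (z : R) : 0 < z -> derivable F z 1.
  by move=> z0; apply: derivableM => //; exact: dp.
have cF : {within `[x, y], continuous F}.
  apply: derivable_within_continuous => z; rewrite in_itv/= => /andP[xz _].
  exact/dF/(lt_le_trans x0 xz).
rewrite (@continuous_FTC2 _ (fun t => t `^ c) F x y)//.
- by rewrite -EFinB /F -mulrBr mulrC.
- apply: derivable_within_continuous => z; rewrite in_itv/= => /andP[xz _].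
  exact/dp/(lt_le_trans x0 xz).
- move/(continuous_within_itvP _ xy) : cF => [_ Fx Fy]; split => // z.
  by rewrite in_itv/= => /andP[xz _]; exact/dF/(lt_trans x0 xz).
- move=> z; rewrite in_itv/= => /andP[xz _]; have z0 := lt_trans x0 xz.
  rewrite derive1Ml; last exact: dp.
  by rewrite powR_derive1 ?in_itv/= ?z0// mulKf// addrK.
Qed.

Lemma integral_powR_near0 (c d : R) : 0 < d -> -1 < c ->
  (\int[mu]_(t in `]0%R, d]) (t `^ c)%:E < +oo)%E.
Proof.
move=> d0 c1; have c10 : 0 < c + 1 by rewrite -ltrBlDr sub0r.
pose F n : set R := `[d / n.+2%:R, d]%classic.
have mp : measurable_fun setT (fun t : R => t `^ c) by exact: measurable_powR.
have -> : `]0%R, d]%classic = \bigcup_n F n.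
  apply/seteqP; split=> [t|t [n _]] /=; rewrite !in_itv/=.
    move=> /andP[t0 td]; exists (Num.truncn (d / t)) => //=; rewrite /F/= in_itv/= td andbT.
    rewrite ler_pdivrMr ?ltr0n// mulrC -ler_pdivrMr// ltW//.
    apply: (lt_trans (truncnS_gt _)); by rewrite ltr_nat.
  by rewrite /F/= in_itv/= => /andP[dt ->]; rewrite andbT (lt_le_trans _ dt)// divr_gt0.
apply: (@le_lt_trans _ _ (d `^ (c + 1) / (c + 1))%:E); last exact: ltry.
apply: ge0_integral_bigcup_le => //.
- apply/nondecreasing_seqP => n; apply/subsetPset => t; rewrite /F/= !in_itv/=.
  move=> /andP[dt ->]; rewrite andbT (le_trans _ dt)// ler_pM2l//.
  by rewrite lef_pV2 ?posrE ?ltr0n// ler_nat.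
- by move=> n; exact: measurable_itv.
- by move=> t; exact: powR_ge0.
- move=> n; rewrite /F integral_powR_segment ?gt_eqF ?divr_gt0 ?ltr_pdivrMr ?ltr_pMr ?ltr1n//.
  by rewrite lee_fin ler_pM2r ?invr_gt0// gerDl oppr_le0 powR_ge0.
Qed.

Lemma integral_powR_tail (a d : R) : 0 < d -> 1 < a ->
  (\int[mu]_(t in `[d, +oo[) (t `^ - a)%:E < +oo)%E.
Proof.
move=> d0 a1; have c10 : - a + 1 < 0 by rewrite addrC subr_lt0.
pose F n : set R := `[d, d + n.+1%:R]%classic.
have -> : `[d, +oo[%classic = \bigcup_n F n.
  apply/seteqP; split=> [t|t [n _]] /=; rewrite !in_itv/= ?andbT.
    move=> dt; exists (Num.truncn (t - d)) => //=; rewrite /F/= in_itv/= dt.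
    by rewrite addrC -lerBlDr ltW// truncnS_gt.
  by rewrite /F/= in_itv/= => /andP[].
apply: (@le_lt_trans _ _ (- (d `^ (- a + 1)) / (- a + 1))%:E); last exact: ltry.
apply: ge0_integral_bigcup_le => //.
- apply/nondecreasing_seqP => n; apply/subsetPset => t; rewrite /F/= !in_itv/=.
  by move=> /andP[-> tn]/=; rewrite (le_trans tn)// lerD2l ler_nat.
- by move=> n; exact: measurable_itv.
- by move=> t; exact: powR_ge0.
- move=> n; rewrite /F integral_powR_segment ?lt_eqF ?ltrDl//.
  rewrite lee_fin ler_nM2r ?invr_lt0//.
  by rewrite lerBrDr addNr powR_ge0.
Qed.

Lemma integrable_powR_pieces (a c d : R) : 0 < d -> 1 < a -> -1 < c ->
  mu.-integrable `]0, +oo[ (EFin \o (fun t => if t <= d then t `^ c else t `^ - a)).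
Proof.
move=> d0 a1 c1.
have mp (e : R) : measurable_fun setT (fun t : R => t `^ e) by exact: measurable_powR.
have mw : measurable_fun setT (fun t : R => if t <= d then t `^ c else t `^ - a).
  by apply: measurable_fun_ifT => //; exact: measurable_fun_ler.
apply/integrableP; split; first by apply/measurable_EFinP; exact: measurable_funTS.
under eq_integral => t _.
  rewrite /= ger0_norm; last by case: ifP; rewrite powR_ge0.
  over.
have -> : `]0, +oo[%classic = `]0, d]%classic `|` `]d, +oo[%classic :> set R.
  apply/seteqP; split=> t /=; rewrite !in_itv/= !andbT.
    by move=> t0; have [td|td] := leP t d; [left; rewrite t0|right].
  by move=> [/andP[]//|]; exact: lt_trans.
rewrite ge0_integral_setU//=; first last.
- rewrite disj_set_sym; apply/disj_setPS => t /= []; rewrite !in_itv/= andbT.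
  by move=> dt /andP[_ td]; move: dt; rewrite ltNge td.
- by move=> t _; rewrite lee_fin; case: ifP; rewrite powR_ge0.
- by apply/measurable_EFinP; exact: measurable_funTS.
apply: lte_add_pinfty.
  apply: le_lt_trans (integral_powR_near0 d0 c1).
  rewrite le_eqVlt; apply/orP; left; apply/eqP; apply: eq_integral => t.
  by rewrite inE/= in_itv/= => /andP[_ ->].
apply: le_lt_trans (integral_powR_tail d0 a1).
apply: (@le_trans _ _ (\int[mu]_(t in `]d, +oo[) (t `^ - a)%:E)%E).
  rewrite le_eqVlt; apply/orP; left; apply/eqP; apply: eq_integral => t.
  by rewrite inE/= in_itv/= andbT => dt; rewrite leNgt dt.
apply: ge0_subset_integral => //.
- by apply/measurable_EFinP; exact: measurable_funTS.
- by move=> t _; rewrite lee_fin powR_ge0.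
- by move=> t /=; rewrite !in_itv/= !andbT; exact: ltW.
Qed.

Lemma weighted_integral_cvg0 (e : nat -> R -> \bar R) (e0 : R -> \bar R) (a b c l d C : R) :
  (forall n, measurable_fun setT (e n)) -> measurable_fun setT e0 ->
  (forall n t, 0 <= e n t)%E -> (forall t, 0 <= e0 t)%E ->
  0 < d -> 1 < a -> -1 < b - a -> 0 <= C -> 0 <= l -> 0 <= c ->
  (\int[mu]_(t in `]0%R, +oo[) ((t `^ a)^-1%:E * e0 t) < +oo)%E ->
  (forall n t, 0 < t <= d -> (e n t <= C%:E * (e0 t + (t `^ b * l)%:E))%E) ->
  (forall n t, 0 < t -> (e n t <= c%:E)%E) ->
  (forall t, 0 < t -> e n t @[n --> \oo] --> 0%E) ->
  (\int[mu]_(t in `]0%R, +oo[) ((t `^ a)^-1%:E * e n t))%E @[n --> \oo] --> 0%E.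
Proof.
move=> me me0 en0 e00 d0 a1 ba C0 l0 c0 fin small large pt.
have mI (E : R -> \bar R) : measurable_fun setT E ->
    measurable_fun (`]0, +oo[%classic : set R) (fun t : R => (t `^ a)^-1%:E * E t)%E.
  move=> mE; apply: measurable_funTS; apply: emeasurable_funM => //.
  apply/measurable_EFinP; apply: (measurableT_comp measurable_invr).
  exact: measurable_powR.
have i0 (t : R) : 0 <= (t `^ a)^-1 by rewrite invr_ge0 powR_ge0.
pose w t := (C * l + c) * (if t <= d then t `^ (b - a) else t `^ - a).
have iw : mu.-integrable `]0, +oo[ (EFin \o w).
  have := integrableZl _ (C * l + c) (integrable_powR_pieces d0 a1 ba).
  by move=> /(_ (measurable_itv _)); congr (_.-integrable _ _).
have ie0 : mu.-integrable `]0, +oo[ (fun t : R => (t `^ a)^-1%:E * e0 t)%E.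
  apply/integrableP; split; first exact: mI.
  by under eq_integral do rewrite gee0_abs ?mule_ge0 ?lee_fin//.
have ig : mu.-integrable `]0, +oo[ (fun t : R => C%:E * ((t `^ a)^-1%:E * e0 t) + (w t)%:E)%E.
  by apply: integrableD => //; exact: integrableZl.
have w0 t : 0 <= w t.
  by rewrite mulr_ge0 ?addr_ge0 ?mulr_ge0//; case: ifP; rewrite powR_ge0.
have cv : {ae mu, forall t, (`]0%R, +oo[%classic : set R) t ->
    ((t `^ a)^-1%:E * e n t)%E @[n --> \oo] --> 0%E}.
  apply: aeW => t; rewrite /= in_itv/= andbT => t0.
  rewrite -(mule0 (t `^ a)^-1%:E); apply: cvgeZl => //; exact: pt.
have dom : {ae mu, forall t n, (`]0%R, +oo[%classic : set R) t ->
    (`|(t `^ a)^-1%:E * e n t| <= C%:E * ((t `^ a)^-1%:E * e0 t) + (w t)%:E)%E}.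
  apply: aeW => t n; rewrite /= in_itv/= andbT => t0.
  rewrite gee0_abs ?mule_ge0 ?lee_fin//.
  have g0 : (0 <= C%:E * ((t `^ a)^-1%:E * e0 t))%E by rewrite !mule_ge0 ?lee_fin.
  have [td|td] := leP t d.
    apply: (@le_trans _ _ ((t `^ a)^-1%:E * (C%:E * (e0 t + (t `^ b * l)%:E)))%E).
      by apply: lee_wpmul2l; rewrite ?lee_fin//; apply: small; rewrite t0.
    rewrite muleCA ge0_muleDr ?lee_fin ?mulr_ge0 ?powR_ge0// ge0_muleDr ?mule_ge0 ?lee_fin ?mulr_ge0 ?powR_ge0//.
    apply: leeD2l; rewrite -!EFinM lee_fin /w td powRB; last by rewrite (@gt_eqF _ _ t)//; apply: implybT.
    rewrite mulrDl -[leLHS]addr0 lerD ?mulr_ge0 ?powR_ge0//.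
    by rewrite le_eqVlt; apply/orP; left; apply/eqP; ring.
  apply: (@le_trans _ _ ((t `^ a)^-1%:E * c%:E)%E).
    by apply: lee_wpmul2l; rewrite ?lee_fin//; exact: large.
  apply: (@le_trans _ _ (w t)%:E); last by rewrite leeDr.
  rewrite -EFinM lee_fin /w [t <= d]leNgt td/= powRN mulrC ler_wpM2r//.
  by rewrite lerDr mulr_ge0.
have := @dominated_convergence _ _ _ mu `]0%R, +oo[%classic (measurable_itv _)
  (fun n (t : R) => (t `^ a)^-1%:E * e n t)%E (cst 0%E) _ (fun n => mI _ (me n))
  (measurable_cst _) cv ig dom.
by move=> [_ _]; rewrite integral0.
Qed.

End power_integrals.

Lemma cvg_poweR0 (R : realType) (x : nat -> \bar R) (r : R) : 0 < r ->
  (forall n, 0 <= x n)%E -> x n @[n --> \oo] --> 0%E -> (x n `^ r)%E @[n --> \oo] --> 0%E.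
Proof.
move=> r0 x0 /fine_cvgP[fin /cvgrPdist_lt cv]; apply/fine_cvgP; split.
  by apply: filterS fin => n; exact: fin_num_poweR.
apply/cvgrPdist_lt => e e0.
have e1 : 0 < e `^ r^-1 by rewrite powR_gt0.
apply: filterS (cv _ e1) => n /=; rewrite !sub0r !normrN fine_poweR.
rewrite ger0_norm ?fine_ge0// ger0_norm ?powR_ge0// => h.
have -> : e = (e `^ r^-1) `^ r by rewrite -powRrM mulVf ?gt_eqF// powRr1// ltW.
by rewrite gt0_ltr_powR// nnegrE ?fine_ge0// ltW.
Qed.

Section truncation.
Context {R : realType} {N : nat}.
Local Notation cV := 'cV[R]_N.
Local Notation L := (lebesgue_cV R N).

Definition truncation (n : nat) (X : cV) : R := Num.max 0 (1 - n.+1%:R^-1 * `|X|).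

Lemma truncation_itv n X : 0 <= truncation n X <= 1.
Proof.
rewrite le_max lexx ge_max ler01/= gerDl oppr_le0 mulr_ge0//.
Qed.

Lemma truncation_lipschitz n X Y :
  `|truncation n Y - truncation n X| <= n.+1%:R^-1 * `|Y - X|.
Proof.
have n0 : 0 <= n.+1%:R^-1 :> R by [].
have H (Z W : cV) : truncation n Z <= truncation n W + n.+1%:R^-1 * `|W - Z|.
  rewrite {1}/truncation ge_max; apply/andP; split.
    by rewrite addr_ge0 ?mulr_ge0//; case/andP: (truncation_itv n W).
  apply: (@le_trans _ _ (1 - n.+1%:R^-1 * `|W| + n.+1%:R^-1 * `|W - Z|)).
    have WZ : `|W| <= `|W - Z| + `|Z| by rewrite -{1}[W](subrK Z) ler_normD.
    rewrite -subr_ge0.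
    rewrite [leRHS](_ : _ = n.+1%:R^-1 * (`|W - Z| + `|Z|) - n.+1%:R^-1 * `|W|); last by ring.
    by rewrite subr_ge0 ler_wpM2l.
  by rewrite lerD2r le_max lexx orbT.
rewrite ler_norml; have := H X Y; have := H Y X; rewrite (distrC X Y) => h1 h2.
by rewrite lerBlDl h1 andbT lerNl opprB lerBlDl.
Qed.

Lemma truncation_neq0 n X : truncation n X != 0 -> `|X| < n.+1%:R.
Proof.
apply: contraNT; rewrite -leNgt => nX; rewrite /truncation max_l// subr_le0.
by rewrite ler_pdivlMl ?mulr1.
Qed.

Lemma measurable_truncation n : measurable_fun setT (truncation n).
Proof.
apply: continuous_measurable_matrix.
exact: (lipschitz_continuous (@truncation_lipschitz n)).
Qed.

Lemma truncation_cvg (X : cV) : truncation n X @[n --> \oo] --> (1 : R).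
Proof.
have -> : (fun n => truncation n X) = (fun n => 1 - n.+1%:R^-1 * `|X|) \max cst 0.
  by apply/funext => n; rewrite /truncation/= maxC.
have h : 1 - n.+1%:R^-1 * `|X| @[n --> \oo] --> (1 : R).
  rewrite -[X in _ --> X]subr0 -[X in _ --> _ - X](mul0r `|X|).
  apply: cvgB; first exact: cvg_cst.
  by apply: cvgMl; exact: cvg_harmonic.
apply: squeeze_cvgr h _; last exact: cvg_cst.
apply: nearW => n /=; rewrite le_max lexx/= ge_max ler01 andbT gerDl oppr_le0.
by rewrite mulr_ge0.
Qed.

Lemma truncation_flow n (E : 'M[R]_N) (m : R) (X : cV) : 0 <= m ->
  `|X| <= 2 * `|E *m X| -> `|E *m X - X| <= m * `|X| ->
  `|truncation n (E *m X) - truncation n X| <= 2 * m.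
Proof.
move=> m0 h1 h2.
have [X2|X2] := leP `|X| (2 * n.+1%:R).
  apply: le_trans (truncation_lipschitz n X (E *m X)) _.
  rewrite ler_pdivrMl//; apply: (le_trans h2).
  rewrite (le_trans (ler_wpM2l m0 X2))// le_eqVlt; apply/orP; left; apply/eqP; ring.
have -> : truncation n (E *m X) = 0.
  apply/eqP; apply: contraTT X2 => /truncation_neq0 EX; rewrite -leNgt.
  by rewrite (le_trans h1)// ler_pM2l// ltW.
have -> : truncation n X = 0.
  apply/eqP; apply: contraTT X2 => /truncation_neq0 EX; rewrite -leNgt.
  by rewrite (le_trans (ltW EX))// ler_peMl// ler1n.
by rewrite subrr normr0 mulr_ge0.
Qed.

Variable p : R.
Hypothesis p1 : 1 <= p.
Let p0 : 0 < p := lt_le_trans ltr01 p1.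

Variable f : cV -> R.
Hypothesis mf : measurable_fun setT f.
Hypothesis Lf : (Lpint p f < +oo)%E.

Let mft n : measurable_fun setT (fun X => f X * truncation n X).
Proof. by apply: measurable_funM => //; exact: measurable_truncation. Qed.

Let ft_le n X : `|f X * truncation n X| <= `|f X|.
Proof.
have /andP[t0 t1] := truncation_itv n X.
by rewrite normrM (ger0_norm t0) ler_piMr.
Qed.

Lemma Lpint_truncation_le n : (Lpint p (fun X => (f X * truncation n X)%R) <= Lpint p f)%E.
Proof.
apply: ge0_le_integral_fin.
- exact: measurable_powR_norm.
- exact: measurable_powR_norm.
- by move=> X; exact: powR_ge0.
- by move=> X; apply: ge0_ler_powR; rewrite ?nnegrE ?(ltW p0).
Qed.

Lemma integrable_truncation n :
  L.-integrable setT (EFin \o (fun X => f X * truncation n X)).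
Proof.
have mt := measurable_truncation n.
apply/integrableP; split; first exact/measurable_EFinP.
apply: (@le_lt_trans _ _ (\int[L]_X (truncation n X + `|f X| `^ p)%:E)%E).
  apply: ge0_le_integral_fin.
  - exact: measurableT_comp.
  - by apply: measurable_funD => //; exact: measurable_powR_norm.
  - by move=> X; exact: normr_ge0.
  - move=> X; have /andP[t0 t1] := truncation_itv n X.
    rewrite normrM (ger0_norm t0); have [f1|f1] := leP `|f X| 1.
      by rewrite (le_trans (ler_piMl t0 f1))// lerDl powR_ge0.
    rewrite (le_trans (ler_piMr (normr_ge0 _) t1))// -[leLHS]add0r lerD//.
    by rewrite -{1}[`|f X|]powRr1// ler_powR// ltW.
rewrite -ge0_integralD_fin//.
- apply: lte_add_pinfty => //.
  apply: (@le_lt_trans _ _ (1 * (2 * n.+1%:R) ^+ N)%:E); last exact: ltry.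
  apply: integral_le_cube => //; first exact: truncation_itv.
  by move=> X /truncation_neq0/ltW.
- exact: measurable_powR_norm.
- by move=> X; case/andP: (truncation_itv n X).
Qed.

Lemma Lpint_truncation_cvg :
  Lpint p (fun X => (f X * truncation n X - f X)%R) @[n --> \oo] --> 0%E.
Proof.
apply: (@Lpint_dominated _ _ p p1 (fun n X => f X * truncation n X - f X) f) => //.
- by move=> n; exact: measurable_funB.
- move=> n X; have /andP[t0 t1] := truncation_itv n X.
  rewrite -{2}[f X]mulr1 -mulrBr normrM ler_piMr// ler0_norm ?subr_le0//.
  by rewrite opprB lerBlDr lerDl.
- move=> X; rewrite -[X in _ --> X](subrr (f X)).
  apply: cvgB; last exact: cvg_cst.
  rewrite -[X in _ --> X]mulr1; apply: cvgMr; exact: truncation_cvg.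
Qed.

End truncation.

Section kernel_energy.
Context {R : realType} {N : nat}.
Local Notation cV := 'cV[R]_N.
Local Notation L := (lebesgue_cV R N).
Variables (Q B : 'M[R]_N).
Local Notation kt t := (fun X Y : cV => transition_kernel Q B X Y t).

Lemma measurable2_transition_kernel t : measurable2 (kt t).
Proof.
apply: (measurableT_comp (measurable_transition_kernel Q B)
  (g := fun z : cV * cV => (t, z))).
exact: measurable_fun_pair.
Qed.

Lemma measurable_energy p (F : cV -> cV -> R) : measurable2 F ->
  measurable_fun setT (fun t => energy (kt t) p F).
Proof.
move=> mF.
pose h (w : (R * cV) * cV) :=
  (transition_kernel Q B w.1.2 w.2 w.1.1 * `|F w.1.2 w.2| `^ p)%:E.
have h0 w : (0 <= h w)%E by rewrite lee_fin mulr_ge0 ?powR_ge0 ?transition_kernel_ge0.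
have mh : measurable_fun setT h.
  apply/measurable_EFinP; apply: measurable_funM.
    apply: (measurableT_comp (measurable_transition_kernel Q B)
      (g := fun w : (R * cV) * cV => (w.1.1, (w.1.2, w.2)))).
    apply: measurable_fun_pair => /=; last apply: measurable_fun_pair => //=.
      exact: (measurableT_comp measurable_fst measurable_fst).
    exact: (measurableT_comp measurable_snd measurable_fst).
  apply: measurable_powR_norm.
  apply: (measurableT_comp mF (g := fun w : (R * cV) * cV => (w.1.2, w.2))).
  apply: measurable_fun_pair => //=.
  exact: (measurableT_comp measurable_snd measurable_fst).
have m1 := measurable_fun_fubini_tonelli_F (m2 := L) h mh h0.
apply: (measurable_fun_fubini_tonelli_F (m2 := L) (fun z : R * cV => \int[L]_Y h (z, Y))%E m1).
by move=> z; apply: integral_ge0 => Y _.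
Qed.

Hypothesis N0 : (0 < N)%N.
Hypothesis Qsym : Q^T = Q.
Hypothesis Qpsd : forall X : cV, 0 <= dotcv (Q *m X) X.
Hypothesis Kinv : forall t : R, 0 < t -> covmx Q B t \in unitmx.
Hypothesis trB : 0 <= \tr B.
Variable p : R.
Hypothesis p1 : 1 <= p.
Let p0 : 0 < p := lt_le_trans ltr01 p1.

Lemma energy_regularization_le (rho : cV -> R) phi c : mollifier_spec rho phi c ->
  exists d C, [/\ 0 < d, 0 <= C & forall f n eps l t, measurable_fun setT f ->
    Lpint p f = l%:E -> 0 < eps -> 0 < t <= d ->
    let g X := f X * truncation n X in
    measurable_fun setT (mollify rho eps g) ->
    (energy (kt t) p (fun X Y => ((mollify rho eps g \- f) Y - (mollify rho eps g \- f) X)%R)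
     <= C%:E * (energy (kt t) p (fun X Y => (f Y - f X)%R) + (t `^ (p / 2) * l)%:E))%E].
Proof.
move=> mol.
pose C0 := expR (entry_sum B); have C00 : 0 <= C0 by exact: expR_ge0.
have [d [W [/andP[d0 d1] W0 HW]]] := mollifier_weight mol C00.
have [Cm Cm0 HCm] := integral_transition_kernel_moment Qsym Qpsd Kinv p0.
pose T := 2 `^ p : R; have T0 : 0 < T by rewrite powR_gt0.
pose m := N%:R * C0; have m0 : 0 <= m by rewrite mulr_ge0.
pose c1 := Cm + (2 * m) `^ p; have c10 : 0 <= c1 by rewrite addr_ge0// powR_ge0.
pose c2 := (W + 1) `^ p; have c20 : 0 <= c2 by rewrite powR_ge0.
exists d, (T ^+ 3 + T + T ^+ 4 * c1 + T ^+ 2 * c2); split => //.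
  by rewrite !addr_ge0 ?mulr_ge0 ?exprn_ge0 ?(ltW T0).
move=> f n eps l t mf Lf eps0 /andP[t0 td] g mu.
have t1 : t <= 1 := le_trans td d1.
have [pE E2 E1 EW] : [/\ posdef (expmx (t *: B)),
    forall X : cV, `|X| <= 2 * `|expmx (t *: B) *m X|,
    forall X : cV, `|expmx (t *: B) *m X - X| <= N%:R * C0 * t * `|X| &
    (\int[L]_h `|\det (expmx (t *: B)) * rho (expmx (t *: B) *m h) - rho h|%:E <= (W * t)%:E)%E].
  apply: HW; first by rewrite t0.
  by move=> i j; rewrite mulrC; apply: expmx_sub1_le; rewrite (ltW t0).
have mk := measurable2_transition_kernel t.
have k0 (X Y : cV) : 0 <= transition_kernel Q B X Y t by exact: transition_kernel_ge0.
have k1 (X : cV) : (\int[L]_Y (transition_kernel Q B X Y t)%:E <= 1)%E.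
  by rewrite integral_transition_kernel.
have tp : t `^ p <= t `^ (p / 2).
  by apply: ger_powR; rewrite ?t0// ler_pdivrMr// ler_peMr ?ler1n ?(ltW p0).
have q0 : 0 <= t `^ (p / 2) by exact: powR_ge0.
set q := t `^ (p / 2) in tp q0 *.
have l0 : 0 <= l by rewrite -lee_fin -Lf Lpint_ge0.
have Lf' : (Lpint p f < +oo)%E by rewrite Lf ltry.
have ig : L.-integrable setT (EFin \o g) by exact: (integrable_truncation p1 mf Lf' n).
have mg : measurable_fun setT g.
  by apply: measurable_funM => //; exact: measurable_truncation.
have e1 : (energy (kt t) p (fun X Y => (g Y - g X)%R) <=
    T%:E * (energy (kt t) p (fun X Y => (f Y - f X)%R) + (T * (c1 * q))%:E * l%:E))%E.
  rewrite -Lf.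
  apply: (le_trans (@energy_truncation_le _ _ (kt t) p (expmx (t *: B)) mk k0 p1 k1
    f (truncation n) 1 (2 * (m * t)) (Cm * q) mf (measurable_truncation n) (truncation_itv n)
    ler01 _ _ _ _)).
  - by rewrite !mulr_ge0// ltW.
  - exact: mulr_ge0.
  - move=> X Y; rewrite -[truncation n Y](subrK (truncation n (expmx (t *: B) *m X))).
    rewrite -addrA (le_trans (ler_normD _ _))// lerD//; last first.
      by apply: truncation_flow => //; rewrite mulr_ge0// ltW.
    rewrite (le_trans (truncation_lipschitz _ _ _))// ler_wpM2r//.
    by rewrite invf_le1// ler1n.
  - by move=> X; apply: HCm; rewrite t0.
  apply: lee_wpmul2l; first by rewrite lee_fin ltW.
  rewrite leeD2l//; apply: lee_wpmul2r; first exact: Lpint_ge0.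
  rewrite lee_fin; apply: ler_wpM2l; first exact: ltW.
  rewrite powR1 mul1r [leRHS]mulrDl; apply: lerD => //.
  by rewrite mulrA powRM ?mulr_ge0 ?(ltW t0)// ler_wpM2l// powR_ge0.
have e2 : (energy (kt t) p (fun X Y => (mollify rho eps g Y - mollify rho eps g X)%R) <=
    T%:E * (energy (kt t) p (fun X Y => (g Y - g X)%R) + (c2 * q)%:E * l%:E))%E.
  have [Mr HMr] := mol_bnd mol.
  have uE : expmx (t *: B) \in unitmx.
    by rewrite unitmxE unitfE gt_eqF// posdef_det_gt0.
  have W1 : 0 < (W + 1) * t by rewrite mulr_gt0// ltr_wpDl.
  apply: (le_trans (@energy_mollify_le _ _ (kt t) p (expmx (t *: B)) mk k0 p1 k1
    pE uE _ rho g Mr eps ((W + 1) * t) (mol_meas mol) (mol_ge0 mol) HMr (mol_int mol)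
    eps0 ig W1 _ mu)).
  - by move=> X Y h; apply: transition_kernel_shift.
  - by rewrite (le_trans EW)// lee_fin ler_wpM2r ?(ltW t0)// lerDl.
  apply: lee_wpmul2l; first by rewrite lee_fin ltW.
  rewrite leeD2l//; apply: lee_pmul; rewrite ?lee_fin ?powR_ge0 ?Lpint_ge0//.
    by rewrite powRM ?addr_ge0 ?(ltW t0)// ler_wpM2l.
  by rewrite -Lf; exact: Lpint_truncation_le.
have e3 : (energy (kt t) p
      (fun X Y => ((mollify rho eps g \- f) Y - (mollify rho eps g \- f) X)%R) <=
    T%:E * (energy (kt t) p (fun X Y => (mollify rho eps g Y - mollify rho eps g X)%R) +
      energy (kt t) p (fun X Y => (f Y - f X)%R)))%E.
  apply: energy_add_le => //; try exact: measurable2_diff.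
    by apply: measurable2_diff; exact: measurable_funB.
  move=> X Y /=.
  rewrite (_ : _ - _ = (mollify rho eps g Y - mollify rho eps g X) - (f Y - f X)); last by ring.
  exact: ler_normB.
have A0 : (0 <= energy (kt t) p (fun X Y => (f Y - f X)%R))%E by exact: energy_ge0.
move: e1 e2 e3 A0; move: (energy (kt t) p (fun X Y => (f Y - f X)%R)).
move: (energy (kt t) p (fun X Y => (g Y - g X)%R)).
move: (energy (kt t) p (fun X Y => (mollify rho eps g Y - mollify rho eps g X)%R)).
move: (energy _ _ _) => x3 x2 x1 [A|//|//]; last first.
  move=> _ _ _ _; rewrite addye// gt0_muley ?leey// lte_fin.
  by rewrite !ltr_wpDr ?mulr_ge0 ?exprn_ge0 ?exprn_gt0 ?(ltW T0).
move=> e1 e2 e3; rewrite lee_fin => A0.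
have {}e2 : (x2 <= (T * (T * (A + T * (c1 * q) * l) + c2 * q * l))%:E)%E.
  apply: (le_trans e2); rewrite [leRHS]EFinM; apply: lee_wpmul2l; first by rewrite lee_fin ltW.
  rewrite [leRHS]EFinD -EFinM; apply: leeD2r; apply: (le_trans e1).
  exact: lexx.
apply: (le_trans e3).
apply: (@le_trans _ _ (T * (T * (T * (A + T * (c1 * q) * l) + c2 * q * l) + A))%:E).
  rewrite [leRHS]EFinM; apply: lee_wpmul2l; first by rewrite lee_fin ltW.
  by rewrite [leRHS]EFinD; exact: leeD2r.
rewrite -EFinD -EFinM lee_fin -subr_ge0.
rewrite [leRHS](_ : _ = (T ^+ 4 * c1 + T ^+ 2 * c2) * A + (T ^+ 3 + T) * (q * l)); last by ring.
by rewrite !addr_ge0 ?mulr_ge0 ?addr_ge0 ?mulr_ge0 ?exprn_ge0 ?(ltW T0).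
Qed.

End kernel_energy.

Lemma mollify_bump_convE (R : realType) (N : nat) (rho : 'cV[R]_N -> R) phi c eps (g : 'cV[R]_N -> R) :
  mollifier_spec rho phi c -> 0 < eps -> (lebesgue_cV R N).-integrable setT (EFin \o g) ->
  mollify rho eps g = (fun X => c / eps ^+ N * bump_conv g eps phi X).
Proof.
move=> mol eps0 ig; apply/funext => X; rewrite (mol_def mol).
by apply: mollify_bump_conv => //; exact: mol_class mol.
Qed.

Lemma measurable_mollify (R : realType) (N : nat) (rho : 'cV[R]_N -> R) phi c eps (g : 'cV[R]_N -> R) :
  mollifier_spec rho phi c -> 0 < eps -> (lebesgue_cV R N).-integrable setT (EFin \o g) ->
  measurable_fun setT (mollify rho eps g).
Proof.
move=> mol eps0 ig; rewrite (mollify_bump_convE mol eps0 ig).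
by apply: continuous_measurable_matrix; apply: bump_conv_continuous => //; exact: mol_class mol.
Qed.

Lemma Cc_smooth_mollify (R : realType) (N : nat) (rho : 'cV[R]_N -> R) phi c eps (g : 'cV[R]_N -> R) (M : R) :
  mollifier_spec rho phi c -> 0 < eps <= 1 -> (lebesgue_cV R N).-integrable setT (EFin \o g) ->
  0 <= M -> (forall X, g X != 0 -> `|X| <= M) -> Cc_smooth (mollify rho eps g).
Proof.
move=> mol e01 ig M0 gM; have /andP[eps0 _] := e01; split.
  rewrite (mollify_bump_convE mol eps0 ig).
  by apply: smooth_bump_conv => //; exact: mol_class mol.
apply: (@compact_support _ _ _ (M + 1)); first by rewrite addr_ge0.
exact: (mollify_support mol).
Qed.

Theorem proposition3p2 (R : realType) (N : nat) (Q B : 'M[R]_N) (s p : R)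
  (N1 : (1 <= N)%N)
  (Qsym : Q^T = Q) (Qpsd : forall X : 'cV[R]_N, 0 <= dotcv (Q *m X) X)
  (Kinv : forall t : R, 0 < t -> covmx Q B t \in unitmx)
  (trB : 0 <= \tr B)
  (s01 : 0 < s < 1) (p1 : 1 <= p) :
  besov_closure Q B s p Cc_smooth = besov_space Q B s p.
Proof.
apply/seteqP; split => [f []//|f fB]; split => //.
have [fL fS] := fB; have /andP[s0 s1] := s01.
have p0 : 0 < p := lt_le_trans ltr01 p1.
have pi0 : p^-1 != 0 by rewrite invr_eq0 gt_eqF.
have LnormE (h : 'cV[R]_N -> R) :
    Lnorm (lebesgue_cV R N) p%:E (EFin \o h) = (Lpint p h `^ p^-1)%E.
  by rewrite unlock.
have mf : measurable_fun setT f by move: fL => /andP[]; rewrite inE.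
have Lf : (Lpint p f < +oo)%E.
  have : finite_norm (lebesgue_cV R N) p%:E f by move: fL => /andP[_]; rewrite inE.
  by rewrite /finite_norm LnormE; exact: lty_poweRy.
pose l := fine (Lpint p f).
have lE : Lpint p f = l%:E by rewrite fineK// ge0_fin_numE// Lpint_ge0.
have l0 : 0 <= l by rewrite fine_ge0// Lpint_ge0.
have [rho [phi [c mol]]] := @mollifier_exists R N.
pose g n X := f X * truncation n X.
have ig n : (lebesgue_cV R N).-integrable setT (EFin \o g n).
  exact: (integrable_truncation p1 mf Lf n).
have mg n : measurable_fun setT (g n).
  by apply: measurable_funM => //; exact: measurable_truncation.
have gn n X : g n X != 0 -> `|X| < n.+1%:R.
  by rewrite mulf_eq0 negb_or => /andP[_]; exact: truncation_neq0.
have Lg n : (Lpint p (g n) < +oo)%E.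
  by apply: le_lt_trans Lf; exact: Lpint_truncation_le.
have /choice[eps Heps] : forall n, exists e, 0 < e <= 1 /\
    (Lpint p (mollify rho e (g n) \- g n)%R <= (n.+1%:R^-1)%:E)%E.
  move=> n; have n0 : 0 < n.+1%:R^-1 :> R by rewrite invr_gt0.
  have [e e01 He] := mollify_cvg p1 mol (ltr0Sn R n) n0
    (ig n) (gn n) (Lg n) (fun e h => @measurable_mollify _ _ _ _ _ e h mol).
  by exists e.
have eps0 n : 0 < eps n by have [/andP[]] := Heps n.
pose u n := mollify rho (eps n) (g n).
have mu n : measurable_fun setT (u n) by exact: (measurable_mollify mol (eps0 n) (ig n)).
have muf n : measurable_fun setT (u n \- f) by exact: measurable_funB.
exists u.
  move=> n; apply: (Cc_smooth_mollify mol (proj1 (Heps n)) (ig n) (ler0n _ n.+1)).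
  by move=> X /gn/ltW.
pose T := 2 `^ p : R; have T0 : 0 < T by rewrite powR_gt0.
have Lle n : (Lpint p (u n \- f)%R <= T%:E * ((n.+1%:R^-1)%:E + Lpint p (g n \- f)%R))%E.
  apply: (le_trans (@Lpint_add_le _ _ p _ (u n \- g n) (g n \- f) (ltW p0) (muf n) _ _ _)).
  - exact: measurable_funB.
  - exact: measurable_funB.
  - move=> X /=; rewrite (_ : u n X - f X = (u n X - g n X) + (g n X - f X)) ?ler_normD//.
    by rewrite addrA subrK.
  apply: lee_wpmul2l; first by rewrite lee_fin ltW.
  by apply: leeD2r; have [] := Heps n.
have Lgf : Lpint p (g n \- f)%R @[n --> \oo] --> 0%E.
  exact: (Lpint_truncation_cvg p1 mf Lf).
have Lu : Lpint p (u n \- f)%R @[n --> \oo] --> 0%E.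
  apply: (@squeeze_cvge _ _ _ _ (cst 0%E) _
    (fun n => T%:E * ((n.+1%:R^-1)%:E + Lpint p (g n \- f)%R))%E).
  - by apply: nearW => n; rewrite Lpint_ge0/= Lle.
  - exact: cvg_cst.
  rewrite -(mule0 T%:E); apply: cvgeZl => //.
  rewrite -[X in _ --> X]adde0; apply: cvgeD => //.
  by apply: cvg_EFin; [exact: nearW|exact: cvg_harmonic].
have Lb n : (Lpint p (u n \- f)%R <= (T * (1 + l))%:E)%E.
  apply: (le_trans (Lle n)); rewrite EFinM; apply: lee_wpmul2l; first by rewrite lee_fin ltW.
  rewrite EFinD; apply: leeD; first by rewrite lee_fin invf_le1// ler1n.
  rewrite -lE; apply: ge0_le_integral_fin.
  - by apply: measurable_powR_norm; exact: measurable_funB.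
  - exact: measurable_powR_norm.
  - by move=> X; exact: powR_ge0.
  - move=> X; apply: ge0_ler_powR; rewrite ?nnegrE ?(ltW p0)//=.
    have /andP[t0 t1] := truncation_itv n X.
    rewrite /g -{2}[f X]mulr1 -mulrBr normrM ler_piMr// ler0_norm ?subr_le0//.
    by rewrite opprB lerBlDr lerDl.
split.
  under eq_fun do rewrite LnormE.
  by apply: cvg_poweR0; [rewrite invr_gt0|move=> n; exact: Lpint_ge0|].
pose kt t (X Y : 'cV[R]_N) := transition_kernel Q B X Y t.
pose D (h : 'cV[R]_N -> R) X Y := h Y - h X.
have [d [C [d0 C0 HC]]] := energy_regularization_le N1 Qsym Qpsd Kinv trB p1 mol.
have kt1 t (X : 'cV[R]_N) : 0 < t -> (\int[lebesgue_cV R N]_Y (kt t X Y)%:E <= 1)%E.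
  by move=> t0; rewrite /kt integral_transition_kernel.
have kt1' t (Y : 'cV[R]_N) : 0 < t -> (\int[lebesgue_cV R N]_X (kt t X Y)%:E <= 1)%E.
  by move=> t0; apply: integral_transition_kernel_backward.
have kt0 t (X Y : 'cV[R]_N) : 0 <= kt t X Y by exact: transition_kernel_ge0.
have mkt t : measurable2 (kt t) by exact: measurable2_transition_kernel.
have large n t : 0 < t -> (energy (kt t) p (D (u n \- f)%R) <=
    T%:E * (Lpint p (u n \- f)%R + Lpint p (u n \- f)%R))%E.
  by move=> t0; apply: energy_diff_le => // X; [exact: kt1|exact: kt1'].
have eD0 t h : (0 <= energy (kt t) p (D h))%E by exact: energy_ge0.
have meD h : measurable_fun setT h -> measurable_fun setT (fun t => energy (kt t) p (D h)).
  by move=> mh; apply: measurable_energy; exact: measurable2_diff.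
apply: cvg_poweR0; first by rewrite invr_gt0.
  move=> n; apply: integral_ge0 => t _; apply: mule_ge0; last exact: (eD0 t (u n \- f)%R).
  by rewrite lee_fin invr_ge0 powR_ge0.
apply: (@weighted_integral_cvg0 R (fun n t => energy (kt t) p (D (u n \- f)%R))
  (fun t => energy (kt t) p (D f)) (s * p / 2 + 1) (p / 2) (T * (T * (1 + l) + T * (1 + l))) l d C) => //.
- by move=> n; exact: meD.
- exact: meD.
- by rewrite ltrDr divr_gt0// mulr_gt0.
- rewrite opprD addrA ltrBrDr addNr -mulrBl divr_gt0// subr_gt0.
  by rewrite gtr_pMl.
- by rewrite mulr_ge0 ?addr_ge0 ?mulr_ge0 ?addr_ge0 ?(ltW T0).
- by move: fS; exact: lty_poweRy.
- move=> n t t0d; exact: (HC f n (eps n) l t mf lE (eps0 n) t0d (mu n)).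
- move=> n t t0; apply: (le_trans (large n t t0)).
  rewrite EFinM; apply: lee_wpmul2l; first by rewrite lee_fin ltW.
  by rewrite EFinD; apply: leeD; exact: Lb.
- move=> t t0; apply: (@squeeze_cvge _ _ _ _ (cst 0%E) _
    (fun n => T%:E * (Lpint p (u n \- f)%R + Lpint p (u n \- f)%R))%E).
  + by apply: nearW => n; rewrite eD0/= large.
  + exact: cvg_cst.
  rewrite -(mule0 T%:E); apply: cvgeZl => //.
  by rewrite -[X in _ --> X]adde0; apply: cvgeD.
Qed.
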